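(* Let $\lambda>0$, $\tilde\sigma>0$, $b>0$ be constants. Suppose that $f\in C^1([0,\infty))$, $f(t)>0$ for $t\ge 0$, $\varphi\in C^2([0,b])$, $\varphi(x)>0$ for $x\in[0,b]$, and $$f(0)=\varphi(0),\qquad f'(0)=\varphi''(0)-\lambda\varphi(0),\qquad \varphi'(b)=0.$$ Then there exists a unique pair of functions $u(x,t)$ and $s(t)>0$ such that: (i) $u(x,t)$ is defined, continuous and has continuous partial derivatives $u_x,u_t,u_{xx}$ in the domain $\{(x,t):\ 0\le x\le s(t),\ t\ge 0\}$; (ii) $s\in C^1([0,\infty))$; (iii) the following hold: $$u_t=u_{xx}-\lambda u,\quad 0<x<s(t),\ t>0;$$ $$s'(t)=\int_0^{s(t)}\bigl(u(x,t)-\tilde\sigma\bigr)\,dx,\quad t>0;$$ $$u(0,t)=f(t),\quad t\ge 0;$$ $$u(x,0)=\varphi(x),\quad x\in[0,b],\qquad s(0)=b;$$ $$u_x(s(t),t)=0,\quad t>0.$$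
   Context: At boundary points of the (closed) domain, partial derivatives are understood as one-sided derivatives where necessary, equivalently as continuous extensions of the derivatives from the interior. *)

(* Defs.v *)
From Stdlib Require Export Reals.
From Coquelicot Require Export Coquelicot.
Open Scope R_scope.

Definition half_line : R -> Prop := fun t => 0 <= t.
Definition segment (b : R) : R -> Prop := fun x => 0 <= x <= b.

(** The derivative of [f] at [x] relative to [D]: two-sided at interior points
    of an interval [D], one-sided at its endpoints. *)
Definition is_derive_on (D : R -> Prop) (f : R -> R) (x l : R) : Prop :=
  filterlim (fun y => (f y - f x) / (y - x)) (within D (locally' x)) (locally l).

(** [f1], resp. [f1] and [f2], are the derivatives of [f]; on a nondegenerate
    interval [D] they are determined on [D] by [f]. *)
Definition C1_on (D : R -> Prop) (f f1 : R -> R) : Prop :=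
  (forall x, D x -> is_derive_on D f x (f1 x)) /\ continuous_on D f1.

Definition C2_on (D : R -> Prop) (f f1 f2 : R -> R) : Prop :=
  C1_on D f f1 /\ C1_on D f1 f2.

Definition closed_domain (s : R -> R) : R * R -> Prop :=
  fun p => 0 <= fst p <= s (snd p) /\ 0 <= snd p.

Definition open_domain (s : R -> R) : R * R -> Prop :=
  fun p => 0 < fst p < s (snd p) /\ 0 < snd p.

Definition continuous_on_closed (s : R -> R) (v : R -> R -> R) : Prop :=
  continuous_on (closed_domain s) (fun p => v (fst p) (snd p)).

(** [ux], [ut], [uxx] are the partial derivatives of [u] on the closed domain:
    the ordinary ones in the open domain, and their continuous extensions at
    the boundary.  As the open domain is dense in the closed one when [s] is
    positive and continuous, [u] determines them on the closed domain. *)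
Definition is_partials (s : R -> R) (u ux ut uxx : R -> R -> R) : Prop :=
  (forall x t, open_domain s (x, t) ->
     is_derive (fun y => u y t) x (ux x t) /\
     is_derive (fun r => u x r) t (ut x t) /\
     is_derive (fun y => ux y t) x (uxx x t)) /\
  continuous_on_closed s ux /\
  continuous_on_closed s ut /\
  continuous_on_closed s uxx.

(** Only the values of [u] on the closed domain and of [s] on the half-line
    are constrained. *)
Definition is_solution (lambda sigma b : R) (f phi : R -> R)
    (u : R -> R -> R) (s : R -> R) : Prop :=
  (forall t, 0 <= t -> 0 < s t) /\
  continuous_on_closed s u /\
  exists (s1 : R -> R) (ux ut uxx : R -> R -> R),
    C1_on half_line s s1 /\
    is_partials s u ux ut uxx /\
    (forall x t, 0 < x < s t -> 0 < t -> ut x t = uxx x t - lambda * u x t) /\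
    (forall t, 0 < t -> s1 t = RInt (fun x => u x t - sigma) 0 (s t)) /\
    (forall t, 0 <= t -> u 0 t = f t) /\
    (forall x, 0 <= x <= b -> u x 0 = phi x) /\
    s 0 = b /\
    (forall t, 0 < t -> ux (s t) t = 0).

(* Main.v *)
(** Put [u = exp (- lambda t) w (x / s(t), t)] and [s(t) = b exp (int_0^t rho)].
    The problem becomes [w_t = w_yy / s^2 + y rho w_y] on the fixed interval
    [0 <= y <= 1], with [w = exp (lambda t) f] at [0], [w_y = 0] at [1], and
    [rho = exp (- lambda t) int_0^1 w dy - sigma], which is a fixed point equation
    for [rho].  The maximum principle bounds the iterates, and applied to the
    difference of the solutions for two choices of [rho] it gives a contraction in
    a norm weighted by [exp (k t)], hence existence and uniqueness on every [0, T].
    For given [rho] the boundary value at [0] is subtracted by a combination of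
    exponentially decaying time-periodic solutions on the half-line; the drift
    [y rho w_y] is handled by a Neumann series; and the heat equation with a
    right-hand side and zero boundary values is solved by Duhamel's formula for
    finite sine sums, damped by the coefficients of a positive trigonometric kernel.
    The convergence of these sums up to the second derivative requires no heat
    kernel: the maximum principle for [p] and for Bernstein's function
    [p^2 + 2 tau (p_x)^2] gives [|p_x| <= sup |p(0)| / sqrt tau], which is
    integrable in time. *)
Require Import Defs.
From Stdlib Require Import Reals Lra Lia Psatz ClassicalEpsilon.
From Coquelicot Require Import Coquelicot.
Open Scope R_scope.

(** The delicate point is the corner at the origin of space and time. The second derivative must be
    continuous up to t = 0 and up to the boundary, and this is what the compatibility conditions
    buy: in the variables of the overview they read F(0) = p(0), F'(0) = p''(0) and p'(b) = 0. After
    the lifted boundary value is subtracted, the initial profile vanishes at 0 together with its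
    second derivative, and its damped sine sums converge uniformly up to the second derivative.
    Every bound that enters the contraction has to be independent of the unknown [rho]. The maximum
    principle bounds the iterates by the data alone, hence |rho| <= L for a fixed L, and the
    constants for the first and second derivatives are chosen from T, b, L and the data before [rho]
    is. An arbitrary competing solution is known only on its own moving domain. For uniqueness it is
    therefore identified with a linear solution built for its own boundary, and this copy enters the
    contraction argument. *)

Definition cont1 (f : R -> R) : Prop := forall x, continuous f x.
(** Continuity is asked on the whole line or plane although only a rectangle matters: functions are
    first extended by clamping their arguments, and no domain has to be carried through the
    calculus. *)
Definition cont2 (f : R -> R -> R) : Prop := forall x y, continuity_2d_pt f x y.

Lemma cont2_eps (f : R -> R -> R) (x y e : R) : cont2 f -> 0 < e ->
  exists d, 0 < d /\
    forall u v, Rabs (u - x) < d -> Rabs (v - y) < d -> Rabs (f u v - f x y) < e.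
Proof.
intros H He. destruct (H x y (mkposreal e He)) as [d Hd].
exists d; split; [apply cond_pos | exact Hd].
Qed.

Lemma cont2_comp (f g h : R -> R -> R) : cont2 f -> cont2 g -> cont2 h ->
  cont2 (fun x y => f (g x y) (h x y)).
Proof.
intros Hf Hg Hh x y e. destruct (Hf (g x y) (h x y) e) as [d Hd].
destruct (Hg x y d) as [d1 H1]. destruct (Hh x y d) as [d2 H2].
assert (Hm : 0 < Rmin d1 d2) by (apply Rmin_pos; apply cond_pos).
exists (mkposreal _ Hm); simpl; intros u v Hu Hv.
pose proof (Rmin_l d1 d2); pose proof (Rmin_r d1 d2).
apply Hd; [apply H1 | apply H2]; lra.
Qed.

Lemma cont1_pt (f : R -> R) (x : R) : cont1 f -> continuity_pt f x.
Proof. intros H; apply continuity_pt_filterlim, H. Qed.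

Lemma cont1_intro (f : R -> R) : (forall x, continuity_pt f x) -> cont1 f.
Proof. intros H x; apply continuity_pt_filterlim, H. Qed.

Lemma cont1_eps (f : R -> R) (x e : R) : cont1 f -> 0 < e ->
  exists d, 0 < d /\ forall u, Rabs (u - x) < d -> Rabs (f u - f x) < e.
Proof.
intros H He. specialize (H x). apply filterlim_locally with (eps := mkposreal e He) in H.
destruct H as [d Hd]. exists d; split; [apply cond_pos | exact Hd].
Qed.

Lemma cont1_of_eps (f : R -> R) :
  (forall x e, 0 < e -> exists d, 0 < d /\ forall u, Rabs (u - x) < d -> Rabs (f u - f x) < e) ->
  cont1 f.
Proof.
intros H x. apply filterlim_locally. intros e.
destruct (H x e (cond_pos e)) as (d & Hd & Hd'). exists (mkposreal d Hd). exact Hd'.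
Qed.

Lemma cont2_comp1 (f : R -> R) (g : R -> R -> R) : cont1 f -> cont2 g ->
  cont2 (fun x y => f (g x y)).
Proof.
intros Hf Hg x y. apply continuity_1d_2d_pt_comp; [apply cont1_pt, Hf | apply Hg].
Qed.

Lemma cont2_const (c : R) : cont2 (fun _ _ => c).
Proof. intros x y; apply continuity_2d_pt_const. Qed.
Lemma cont2_fst : cont2 (fun x _ => x).
Proof. intros x y; apply continuity_2d_pt_id1. Qed.
Lemma cont2_snd : cont2 (fun _ y => y).
Proof. intros x y; apply continuity_2d_pt_id2. Qed.
Lemma cont2_plus (f g : R -> R -> R) : cont2 f -> cont2 g -> cont2 (fun x y => f x y + g x y).
Proof. intros Hf Hg x y; apply continuity_2d_pt_plus; auto. Qed.
Lemma cont2_minus (f g : R -> R -> R) : cont2 f -> cont2 g -> cont2 (fun x y => f x y - g x y).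
Proof. intros Hf Hg x y; apply continuity_2d_pt_minus; auto. Qed.
Lemma cont2_mult (f g : R -> R -> R) : cont2 f -> cont2 g -> cont2 (fun x y => f x y * g x y).
Proof. intros Hf Hg x y; apply continuity_2d_pt_mult; auto. Qed.
Lemma cont2_opp (f : R -> R -> R) : cont2 f -> cont2 (fun x y => - f x y).
Proof. intros Hf x y; apply continuity_2d_pt_opp; auto. Qed.
Lemma cont2_inv (f : R -> R -> R) : cont2 f -> (forall x y, f x y <> 0) -> cont2 (fun x y => / f x y).
Proof. intros Hf H x y; apply continuity_2d_pt_inv; auto. Qed.
Lemma cont2_div (f g : R -> R -> R) : cont2 f -> cont2 g -> (forall x y, g x y <> 0) ->
  cont2 (fun x y => f x y / g x y).
Proof. intros Hf Hg H; apply cont2_mult; [|apply cont2_inv]; auto. Qed.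
Lemma cont2_pow (f : R -> R -> R) (n : nat) : cont2 f -> cont2 (fun x y => f x y ^ n).
Proof.
intros Hf; induction n; simpl; [apply cont2_const | apply cont2_mult; assumption].
Qed.


Lemma cont2_diag (f : R -> R -> R) (g h : R -> R) : cont2 f -> cont1 g -> cont1 h ->
  cont1 (fun t => f (g t) (h t)).
Proof.
intros Hf Hg Hh. apply cont1_of_eps. intros t e He.
destruct (cont2_eps f (g t) (h t) e Hf He) as (d & Hd & H).
destruct (cont1_eps g t d Hg Hd) as (d1 & Hd1 & H1).
destruct (cont1_eps h t d Hh Hd) as (d2 & Hd2 & H2).
exists (Rmin d1 d2); split; [apply Rmin_pos; auto|].
intros u Hu. pose proof (Rmin_l d1 d2); pose proof (Rmin_r d1 d2).
apply H; [apply H1 | apply H2]; lra.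
Qed.

Lemma cont1_id : cont1 (fun x => x).
Proof. intros x; apply continuous_id. Qed.
Lemma cont1_const (c : R) : cont1 (fun _ => c).
Proof. intros x; apply continuous_const. Qed.
Lemma cont1_plus (f g : R -> R) : cont1 f -> cont1 g -> cont1 (fun x => f x + g x).
Proof. intros Hf Hg x; apply (continuous_plus f g); auto. Qed.
Lemma cont1_minus (f g : R -> R) : cont1 f -> cont1 g -> cont1 (fun x => f x - g x).
Proof. intros Hf Hg x; apply (continuous_minus f g); auto. Qed.
Lemma cont1_opp (f : R -> R) : cont1 f -> cont1 (fun x => - f x).
Proof. intros Hf x; apply (continuous_opp f); auto. Qed.
Lemma cont1_mult (f g : R -> R) : cont1 f -> cont1 g -> cont1 (fun x => f x * g x).
Proof. intros Hf Hg x; apply (continuous_mult f g); auto. Qed.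
Lemma cont1_comp (f g : R -> R) : cont1 f -> cont1 g -> cont1 (fun x => f (g x)).
Proof. intros Hf Hg x; apply continuous_comp; auto. Qed.
Lemma cont1_inv (f : R -> R) : cont1 f -> (forall x, f x <> 0) -> cont1 (fun x => / f x).
Proof.
intros Hf H. apply cont1_intro. intros x.
apply continuity_pt_inv; [apply cont1_pt, Hf | apply H].
Qed.
Lemma cont1_div (f g : R -> R) : cont1 f -> cont1 g -> (forall x, g x <> 0) ->
  cont1 (fun x => f x / g x).
Proof. intros; apply cont1_mult; [|apply cont1_inv]; auto. Qed.
Lemma cont1_pow (f : R -> R) (n : nat) : cont1 f -> cont1 (fun x => f x ^ n).
Proof. intros Hf; induction n; simpl; [apply cont1_const | apply cont1_mult; auto]. Qed.
Lemma cont1_exp : cont1 exp.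
Proof. apply cont1_intro; intros x; apply derivable_continuous_pt, derivable_pt_exp. Qed.
Lemma cont1_sin : cont1 sin.
Proof. apply cont1_intro; intros x; apply continuity_sin. Qed.
Lemma cont1_cos : cont1 cos.
Proof. apply cont1_intro; intros x; apply continuity_cos. Qed.
Lemma cont1_abs : cont1 Rabs.
Proof. intros x; apply continuity_pt_filterlim, Rcontinuity_abs. Qed.
Lemma cont1_derive (f f1 : R -> R) : (forall x, is_derive f x (f1 x)) -> cont1 f.
Proof. intros H x. apply (ex_derive_continuous f). exists (f1 x); apply H. Qed.

(** Partial applications such as [Rmult c] have clauses of their own, because goals often arrive
    eta-reduced. Side conditions on denominators are left as goals. *)
Ltac cont_step :=
  match goal with
  | H : cont1 ?f |- cont1 ?f => exact H
  | H : cont2 ?f |- cont2 ?f => exact H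
  | |- cont1 (fun _ => ?c) => apply (cont1_const c)
  | |- cont1 (fun x => x) => apply cont1_id
  | |- cont1 (Rmult ?c) => apply (cont1_mult (fun _ => c) (fun y => y))
  | |- cont1 (Rplus ?c) => apply (cont1_plus (fun _ => c) (fun y => y))
  | |- cont1 (Rminus ?c) => apply (cont1_minus (fun _ => c) (fun y => y))
  | |- cont1 Ropp => apply (cont1_opp (fun y => y))
  | |- cont1 exp => apply cont1_exp
  | |- cont1 sin => apply cont1_sin
  | |- cont1 cos => apply cont1_cos
  | |- cont1 Rabs => apply cont1_abs
  | |- cont1 (fun x => exp _) => apply (cont1_comp exp); [apply cont1_exp|]
  | |- cont1 (fun x => sin _) => apply (cont1_comp sin); [apply cont1_sin|]
  | |- cont1 (fun x => cos _) => apply (cont1_comp cos); [apply cont1_cos|]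
  | |- cont1 (fun x => Rabs _) => apply (cont1_comp Rabs); [apply cont1_abs|]
  | |- cont1 (fun x => _ + _) => apply cont1_plus
  | |- cont1 (fun x => _ - _) => apply cont1_minus
  | |- cont1 (fun x => _ * _) => apply cont1_mult
  | |- cont1 (fun x => - _) => apply cont1_opp
  | |- cont1 (fun x => _ / _) => apply cont1_div
  | |- cont1 (fun x => / _) => apply cont1_inv
  | |- cont1 (fun x => _ ^ _) => apply cont1_pow
  | H : cont2 ?f |- cont1 (fun x => ?f _ _) => apply (cont2_diag f); [exact H| |]
  | H : cont2 ?f |- cont1 (?f ?c) => apply (cont2_diag f (fun _ => c) (fun y => y)); [exact H| |]
  | H : cont1 ?f |- cont1 (fun x => ?f _) => apply (cont1_comp f); [exact H|]
  | |- cont2 (fun _ _ => ?c) => apply (cont2_const c)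
  | |- cont2 (fun x _ => x) => apply cont2_fst
  | |- cont2 (fun _ y => y) => apply cont2_snd
  | |- cont2 (fun _ _ => exp _) => apply (cont2_comp1 exp); [apply cont1_exp|]
  | |- cont2 (fun _ _ => sin _) => apply (cont2_comp1 sin); [apply cont1_sin|]
  | |- cont2 (fun _ _ => cos _) => apply (cont2_comp1 cos); [apply cont1_cos|]
  | |- cont2 (fun _ _ => Rabs _) => apply (cont2_comp1 Rabs); [apply cont1_abs|]
  | |- cont2 (fun _ _ => _ + _) => apply cont2_plus
  | |- cont2 (fun _ _ => _ - _) => apply cont2_minus
  | |- cont2 (fun _ _ => _ * _) => apply cont2_mult
  | |- cont2 (fun _ _ => - _) => apply cont2_opp
  | |- cont2 (fun _ _ => _ / _) => apply cont2_div
  | |- cont2 (fun _ _ => / _) => apply cont2_inv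
  | |- cont2 (fun _ _ => _ ^ _) => apply cont2_pow
  | H : cont2 ?f |- cont2 (fun _ _ => ?f _ _) => apply (cont2_comp f); [exact H| |]
  | H : cont1 ?f |- cont2 (fun _ _ => ?f _) => apply (cont2_comp1 f); [exact H|]
  end.
Ltac cont := repeat cont_step.

Lemma derive_const (c x : R) : is_derive (fun _ : R => c) x 0.
Proof. exact (is_derive_const c x). Qed.
Lemma derive_id (x : R) : is_derive (fun y : R => y) x 1.
Proof. exact (is_derive_id x). Qed.
Lemma derive_plus (f g : R -> R) (x a b : R) : is_derive f x a -> is_derive g x b ->
  is_derive (fun y => f y + g y) x (a + b).
Proof. exact (is_derive_plus f g x a b). Qed.
Lemma derive_minus (f g : R -> R) (x a b : R) : is_derive f x a -> is_derive g x b ->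
  is_derive (fun y => f y - g y) x (a - b).
Proof. exact (is_derive_minus f g x a b). Qed.
Lemma derive_opp (f : R -> R) (x a : R) : is_derive f x a -> is_derive (fun y => - f y) x (- a).
Proof. exact (is_derive_opp f x a). Qed.
Lemma derive_mult (f g : R -> R) (x a b : R) : is_derive f x a -> is_derive g x b ->
  is_derive (fun y => f y * g y) x (a * g x + f x * b).
Proof.
intros Hf Hg. apply (is_derive_mult f g x a b); auto. intros; apply Rmult_comm.
Qed.
Lemma derive_comp (f g : R -> R) (x a b : R) : is_derive f (g x) b -> is_derive g x a ->
  is_derive (fun y => f (g y)) x (a * b).
Proof. exact (is_derive_comp f g x b a). Qed.
Lemma derive_inv (f : R -> R) (x a : R) : is_derive f x a -> f x <> 0 ->
  is_derive (fun y => / f y) x (- a / f x ^ 2).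
Proof. exact (is_derive_inv f x a). Qed.
Lemma derive_pow (f : R -> R) (n : nat) (x a : R) : is_derive f x a ->
  is_derive (fun y => f y ^ n) x (INR n * a * f x ^ pred n).
Proof. exact (is_derive_pow f n x a). Qed.
Lemma derive_exp (f : R -> R) (x a : R) : is_derive f x a ->
  is_derive (fun y => exp (f y)) x (a * exp (f x)).
Proof. apply (derive_comp exp). apply is_derive_Reals, derivable_pt_lim_exp. Qed.
Lemma derive_sin (f : R -> R) (x a : R) : is_derive f x a ->
  is_derive (fun y => sin (f y)) x (a * cos (f x)).
Proof. apply (derive_comp sin). apply is_derive_Reals, derivable_pt_lim_sin. Qed.
Lemma derive_cos (f : R -> R) (x a : R) : is_derive f x a ->
  is_derive (fun y => cos (f y)) x (a * - sin (f x)).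
Proof. apply (derive_comp cos). apply is_derive_Reals, derivable_pt_lim_cos. Qed.

Ltac der_step :=
  match goal with
  | |- is_derive (fun _ => ?c) _ _ => apply (derive_const c)
  | |- is_derive (fun y => y) _ _ => apply derive_id
  | |- is_derive _ _ _ => eassumption
  | |- is_derive (Rmult ?c) _ _ => apply (derive_mult (fun _ => c) (fun y => y))
  | |- is_derive (Rplus ?c) _ _ => apply (derive_plus (fun _ => c) (fun y => y))
  | |- is_derive (Rminus ?c) _ _ => apply (derive_minus (fun _ => c) (fun y => y))
  | |- is_derive Ropp _ _ => apply (derive_opp (fun y => y))
  | |- is_derive (fun y => _ + _) _ _ => apply derive_plus
  | |- is_derive (fun y => _ - _) _ _ => apply derive_minus
  | |- is_derive (fun y => - _) _ _ => apply derive_opp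
  | |- is_derive (fun y => _ * _) _ _ => apply derive_mult
  | |- is_derive (fun y => _ / _) _ _ => apply derive_mult
  | |- is_derive (fun y => / _) _ _ => apply derive_inv
  | |- is_derive (fun y => _ ^ _) _ _ => apply derive_pow
  | |- is_derive (fun y => exp _) _ _ => apply derive_exp
  | |- is_derive (fun y => sin _) _ _ => apply derive_sin
  | |- is_derive (fun y => cos _) _ _ => apply derive_cos
  | H : forall x, is_derive ?f x _ |- is_derive (fun y => ?f _) _ _ => apply (derive_comp f); [apply H|]
  end.
(** The rules compute a derivative; the goal that remains is its equality with the claimed value. *)
Ltac der := evar_last; [repeat der_step | simpl].

Lemma exp_le (x y : R) : x <= y -> exp x <= exp y.
Proof. intros [H | ->]; [apply Rlt_le, exp_increasing, H|lra]. Qed.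

Lemma ratio_unit (x s : R) : 0 < s -> 0 <= x <= s -> 0 <= x / s <= 1.
Proof.
intros Hs Hx. split; [apply Rdiv_le_0_compat; lra|]. apply Rmult_le_reg_r with s; [exact Hs|].
unfold Rdiv. rewrite Rmult_assoc, Rinv_l; lra.
Qed.

Lemma RInt_scal_cont1 (f : R -> R) (c a b : R) : cont1 f ->
  RInt (fun x => c * f x) a b = c * RInt f a b :> R.
Proof. intros H. apply (RInt_scal f), (ex_RInt_continuous f). intros; apply H. Qed.

Lemma RInt_plus_cont1 (f g : R -> R) (a b : R) : cont1 f -> cont1 g ->
  RInt (fun x => f x + g x) a b = RInt f a b + RInt g a b :> R.
Proof. intros H K. apply (RInt_plus f g); apply ex_RInt_continuous; intros; [apply H|apply K]. Qed.

Lemma RInt_minus_cont1 (f g : R -> R) (a b : R) : cont1 f -> cont1 g ->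
  RInt (fun x => f x - g x) a b = RInt f a b - RInt g a b :> R.
Proof. intros H K. apply (RInt_minus f g); apply ex_RInt_continuous; intros; [apply H|apply K]. Qed.

Lemma RInt_point_R (f : R -> R) (a : R) : RInt f a a = 0 :> R.
Proof. apply (RInt_point a f). Qed.

Lemma RInt_const_R (a b c : R) : RInt (fun _ => c) a b = (b - a) * c :> R.
Proof. rewrite RInt_const. reflexivity. Qed.

(** * Clamping, extreme values, integrals and mean value inequalities *)

Definition clamp (a b x : R) : R := Rmax a (Rmin b x).

Lemma clamp_in (a b x : R) : a <= b -> a <= clamp a b x <= b.
Proof. intros; unfold clamp, Rmax, Rmin; repeat destruct Rle_dec; lra. Qed.

Lemma clamp_id (a b x : R) : a <= x <= b -> clamp a b x = x.
Proof. intros; unfold clamp, Rmax, Rmin; repeat destruct Rle_dec; lra. Qed.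

Lemma clamp_lip (a b x y : R) : Rabs (clamp a b x - clamp a b y) <= Rabs (x - y).
Proof.
unfold clamp, Rmax, Rmin; repeat destruct Rle_dec; unfold Rabs; repeat destruct Rcase_abs; lra.
Qed.

Lemma cont1_clamp (a b : R) : cont1 (clamp a b).
Proof.
apply cont1_of_eps. intros x e He. exists e; split; auto.
intros u Hu. eapply Rle_lt_trans; [apply clamp_lip | exact Hu].
Qed.

(** A maximiser in [x] is chosen for every [y]. The choice may jump with [y], but uniform continuity
    makes the maximal value continuous, and the one-dimensional theorem applies to it. *)
Lemma evt2 (v : R -> R -> R) (a b c d : R) : cont2 v -> a <= b -> c <= d ->
  exists x y, a <= x <= b /\ c <= y <= d /\
    forall x' y', a <= x' <= b -> c <= y' <= d -> v x' y' <= v x y.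
Proof.
intros Hv Hab Hcd.
assert (Hmax : forall y, exists x, a <= x <= b /\ forall x', a <= x' <= b -> v x' y <= v x y).
{ intros y. destruct (continuity_ab_maj (fun x => v x y) a b Hab) as (x & H1 & H2).
  - intros x _. apply cont1_pt. cont.
  - exists x; auto. }
set (X := fun y => proj1_sig (constructive_indefinite_description _ (Hmax y))).
assert (HX : forall y, a <= X y <= b /\ forall x', a <= x' <= b -> v x' y <= v (X y) y).
{ intros y; unfold X; destruct constructive_indefinite_description; auto. }
assert (Hm : cont1 (fun y => v (X y) y)).
{ apply cont1_of_eps. intros y e He.
  destruct (uniform_continuity_2d v a b (y - 1) (y + 1) (fun x y _ _ => Hv x y) (mkposreal e He))
    as [d' Hd']. simpl in Hd'.
  exists (Rmin 1 d'); split; [apply Rmin_pos; [lra | apply cond_pos]|].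
  intros u Hu. pose proof (Rmin_l 1 d'); pose proof (Rmin_r 1 d').
  assert (A : Rabs (v (X y) u - v (X y) y) < e).
  { apply Hd'; try apply HX.
    - lra.
    - apply Rabs_def2 in Hu; lra.
    - replace (X y - X y) with 0 by ring. rewrite Rabs_R0; apply cond_pos.
    - lra. }
  assert (B : Rabs (v (X u) u - v (X u) y) < e).
  { apply Hd'; try apply HX.
    - lra.
    - apply Rabs_def2 in Hu; lra.
    - replace (X u - X u) with 0 by ring. rewrite Rabs_R0; apply cond_pos.
    - lra. }
  pose proof (proj2 (HX u) (X y) (proj1 (HX y))).
  pose proof (proj2 (HX y) (X u) (proj1 (HX u))).
  apply Rabs_def2 in A; apply Rabs_def2 in B; apply Rabs_def1; lra. }
destruct (continuity_ab_maj (fun y => v (X y) y) c d Hcd) as (y & H1 & H2).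
{ intros y _; apply cont1_pt, Hm. }
exists (X y), y; split; [apply HX|split; [exact H2|]].
intros x' y' Hx Hy. apply Rle_trans with (v (X y') y'); [apply HX; auto | apply H1; auto].
Qed.

Lemma bounded2 (v : R -> R -> R) (a b c d : R) : cont2 v -> a <= b -> c <= d ->
  exists M, 0 < M /\ forall x y, a <= x <= b -> c <= y <= d -> Rabs (v x y) <= M.
Proof.
intros Hv Hab Hcd.
destruct (evt2 (fun x y => Rabs (v x y)) a b c d) as (x & y & _ & _ & H); auto.
{ cont. }
exists (Rabs (v x y) + 1); split; [pose proof (Rabs_pos (v x y)); lra|].
intros x' y' Hx Hy. specialize (H x' y' Hx Hy). lra.
Qed.

Lemma bounded1 (f : R -> R) (a b : R) : cont1 f -> a <= b ->
  exists M, 0 < M /\ forall x, a <= x <= b -> Rabs (f x) <= M.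
Proof.
intros Hf Hab. destruct (bounded2 (fun x _ => f x) a b 0 0) as (M & HM & H); try lra.
- cont.
- exists M; split; auto. intros x Hx; apply (H x 0); lra.
Qed.

Lemma ex_RInt_cont1 (f : R -> R) (a b : R) : cont1 f -> ex_RInt f a b.
Proof. intros H; apply (ex_RInt_continuous f); intros; apply H. Qed.

Lemma is_derive_RInt_cont1 (f : R -> R) (a t : R) : cont1 f ->
  is_derive (fun x => RInt f a x) t (f t).
Proof.
intros H. apply (is_derive_RInt f (RInt f a) a t); [|apply H].
exists (mkposreal 1 Rlt_0_1). intros y _. apply (RInt_correct f), ex_RInt_cont1, H.
Qed.

Lemma cont1_RInt (f : R -> R) (a : R) : cont1 f -> cont1 (fun x => RInt f a x).
Proof. intros H. apply (cont1_derive _ f). intros; apply is_derive_RInt_cont1, H. Qed.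

Lemma mvt_open (g g1 : R -> R) (a b : R) : a < b ->
  (forall x, a <= x <= b -> continuity_pt g x) ->
  (forall x, a < x < b -> is_derive g x (g1 x)) ->
  exists c, a < c < b /\ g b - g a = g1 c * (b - a).
Proof.
intros Hab Hc Hd.
assert (pr : forall c, a < c < b -> derivable_pt g c).
{ intros c Hcc. exists (g1 c). apply is_derive_Reals, Hd, Hcc. }
destruct (MVT g id a b pr (fun c _ => derivable_pt_id c) Hab Hc) as (c & P & E);
  [intros; apply derivable_continuous_pt, derivable_pt_id|].
exists c; split; auto.
rewrite derive_pt_id in E; unfold id in E.
assert (E2 : derive_pt g c (pr c P) = g1 c)
  by (apply derive_pt_eq_0; apply is_derive_Reals, Hd, P).
rewrite E2 in E; lra.
Qed.

Lemma mono_open (g g1 : R -> R) (a b : R) : a <= b ->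
  (forall x, a <= x <= b -> continuity_pt g x) ->
  (forall x, a < x < b -> is_derive g x (g1 x)) ->
  (forall x, a < x < b -> 0 <= g1 x) -> g a <= g b.
Proof.
intros Hab Hc Hd H. destruct (Req_dec a b) as [->|Hn]; [lra|].
destruct (mvt_open g g1 a b) as (c & Hc1 & E); auto; [lra|].
specialize (H c Hc1). assert (0 <= g1 c * (b - a)) by (apply Rmult_le_pos; lra). lra.
Qed.

Lemma lipschitz_open (g g1 : R -> R) (a b M : R) : cont1 g ->
  (forall x, a < x < b -> is_derive g x (g1 x)) ->
  (forall x, a < x < b -> Rabs (g1 x) <= M) ->
  forall x y, a <= x <= b -> a <= y <= b -> Rabs (g x - g y) <= M * Rabs (x - y).
Proof.
intros Hg Hd HM.
assert (K : forall x y, a <= x -> x < y -> y <= b -> Rabs (g y - g x) <= M * Rabs (y - x)).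
{ intros x y Hx Hxy Hy. destruct (mvt_open g g1 x y) as (c & Hc & E); auto.
  - intros; apply cont1_pt, Hg.
  - intros; apply Hd; lra.
  - rewrite E, Rabs_mult. apply Rmult_le_compat_r; [apply Rabs_pos | apply HM; lra]. }
intros x y Hx Hy. destruct (Rtotal_order x y) as [H|[->|H]].
- rewrite (Rabs_minus_sym (g x)), (Rabs_minus_sym x). apply K; lra.
- rewrite !Rminus_diag, Rabs_R0; lra.
- apply K; lra.
Qed.

Lemma ftc_open (g g1 : R -> R) (a b : R) : a <= b -> cont1 g -> cont1 g1 ->
  (forall x, a < x < b -> is_derive g x (g1 x)) -> RInt g1 a b = g b - g a :> R.
Proof.
intros Hab Hg Hg1 Hd. destruct (Req_dec a b) as [->|Hn].
{ rewrite RInt_point_R. lra. }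
destruct (mvt_open (fun x => g x - RInt g1 a x) (fun _ => 0) a b) as (c & _ & E); try lra.
- intros x _. apply cont1_pt. apply cont1_minus; [exact Hg | apply cont1_RInt, Hg1].
- intros x Hx. evar_last; [apply (is_derive_minus g); [apply Hd, Hx | apply is_derive_RInt_cont1, Hg1]|].
  apply Rminus_diag.
- rewrite RInt_point_R in E. lra.
Qed.

(** The functions [H - s * RInt g a] with s = 1 and s = -1 are both nondecreasing. Only [H] has to
    be continuous at the endpoints, so the bound [h] may blow up there, like an inverse square
    root. *)
Lemma abs_RInt_le_prim (g H h : R -> R) (a b : R) : a <= b -> cont1 g -> cont1 H ->
  (forall r, a < r < b -> is_derive H r (h r)) ->
  (forall r, a < r < b -> Rabs (g r) <= h r) -> Rabs (RInt g a b) <= H b - H a.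
Proof.
intros Hab Hg HH Hd Hle.
assert (K : forall s, (s = 1 \/ s = -1) -> s * RInt g a b <= H b - H a).
{ intros s Hs.
  enough (E : H a - s * RInt g a a <= H b - s * RInt g a b)
    by (rewrite RInt_point_R in E; lra).
  apply (mono_open (fun x => H x - s * RInt g a x) (fun x => h x - s * g x) a b Hab).
  - intros x _. apply cont1_pt. apply cont1_minus; [exact HH|].
    apply cont1_mult; [apply cont1_const | apply cont1_RInt, Hg].
  - intros x Hx. apply (is_derive_minus H); [apply Hd, Hx|].
    apply (is_derive_scal (RInt g a)), is_derive_RInt_cont1, Hg.
  - intros x Hx. specialize (Hle x Hx). apply Rabs_le_between in Hle.
    destruct Hs as [-> | ->]; lra. }
apply Rabs_le. pose proof (K 1 (or_introl eq_refl)). pose proof (K (-1) (or_intror eq_refl)). lra.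
Qed.

Lemma abs_RInt_le (g : R -> R) (a b M : R) : a <= b -> cont1 g ->
  (forall r, a <= r <= b -> Rabs (g r) <= M) -> Rabs (RInt g a b) <= M * (b - a).
Proof.
intros Hab Hg Hle. replace (M * (b - a)) with (M * b - M * a) by ring.
apply (abs_RInt_le_prim g (fun r => M * r) (fun _ => M)); auto.
- cont.
- intros r _. auto_derive; [exact I | ring].
- intros r Hr; apply Hle; lra.
Qed.

Lemma cont1_RInt_param (f : R -> R -> R) (a b : R) : cont2 f -> a <= b ->
  cont1 (fun t => RInt (fun x => f x t) a b).
Proof.
intros Hf Hab. apply cont1_of_eps. intros t e He.
(* The summand 1 keeps the denominator positive when a = b. *)
assert (He' : 0 < e / (b - a + 1)) by (apply Rdiv_lt_0_compat; lra).
destruct (uniform_continuity_2d_1d f a b t (fun x _ => Hf x t) (mkposreal _ He')) as [d Hd].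
simpl in Hd. exists d; split; [apply cond_pos|].
intros u Hu.
assert (E : RInt (fun x => f x u) a b - RInt (fun x => f x t) a b
            = RInt (fun x => f x u - f x t) a b).
{ symmetry. apply (RInt_minus_cont1 (fun x => f x u) (fun x => f x t)); cont. }
rewrite E.
apply Rle_lt_trans with (e / (b - a + 1) * (b - a)).
- apply abs_RInt_le; [exact Hab | cont |].
  intros r Hr. apply Rlt_le. apply Hd; try lra.
  + pose proof (cond_pos d); lra.
  + apply Rabs_def2 in Hu; lra.
  + rewrite Rminus_diag, Rabs_R0; apply cond_pos.
- apply Rmult_lt_reg_r with (b - a + 1); [lra|].
  replace (e / (b - a + 1) * (b - a) * (b - a + 1)) with (e * (b - a)) by (field; lra). nra.
Qed.

(** Total differentiability at the point follows from the continuity of one partial derivative and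
    the mere existence of the other. *)
Lemma is_derive_chain2 (w w1 : R -> R -> R) (g : R -> R) (t dg wt : R) :
  cont2 w1 -> is_derive g t dg -> is_derive (fun r => w (g t) r) t wt ->
  (exists d, 0 < d /\ forall x r, Rabs (x - g t) < d -> Rabs (r - t) < d ->
     is_derive (fun z => w z r) x (w1 x r)) ->
  is_derive (fun r => w (g r) r) t (w1 (g t) t * dg + wt).
Proof.
intros Hw1 Hg Ht (d & Hd & Hx).
assert (D : differentiable_pt_lim w (g t) t (w1 (g t) t) wt).
{ apply filterdiff_differentiable_pt_lim.
  apply (is_derive_filterdiff w (g t) t w1 wt).
  - exists (mkposreal d Hd). intros [u v] [Hu Hv]. apply Hx; [exact Hu | exact Hv].
  - exact Ht.
  - apply continuity_2d_pt_filterlim, Hw1. }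
apply is_derive_Reals.
replace (w1 (g t) t * dg + wt) with (w1 (g t) t * dg + wt * 1) by ring.
apply (derivable_pt_lim_comp_2d w g (fun r => r)); auto.
- apply is_derive_Reals, Hg.
- apply derivable_pt_lim_id.
Qed.

(** * Uniform limits of classical solutions on a rectangle *)

Definition in_rect (X T x t : R) : Prop := 0 <= x <= X /\ 0 <= t <= T.

(** The derivatives in [x] are required at t = 0 and t = T as well, because the lifted boundary
    value is differentiated in [x] at time 0 to form the initial profile. At the other boundary
    points the derivatives are continuous extensions. *)
Definition rect_C21 (X T : R) (w w1 w2 wt : R -> R -> R) : Prop :=
  (cont2 w /\ cont2 w1 /\ cont2 w2 /\ cont2 wt) /\
  (forall x t, 0 < x < X -> 0 <= t <= T ->
     is_derive (fun y => w y t) x (w1 x t) /\ is_derive (fun y => w1 y t) x (w2 x t)) /\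
  (forall x t, 0 < x < X -> 0 < t < T -> is_derive (fun r => w x r) t (wt x t)).

Definition ucauchy (X T : R) (G : nat -> R -> R -> R) : Prop :=
  forall e, 0 < e -> exists N, forall n m, (N <= n)%nat -> (N <= m)%nat ->
    forall x t, in_rect X T x t -> Rabs (G n x t - G m x t) <= e.

Definition ulimit (X T : R) (G : nat -> R -> R -> R) (g : R -> R -> R) : Prop :=
  forall e, 0 < e -> exists N, forall n, (N <= n)%nat ->
    forall x t, in_rect X T x t -> Rabs (G n x t - g x t) <= e.

Lemma Un_cv_le_bound (u : nat -> R) (l a e : R) (N : nat) :
  Un_cv u l -> (forall n, (N <= n)%nat -> Rabs (u n - a) <= e) -> Rabs (l - a) <= e.
Proof.
intros Hu H. apply le_epsilon. intros d Hd.
destruct (Hu d Hd) as [N' HN']. specialize (H (max N N') ltac:(lia)).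
specialize (HN' (max N N') ltac:(lia)). unfold Rdist in HN'.
replace (l - a) with ((u (max N N') - a) - (u (max N N') - l)) by ring.
eapply Rle_trans; [apply Rabs_triang|]. rewrite Rabs_Ropp. lra.
Qed.

(** The limit is taken of the clamped functions, which makes it continuous on the whole plane and
    not only on the rectangle. *)
Lemma ucauchy_limit (X T : R) (G : nat -> R -> R -> R) : 0 <= X -> 0 <= T ->
  (forall n, cont2 (G n)) -> ucauchy X T G ->
  exists g, cont2 g /\ ulimit X T G g.
Proof.
intros HX HT Hc HG.
assert (Hl : forall x t, {l | Un_cv (fun n => G n (clamp 0 X x) (clamp 0 T t)) l}).
{ intros x t. apply Rcomplete.R_complete. intros e He.
  destruct (HG (e / 2)) as [N HN]; [lra|]. exists N. intros n m Hn Hm.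
  unfold Rdist. assert (Rabs (G n (clamp 0 X x) (clamp 0 T t) - G m (clamp 0 X x) (clamp 0 T t)) <= e / 2).
  { apply HN; try lia. split; apply clamp_in; auto. }
  lra. }
pose (g := fun x t => proj1_sig (Hl x t)).
assert (Hu : forall e, 0 < e -> exists N, forall n, (N <= n)%nat -> forall x t,
  Rabs (g x t - G n (clamp 0 X x) (clamp 0 T t)) <= e).
{ intros e He. destruct (HG e He) as [N HN]. exists N. intros n Hn x t.
  apply (Un_cv_le_bound (fun n => G n (clamp 0 X x) (clamp 0 T t)) _ _ _ N).
  - unfold g; destruct (Hl x t); auto.
  - intros m Hm. apply HN; auto. split; apply clamp_in; auto. }
exists g; split.
- intros x t e. destruct (Hu (e / 3)) as [N HN]; [pose proof (cond_pos e); lra|].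
  pose (h := fun x t => G N (clamp 0 X x) (clamp 0 T t)).
  assert (Hh : cont2 h).
  { unfold h. specialize (Hc N). pose proof (cont1_clamp 0 X). pose proof (cont1_clamp 0 T). cont. }
  destruct (cont2_eps h x t (e / 3) Hh) as (d & Hd & Hd'); [pose proof (cond_pos e); lra|].
  exists (mkposreal d Hd). intros u v Huu Hvv. simpl in *.
  specialize (Hd' u v Huu Hvv). pose proof (HN N (le_n _) u v) as A.
  pose proof (HN N (le_n _) x t) as B. fold (h u v) in A. fold (h x t) in B.
  apply Rabs_def2 in Hd'. apply Rabs_le_between in A. apply Rabs_le_between in B.
  apply Rabs_def1; lra.
- intros e He. destruct (Hu e He) as [N HN]. exists N. intros n Hn x t [Hx Ht].
  specialize (HN n Hn x t). rewrite !clamp_id in HN by assumption.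
  rewrite Rabs_minus_sym; exact HN.
Qed.

Lemma ulimit_cv (X T : R) (G : nat -> R -> R -> R) (g : R -> R -> R) (x t : R) :
  ulimit X T G g -> in_rect X T x t -> Un_cv (fun n => G n x t) (g x t).
Proof.
intros H Hxt e He. destruct (H (e / 2)) as [N HN]; [lra|].
exists N. intros n Hn. unfold Rdist. specialize (HN n Hn x t Hxt). lra.
Qed.

Lemma is_derive_limit (f f1 : nat -> R -> R) (g g1 : R -> R) (a b x : R) : a < x < b ->
  (forall n y, a < y < b -> is_derive (f n) y (f1 n y)) ->
  (forall y, a < y < b -> Un_cv (fun n => f n y) (g y)) ->
  (forall e, 0 < e -> exists N, forall n, (N <= n)%nat ->
     forall y, a < y < b -> Rabs (f1 n y - g1 y) <= e) ->
  is_derive g x (g1 x).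
Proof.
intros Hx Hd Hcv Hu. apply is_derive_Reals.
assert (Hr : 0 < Rmin (x - a) (b - x)) by (apply Rmin_pos; lra).
pose proof (Rmin_l (x - a) (b - x)). pose proof (Rmin_r (x - a) (b - x)).
assert (HB : forall y, Boule x (mkposreal _ Hr) y -> a < y < b).
{ intros y Hy. unfold Boule in Hy; simpl in Hy. apply Rabs_def2 in Hy. lra. }
apply (CVU_derivable f f1 g g1 x (mkposreal _ Hr)).
- intros e He. destruct (Hu (e / 2)) as [N HN]; [lra|]. exists N. intros n y Hn Hy.
  specialize (HN n Hn y (HB y Hy)). rewrite Rabs_minus_sym. lra.
- intros y Hy; apply Hcv, HB, Hy.
- intros n y Hy. apply is_derive_Reals, Hd, HB, Hy.
- unfold Boule; simpl. rewrite Rminus_diag, Rabs_R0; exact Hr.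
Qed.

Lemma rect_C21_limit (X T : R) (w w1 w2 wt : nat -> R -> R -> R) : 0 < X -> 0 < T ->
  (forall n, rect_C21 X T (w n) (w1 n) (w2 n) (wt n)) ->
  ucauchy X T w -> ucauchy X T w1 -> ucauchy X T w2 -> ucauchy X T wt ->
  exists v v1 v2 vt, rect_C21 X T v v1 v2 vt /\
    ulimit X T w v /\ ulimit X T w1 v1 /\ ulimit X T w2 v2 /\ ulimit X T wt vt.
Proof.
intros HX HT Hw C C1 C2 Ct.
destruct (ucauchy_limit X T w) as (v & Hv & Lv); try lra; [apply Hw|exact C|].
destruct (ucauchy_limit X T w1) as (v1 & Hv1 & Lv1); try lra; [apply Hw|exact C1|].
destruct (ucauchy_limit X T w2) as (v2 & Hv2 & Lv2); try lra; [apply Hw|exact C2|].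
destruct (ucauchy_limit X T wt) as (vt & Hvt & Lvt); try lra; [apply Hw|exact Ct|].
exists v, v1, v2, vt. split; [|auto]. split; [auto|]. split.
- intros x t Hx Ht. split.
  + apply (is_derive_limit (fun n y => w n y t) (fun n y => w1 n y t) _ (fun y => v1 y t) 0 X); auto.
    * intros n y Hy. apply Hw; auto.
    * intros y Hy. apply (ulimit_cv X T w); auto. split; lra.
    * intros e He. destruct (Lv1 e He) as [N HN]. exists N. intros n Hn y Hy.
      apply HN; auto. split; lra.
  + apply (is_derive_limit (fun n y => w1 n y t) (fun n y => w2 n y t) _ (fun y => v2 y t) 0 X); auto.
    * intros n y Hy. apply Hw; auto.
    * intros y Hy. apply (ulimit_cv X T w1); auto. split; lra.
    * intros e He. destruct (Lv2 e He) as [N HN]. exists N. intros n Hn y Hy.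
      apply HN; auto. split; lra.
- intros x t Hx Ht.
  apply (is_derive_limit (fun n y => w n x y) (fun n y => wt n x y) _ (fun y => vt x y) 0 T); auto.
  + intros n y Hy. apply Hw; auto.
  + intros y Hy. apply (ulimit_cv X T w); auto. split; lra.
  + intros e He. destruct (Lvt e He) as [N HN]. exists N. intros n Hn y Hy.
    apply HN; auto. split; lra.
Qed.

Lemma rect_closure (X T : R) (g h : R -> R -> R) : 0 < X -> 0 < T -> cont2 g -> cont2 h ->
  (forall x t, 0 < x < X -> 0 < t < T -> g x t = h x t) ->
  forall x t, in_rect X T x t -> g x t = h x t.
Proof.
intros HX HT Hg Hh E x t [Hx Ht].
destruct (Req_dec (g x t - h x t) 0) as [|Hne]; [lra|exfalso].
assert (Hc : cont2 (fun x t => g x t - h x t)) by cont.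
destruct (cont2_eps _ x t (Rabs (g x t - h x t)) Hc) as (d & Hd & H); [apply Rabs_pos_lt, Hne|].
assert (Hk : forall Y z, 0 < Y -> 0 <= z <= Y -> exists z', 0 < z' < Y /\ Rabs (z' - z) < d).
{ intros Y z HY Hz. pose (k := Rmin (Y / 3) (d / 2)).
  assert (0 < k) by (apply Rmin_pos; lra).
  pose proof (Rmin_l (Y / 3) (d / 2)); pose proof (Rmin_r (Y / 3) (d / 2)). fold k in H1, H2.
  (* The point moves towards the middle of the interval by at most a third of its length. *)
  destruct (Rle_dec z (Y / 2)); [exists (z + k) | exists (z - k)]; split; try lra;
    apply Rabs_def1; lra. }
destruct (Hk X x HX Hx) as (x' & Hx' & Dx). destruct (Hk T t HT Ht) as (t' & Ht' & Dt).
specialize (H x' t' Dx Dt). rewrite (E x' t' Hx' Ht') in H.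
rewrite Rminus_diag, Rminus_0_l, Rabs_Ropp in H. lra.
Qed.

(** The Neumann condition lets [w1] be integrated from 1, the Dirichlet condition lets [w] be
    integrated from 0, and on an interval of length 1 no constant is lost. Estimates and convergence
    therefore have to be proved for the second derivative only. *)
Lemma second_derivative_bound (w w1 w2 : R -> R) (M : R) : cont1 w -> cont1 w1 ->
  (forall x, 0 < x < 1 -> is_derive w x (w1 x) /\ is_derive w1 x (w2 x)) ->
  w 0 = 0 -> w1 1 = 0 -> (forall x, 0 <= x <= 1 -> Rabs (w2 x) <= M) ->
  forall x, 0 <= x <= 1 -> Rabs (w1 x) <= M /\ Rabs (w x) <= M.
Proof.
intros Hw Hw1 Hd E0 E1 HM.
assert (HM0 : 0 <= M) by (eapply Rle_trans; [apply Rabs_pos | apply (HM 0); lra]).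
assert (A : forall x, 0 <= x <= 1 -> Rabs (w1 x) <= M).
{ intros x Hx. replace (w1 x) with (w1 x - w1 1) by lra.
  eapply Rle_trans.
  - apply (lipschitz_open w1 w2 0 1 M); auto; try lra; [apply Hd | intros; apply HM; lra].
  - rewrite <- (Rmult_1_r M) at 2. apply Rmult_le_compat_l; [exact HM0|]. apply Rabs_le; lra. }
intros x Hx; split; [auto|]. replace (w x) with (w x - w 0) by lra.
eapply Rle_trans.
- apply (lipschitz_open w w1 0 1 M); auto; try lra; [apply Hd | intros; apply A; lra].
- rewrite <- (Rmult_1_r M) at 2. apply Rmult_le_compat_l; [exact HM0|]. apply Rabs_le; lra.
Qed.

(** * Maximum principles *)

Lemma derive_pos_strict (g : R -> R) (x l : R) : is_derive g x l -> 0 < l ->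
  exists d, 0 < d /\ forall h, 0 < h < d -> g (x - h) < g x < g (x + h).
Proof.
intros Hd Hl. apply is_derive_Reals in Hd. destruct (Hd l Hl) as [d H].
exists d; split; [apply cond_pos|]. intros h Hh. split.
- specialize (H (- h) ltac:(lra)). rewrite Rabs_Ropp, (Rabs_pos_eq h) in H by lra.
  specialize (H ltac:(lra)). apply Rabs_def2 in H. destruct H as [_ H].
  assert (E : g (x + - h) - g x = (g (x + - h) - g x) / - h * - h) by (field; lra).
  unfold Rminus at 1. nra.
- specialize (H h ltac:(lra)). rewrite (Rabs_pos_eq h) in H by lra.
  specialize (H ltac:(lra)). apply Rabs_def2 in H. destruct H as [_ H].
  assert (E : g (x + h) - g x = (g (x + h) - g x) / h * h) by (field; lra). nra.
Qed.

Lemma left_max_derive (g : R -> R) (x l d : R) : is_derive g x l -> 0 < d ->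
  (forall h, 0 < h < d -> g (x - h) <= g x) -> 0 <= l.
Proof.
intros Hd Hp Hm. destruct (Rle_dec 0 l) as [|Hn]; [auto|exfalso].
destruct (derive_pos_strict (fun y => - g y) x (- l)) as (d' & Hd' & H);
  [apply (is_derive_opp g x l Hd) | lra |].
pose (h := Rmin d d' / 2). assert (0 < Rmin d d') by (apply Rmin_pos; auto).
pose proof (Rmin_l d d'); pose proof (Rmin_r d d').
specialize (H h ltac:(unfold h; lra)). specialize (Hm h ltac:(unfold h; lra)). lra.
Qed.

Lemma right_max_derive (g : R -> R) (x l d : R) : is_derive g x l -> 0 < d ->
  (forall h, 0 < h < d -> g (x + h) <= g x) -> l <= 0.
Proof.
intros Hd Hp Hm. destruct (Rle_dec l 0) as [|Hn]; [auto|exfalso].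
destruct (derive_pos_strict g x l) as (d' & Hd' & H); [auto | lra |].
pose (h := Rmin d d' / 2). assert (0 < Rmin d d') by (apply Rmin_pos; auto).
pose proof (Rmin_l d d'); pose proof (Rmin_r d d').
specialize (H h ltac:(unfold h; lra)). specialize (Hm h ltac:(unfold h; lra)). lra.
Qed.

(* A one-sided maximum is enough at a critical point: this also serves the endpoints. *)
Lemma max_second_derive (g g1 : R -> R) (x l d : R) : 0 < d ->
  (forall y, Rabs (y - x) < d -> is_derive g y (g1 y)) -> is_derive g1 x l -> g1 x = 0 ->
  (forall h, 0 < h < d -> g (x - h) <= g x) \/ (forall h, 0 < h < d -> g (x + h) <= g x) ->
  l <= 0.
Proof.
intros Hp Hd Hl E Hm. destruct (Rle_dec l 0) as [|Hn]; [auto|exfalso].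
destruct (derive_pos_strict g1 x l Hl) as (d' & Hd' & H); [lra|].
pose (h := Rmin d d' / 2). assert (0 < Rmin d d') by (apply Rmin_pos; auto).
pose proof (Rmin_l d d'); pose proof (Rmin_r d d'). assert (Hh : 0 < h) by (unfold h; lra).
assert (Hc : forall y, Rabs (y - x) < d -> continuity_pt g y).
{ intros y Hy. apply derivable_continuous_pt. exists (g1 y). apply is_derive_Reals, Hd, Hy. }
destruct Hm as [Hm|Hm].
- destruct (mvt_open g g1 (x - h) x) as (c & Hc1 & E2); [lra| | |].
  + intros y Hy. apply Hc. apply Rabs_def1; unfold h in *; lra.
  + intros y Hy. apply Hd. apply Rabs_def1; unfold h in *; lra.
  + specialize (Hm h ltac:(unfold h; lra)).
    destruct (H (x - c)) as [K _]; [unfold h in *; lra|].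
    replace (x - (x - c)) with c in K by ring. nra.
- destruct (mvt_open g g1 x (x + h)) as (c & Hc1 & E2); [lra| | |].
  + intros y Hy. apply Hc. apply Rabs_def1; unfold h in *; lra.
  + intros y Hy. apply Hd. apply Rabs_def1; unfold h in *; lra.
  + specialize (Hm h ltac:(unfold h; lra)).
    destruct (H (c - x)) as [_ K]; [unfold h in *; lra|].
    replace (x + (c - x)) with c in K by ring. nra.
Qed.

Lemma interior_max (g g1 : R -> R) (x l r : R) : 0 < r ->
  (forall y, Rabs (y - x) < r -> is_derive g y (g1 y)) -> is_derive g1 x l ->
  (forall y, Rabs (y - x) < r -> g y <= g x) -> g1 x = 0 /\ l <= 0.
Proof.
intros Hr Hd Hl Hm.
assert (Hx : is_derive g x (g1 x)) by (apply Hd; rewrite Rminus_diag, Rabs_R0; exact Hr).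
assert (Hleft : forall h, 0 < h < r -> g (x - h) <= g x) by (intros h Hh; apply Hm; apply Rabs_def1; lra).
assert (E : g1 x = 0).
{ apply Rle_antisym.
  - apply (right_max_derive g x _ r); auto. intros h Hh; apply Hm; apply Rabs_def1; lra.
  - apply (left_max_derive g x _ r); auto. }
split; [exact E|]. apply (max_second_derive g g1 x l r); auto.
Qed.

Lemma max_principle_moving (T Cc : R) (s : R -> R) (D D1 D2 Dt a c : R -> R -> R) (mu m : R -> R) :
  0 < T -> 0 <= Cc -> cont1 s -> (forall t, 0 <= t <= T -> 0 < s t) -> cont1 mu ->
  cont2 (fun y t => D (s (clamp 0 T t) * clamp 0 1 y) (clamp 0 T t)) ->
  (forall x t, 0 < t < T -> 0 < x < s t ->
     is_derive (fun y => D y t) x (D1 x t) /\ is_derive (fun y => D1 y t) x (D2 x t) /\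
     is_derive (fun r => D x r) t (Dt x t)) ->
  (forall x t, 0 < t < T -> 0 < x < s t -> 0 <= a x t /\ Rabs (c x t) <= Cc /\
     (mu t < D x t -> Dt x t <= a x t * D2 x t + c x t * D1 x t + m t)) ->
  (forall t e, 0 < t < T -> 0 < e -> exists d, 0 < d /\
     forall x, 0 < x -> s t - d < x < s t -> D1 x t < e) ->
  (forall t, 0 < t < T -> is_derive mu t (m t)) -> (forall t, 0 <= t <= T -> 0 <= mu t) ->
  (forall t, 0 <= t <= T -> D 0 t <= mu t) -> (forall x, 0 <= x <= s 0 -> D x 0 <= mu 0) ->
  forall x t, 0 <= t <= T -> 0 <= x <= s t -> D x t <= mu t.
Proof.
intros HT HCc Hs Hsp Hmu HD Hder Hpde Hneu Hmud Hmup Hd0 Hi.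
assert (Hlt : forall y0 t0, 0 <= t0 < T -> 0 <= y0 <= 1 -> D (s t0 * y0) t0 <= mu t0).
{ intros y0 t0 Ht0 Hy0. destruct (Rle_dec (D (s t0 * y0) t0) (mu t0)) as [|Hn]; [auto|exfalso].
  set (P := D (s t0 * y0) t0 - mu t0) in *. assert (HP : 0 < P) by (unfold P; lra).
  pose proof (Hsp t0 ltac:(lra)) as Hst0.
  (* With e = P / (2 B) the penalty takes away less than half of the excess [P] at the chosen
     point. *)
  set (B := s t0 * y0 + (Cc + 1) * t0 + 1).
  assert (HB : 0 < B) by (unfold B; nra).
  set (e := P / (2 * B)). assert (He : 0 < e) by (apply Rdiv_lt_0_compat; lra).
  assert (HeB : e * B = P / 2) by (unfold e; field; lra).
  pose (v := fun y t => D (s (clamp 0 T t) * clamp 0 1 y) (clamp 0 T t) - mu t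
                        - e * (s t * y) - e * (Cc + 1) * t).
  assert (Hv : cont2 v) by (unfold v; cont).
  assert (Ev : forall y t, 0 <= y <= 1 -> 0 <= t <= T ->
     v y t = D (s t * y) t - mu t - e * (s t * y) - e * (Cc + 1) * t).
  { intros y t Hy Ht. unfold v. rewrite !clamp_id by lra. reflexivity. }
  destruct (evt2 v 0 1 0 t0 Hv) as (y & t & Hy & Ht & Hmax); try lra.
  assert (Hpos : 0 < v y t).
  { apply Rlt_le_trans with (v y0 t0); [|apply Hmax; lra].
    rewrite Ev by lra. unfold B in HeB. fold P. nra. }
  assert (HEt : v y t = D (s t * y) t - mu t - e * (s t * y) - e * (Cc + 1) * t) by (apply Ev; lra).
  pose proof (Hsp t ltac:(lra)) as Hst.
  assert (Hx0 : 0 <= s t * y) by nra.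
  assert (Hb : 0 <= e * (s t * y) /\ 0 <= e * (Cc + 1) * t).
  { split; [nra|]. apply Rmult_le_pos; [nra|lra]. }
  assert (Ht1 : 0 < t).
  { destruct (Req_dec t 0) as [E|]; [exfalso|lra]. rewrite E in *. pose proof (Hi (s 0 * y) ltac:(nra)). lra. }
  assert (Hy1 : 0 < y).
  { destruct (Req_dec y 0) as [E|]; [exfalso|lra]. rewrite E, Rmult_0_r in *. pose proof (Hd0 t ltac:(lra)). lra. }
  assert (Hspace : forall x, 0 <= x <= s t -> D x t - e * x <= D (s t * y) t - e * (s t * y)).
  { intros x Hx. assert (Hq : 0 <= x / s t <= 1).
    { apply ratio_unit; lra. }
    specialize (Hmax (x / s t) t Hq Ht). rewrite (Ev (x / s t) t) in Hmax by lra.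
    replace (s t * (x / s t)) with x in Hmax by (field; lra). lra. }
  assert (Hy2 : y < 1).
  { destruct (Req_dec y 1) as [E|]; [exfalso|lra]. rewrite E, Rmult_1_r in *.
    (* Near the moving end the slope of [D] is below [e], whereas maximality at the end forces a
       mean slope of at least [e]. *)
    destruct (Hneu t e ltac:(lra) He) as (d & Hd & Hd1).
    set (z := s t - Rmin d (s t) / 2). assert (0 < Rmin d (s t)) by (apply Rmin_pos; lra).
    pose proof (Rmin_l d (s t)); pose proof (Rmin_r d (s t)).
    pose (g := fun x => D (s (clamp 0 T t) * clamp 0 1 (x / s t)) (clamp 0 T t)).
    assert (Hg : cont1 g).
    { unfold g. apply (cont2_diag _ (fun x => x / s t) (fun _ => t) HD); cont. intros; lra. }
    assert (Eg : forall x, 0 <= x <= s t -> g x = D x t).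
    { intros x Hx. unfold g. rewrite (clamp_id 0 T) by lra. rewrite clamp_id.
      - f_equal. field; lra.
      - apply ratio_unit; lra. }
    destruct (mvt_open g (fun x => D1 x t) z (s t)) as (k & Hk & Ek); [unfold z; lra| | |].
    - intros; apply cont1_pt, Hg.
    - intros x Hx. apply (is_derive_ext_loc (fun y => D y t)).
      + assert (Hr : 0 < Rmin x (s t - x)) by (apply Rmin_pos; unfold z in *; lra).
        exists (mkposreal _ Hr). intros u Hu. simpl in Hu.
        pose proof (Rmin_l x (s t - x)); pose proof (Rmin_r x (s t - x)).
        apply Rabs_def2 in Hu. unfold minus, plus, opp in Hu; simpl in Hu. symmetry; apply Eg. lra.
      + apply Hder; unfold z in *; lra.
    - rewrite !Eg in Ek by (unfold z; lra).
      specialize (Hspace z ltac:(unfold z; lra)).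
      specialize (Hd1 k ltac:(unfold z in *; lra) ltac:(unfold z in *; lra)).
      nra. }
  set (x := s t * y) in *. assert (Hx : 0 < x < s t) by (unfold x; nra).
  assert (HtT : 0 < t < T) by lra.
  destruct (Hder x t HtT Hx) as (HD1 & HD2 & HDt).
  set (r := Rmin x (s t - x)). assert (Hr : 0 < r) by (apply Rmin_pos; lra).
  assert (Hr2 : r <= x /\ r <= s t - x) by (split; [apply Rmin_l|apply Rmin_r]).
  assert (Hdg : forall z, Rabs (z - x) < r -> is_derive (fun z => D z t - e * z) z (D1 z t - e)).
  { intros z Hz. apply Rabs_def2 in Hz. destruct (Hder z t HtT ltac:(lra)) as (Hz1 & _).
    der. ring. }
  destruct (interior_max (fun z => D z t - e * z) (fun z => D1 z t - e) x (D2 x t) r) as [E1 E2]; auto.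
  { der. ring. }
  { intros z Hz. apply Rabs_def2 in Hz. apply Hspace. lra. }
  assert (E3 : 0 <= Dt x t - (m t + e * (Cc + 1))).
  (* At slightly earlier times the same [x] still lies inside the moving domain, so the earlier
     values can be compared. *)
  { destruct (cont1_eps s t (s t - x) Hs) as (d & Hd & Hds); [lra|].
    apply (left_max_derive (fun r => D x r - (mu r + e * (Cc + 1) * r)) t _ (Rmin d t)).
    - specialize (Hmud t HtT). der. ring.
    - apply Rmin_pos; lra.
    - intros h Hh. pose proof (Rmin_l d t); pose proof (Rmin_r d t).
      specialize (Hds (t - h)). replace (t - h - t) with (- h) in Hds by ring.
      rewrite Rabs_Ropp, Rabs_pos_eq in Hds by lra. specialize (Hds ltac:(lra)).
      apply Rabs_def2 in Hds.
      assert (Hq : 0 <= x / s (t - h) <= 1).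
      { apply ratio_unit; lra. }
      specialize (Hmax (x / s (t - h)) (t - h) Hq ltac:(lra)).
      rewrite (Ev (x / s (t - h)) (t - h)) in Hmax by lra.
      replace (s (t - h) * (x / s (t - h))) with x in Hmax by (field; lra). lra. }
  destruct (Hpde x t HtT Hx) as (Ha & Hc & Hp).
  specialize (Hp ltac:(lra)). replace (D1 x t) with e in Hp by lra. apply Rabs_le_between in Hc. nra. }
(* Time derivatives exist only before [T]; the final time is reached by continuity. *)
assert (Hall : forall y t, 0 <= t <= T -> 0 <= y <= 1 -> D (s t * y) t <= mu t).
{ intros y t Ht Hy. destruct (Rlt_dec t T) as [H|H]; [apply Hlt; lra|].
  assert (t = T) by lra. subst t. destruct (Rle_dec (D (s T * y) T) (mu T)) as [|Hn]; [auto|exfalso].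
  pose (v := fun y t => D (s (clamp 0 T t) * clamp 0 1 y) (clamp 0 T t) - mu t).
  assert (Hv : cont2 v) by (unfold v; cont).
  assert (Ev : v y T = D (s T * y) T - mu T) by (unfold v; rewrite !clamp_id by lra; auto).
  destruct (cont2_eps v y T (v y T) Hv) as (d & Hd & Hd'); [lra|].
  pose proof (Rmin_l d T); pose proof (Rmin_r d T). assert (0 < Rmin d T) by (apply Rmin_pos; lra).
  specialize (Hd' y (T - Rmin d T / 2)). rewrite Rminus_diag, Rabs_R0 in Hd'. specialize (Hd' Hd).
  replace (T - Rmin d T / 2 - T) with (- (Rmin d T / 2)) in Hd' by ring.
  rewrite Rabs_Ropp, (Rabs_pos_eq (Rmin d T / 2)) in Hd' by lra. specialize (Hd' ltac:(lra)).
  apply Rabs_def2 in Hd'. pose proof (Hlt y (T - Rmin d T / 2) ltac:(lra) Hy) as K.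
  assert (Ev2 : forall t', 0 <= t' <= T -> v y t' = D (s t' * y) t' - mu t').
  { intros t' Ht'. unfold v. rewrite !clamp_id by lra. reflexivity. }
  rewrite (Ev2 (T - Rmin d T / 2)) in Hd' by lra. lra. }
intros x t Ht Hx. pose proof (Hsp t Ht).
replace x with (s t * (x / s t)) by (field; lra). apply Hall; auto.
apply ratio_unit; lra.
Qed.

(** A penalty in time is enough: with zero slope at both ends a maximum there is a critical point
    too, and the one-sided second-order test applies at the ends as in the interior. *)
Lemma max_principle_neumann (z zx zxx zt : R -> R -> R) (M : R) : cont2 z ->
  (forall x t, is_derive (fun y => z y t) x (zx x t) /\ is_derive (fun y => zx y t) x (zxx x t) /\
     is_derive (fun r => z x r) t (zt x t)) ->
  (forall x t, 0 <= x <= 1 -> 0 < t -> zt x t <= zxx x t) ->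
  (forall t, zx 0 t = 0 /\ zx 1 t = 0) -> (forall x, 0 <= x <= 1 -> z x 0 <= M) ->
  forall x t, 0 <= x <= 1 -> 0 <= t -> z x t <= M.
Proof.
intros Hz Hd Hpde Hn Hi x0 t0 Hx0 Ht0.
destruct (Rle_dec (z x0 t0) M) as [|Hnot]; [auto|exfalso].
set (P := z x0 t0 - M). assert (HP : 0 < P) by (unfold P; lra).
set (e := P / (2 * (t0 + 1))). assert (He : 0 < e) by (apply Rdiv_lt_0_compat; lra).
assert (HeB : e * (t0 + 1) = P / 2) by (unfold e; field; lra).
pose (v := fun x t => z x t - e * t).
assert (Hv : cont2 v) by (unfold v; cont).
destruct (evt2 v 0 1 0 t0 Hv) as (x & t & Hx & Ht & Hmax); try lra.
assert (Hpos : M < v x t).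
{ apply Rlt_le_trans with (v x0 t0); [|apply Hmax; lra]. unfold v, P in *. nra. }
assert (Ht1 : 0 < t).
{ destruct (Req_dec t 0) as [E|]; [exfalso|lra]. subst t. specialize (Hi x Hx). unfold v in Hpos. lra. }
assert (Hsp : forall y, 0 <= y <= 1 -> z y t <= z x t).
{ intros y Hy. specialize (Hmax y t Hy Ht). unfold v in Hmax. lra. }
destruct (Hd x t) as (Hd1 & Hd2 & Hd3).
assert (E1 : zx x t = 0).
{ destruct (Req_dec x 0) as [->|]; [apply Hn|]. destruct (Req_dec x 1) as [->|]; [apply Hn|].
  apply Rle_antisym.
  - apply (right_max_derive (fun y => z y t) x _ (1 - x)); auto; [lra|]. intros h Hh; apply Hsp; lra.
  - apply (left_max_derive (fun y => z y t) x _ x); auto; [lra|]. intros h Hh; apply Hsp; lra. }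
assert (E2 : zxx x t <= 0).
{ apply (max_second_derive (fun y => z y t) (fun y => zx y t) x _ (/ 2)); auto; [lra| |].
  - intros y _. apply Hd.
  - destruct (Rle_dec x (/ 2)); [right|left]; intros h Hh; apply Hsp; lra. }
assert (E3 : 0 <= zt x t - e).
{ apply (left_max_derive (fun r => z x r - e * r) t _ t); auto.
  - der. ring.
  - intros h Hh. specialize (Hmax x (t - h) Hx ltac:(lra)). unfold v in Hmax. lra. }
specialize (Hpde x t Hx Ht1). lra.
Qed.

(* Phragmen-Lindelof: the penalty [ln (1 + x)] is strictly concave, which leaves room for [ln (1 + t ^ 2)]. *)
Lemma max_principle_ancient (q qx qxx : R -> R -> R) (M K : R) : cont2 q ->
  (forall x t, is_derive (fun y => q y t) x (qx x t) /\ is_derive (fun y => qx y t) x (qxx x t) /\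
     is_derive (fun r => q x r) t (qxx x t)) ->
  (forall x t, 0 <= x -> q x t <= K) -> (forall t, q 0 t <= M) ->
  forall x t, 0 <= x -> q x t <= M.
Proof.
intros Hq Hd HK HM x0 t0 Hx0.
destruct (Rle_dec (q x0 t0) M) as [|Hnot]; [auto|exfalso].
set (P := q x0 t0 - M). assert (HP : 0 < P) by (unfold P; lra).
assert (Hln : forall y, 0 <= y -> 0 <= ln (1 + y)).
{ intros y Hy. rewrite <- ln_1. destruct (Req_dec y 0) as [->|]; [rewrite Rplus_0_r; lra|].
  apply Rlt_le, ln_increasing; lra. }
assert (Hsq : forall t : R, 0 <= t * t) by (intros; nra).
set (e := P / (2 * (ln (1 + x0) + 1))).
assert (He : 0 < e) by (pose proof (Hln x0 Hx0); apply Rdiv_lt_0_compat; lra).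
assert (HeB : e * (ln (1 + x0) + 1) = P / 2) by (pose proof (Hln x0 Hx0); unfold e; field; lra).
(* At x = X the space penalty exceeds K - M, so no value above [M] survives there; [S] plays the
   same role for the time penalty. *)
set (X := exp ((K - M) / e) + x0). pose proof (exp_pos ((K - M) / e)) as HXe.
assert (HX : K - M < e * ln (1 + X)).
{ apply Rle_lt_trans with (e * ln (exp ((K - M) / e))).
  - rewrite ln_exp. replace (e * ((K - M) / e)) with (K - M) by (field; lra). lra.
  - apply Rmult_lt_compat_l; [auto|]. apply ln_increasing; unfold X; lra. }
assert (Hp0 : 0 < P / (2 * (ln (1 + t0 * t0) + 1))).
{ pose proof (Hln _ (Hsq t0)). apply Rdiv_lt_0_compat; lra. }
assert (Hp1 : 0 < e / (1 + X) ^ 2) by (apply Rdiv_lt_0_compat; [auto|]; apply pow_lt; unfold X; lra).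
(* Two demands: the time penalty takes less than half of the excess at the chosen point, and [n] is
   smaller than e / (1 + X)^2, the least concavity of the space penalty on [0, X]. *)
set (n := Rmin (P / (2 * (ln (1 + t0 * t0) + 1))) (e / (1 + X) ^ 2) / 2).
assert (Hn : 0 < n) by (pose proof (Rmin_pos _ _ Hp0 Hp1); unfold n; lra).
assert (Hn1 : n * (ln (1 + t0 * t0) + 1) < P / 2).
{ pose proof (Rmin_l (P / (2 * (ln (1 + t0 * t0) + 1))) (e / (1 + X) ^ 2)). fold n in H.
  pose proof (Hln _ (Hsq t0)).
  apply Rlt_le_trans with (P / (2 * (ln (1 + t0 * t0) + 1)) * (ln (1 + t0 * t0) + 1)).
  - apply Rmult_lt_compat_r; [lra|]. unfold n in *. lra.
  - apply Req_le. field. lra. }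
assert (Hn2 : n < e / (1 + X) ^ 2).
{ pose proof (Rmin_r (P / (2 * (ln (1 + t0 * t0) + 1))) (e / (1 + X) ^ 2)). unfold n in *. lra. }
set (S := exp ((K - M) / n) + 1 + Rabs t0). pose proof (exp_pos ((K - M) / n)) as HSe.
pose proof (Rabs_pos t0) as Ht0.
assert (HS : K - M < n * ln (1 + S * S)).
{ apply Rle_lt_trans with (n * ln (exp ((K - M) / n))).
  - rewrite ln_exp. replace (n * ((K - M) / n)) with (K - M) by (field; lra). lra.
  - apply Rmult_lt_compat_l; [auto|]. apply ln_increasing; unfold S; [lra|nra]. }
assert (Hclog : cont1 (fun t => ln (1 + t * t))).
{ apply (cont1_derive _ (fun t => (1 * t + t * 1) * / (1 + t * t))). intros t.
  auto_derive; [pose proof (Hsq t); lra | ring]. }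
assert (Hclog2 : cont1 (fun x => ln (1 + Rabs x))).
{ apply cont1_intro. intros x.
  apply (continuity_pt_comp (fun x => 1 + Rabs x) ln).
  - apply cont1_pt. cont.
  - apply continuity_pt_filterlim. apply (ex_derive_continuous ln).
    exists (/ (1 + Rabs x)). pose proof (Rabs_pos x).
    apply is_derive_Reals. apply derivable_pt_lim_ln. lra. }
pose (v := fun x t => q x t - e * ln (1 + Rabs x) - n * ln (1 + t * t)).
assert (Hv : cont2 v).
{ unfold v. apply cont2_minus; [apply cont2_minus; [cont|]|].
  - apply cont2_mult; [cont|]. apply (cont2_comp1 (fun x => ln (1 + Rabs x)) (fun x _ => x)); cont.
  - apply cont2_mult; [cont|]. apply (cont2_comp1 (fun t => ln (1 + t * t)) (fun _ t => t)); cont. }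
assert (HS0 : Rabs t0 < S) by (unfold S; lra). assert (HX0 : x0 < X) by (unfold X; lra).
apply Rabs_def2 in HS0.
destruct (evt2 v 0 X (- S) S Hv) as (x & t & Hx & Ht & Hmax); try lra.
assert (Hpos : M < v x t).
{ apply Rlt_le_trans with (v x0 t0); [|apply Hmax; lra]. unfold v. rewrite Rabs_pos_eq by lra.
  unfold P in *. lra. }
pose proof (Hln (Rabs x) (Rabs_pos x)) as L1. pose proof (Hln _ (Hsq t)) as L2.
assert (Hvq : v x t <= q x t).
{ unfold v. assert (0 <= e * ln (1 + Rabs x)) by nra. assert (0 <= n * ln (1 + t * t)) by nra. lra. }
pose proof (HK x t (proj1 Hx)) as HKx.
assert (Hx1 : 0 < x).
{ destruct (Req_dec x 0) as [E|]; [exfalso|lra]. subst x. specialize (HM t). lra. }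
assert (Hx2 : x < X).
{ destruct (Req_dec x X) as [E|]; [exfalso|lra]. subst x. unfold v in Hpos.
  rewrite Rabs_pos_eq in Hpos by lra. assert (0 <= n * ln (1 + t * t)) by nra. lra. }
assert (Ht1 : - S < t < S).
{ assert (Hne : t * t <> S * S).
  { intros E. unfold v in Hpos. rewrite E in Hpos. assert (0 <= e * ln (1 + Rabs x)) by nra. lra. }
  split; [destruct (Req_dec t (- S)) as [->|]|destruct (Req_dec t S) as [->|]]; try lra;
    exfalso; apply Hne; ring. }
destruct (Hd x t) as (Hd1 & Hd2 & Hd3).
assert (Hspace : forall y, 0 <= y <= X -> q y t - e * ln (1 + y) <= q x t - e * ln (1 + x)).
{ intros y Hy. specialize (Hmax y t Hy Ht). unfold v in Hmax. rewrite !Rabs_pos_eq in Hmax by lra. lra. }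
assert (Hdg : forall y, 0 <= y -> is_derive (fun y => q y t - e * ln (1 + y)) y (qx y t - e * / (1 + y))).
{ intros y Hy. apply (is_derive_minus (fun y => q y t)); [apply Hd|].
  auto_derive; [lra|ring]. }
set (r := Rmin x (X - x)). assert (Hr : 0 < r) by (apply Rmin_pos; lra).
assert (Hr2 : r <= x /\ r <= X - x) by (split; [apply Rmin_l|apply Rmin_r]).
destruct (interior_max (fun y => q y t - e * ln (1 + y)) (fun y => qx y t - e * / (1 + y)) x
  (qxx x t + e / (1 + x) ^ 2) r) as [_ E2]; auto.
{ intros y Hy. apply Rabs_def2 in Hy. apply Hdg. lra. }
{ der; lra || (field; lra). }
{ intros y Hy. apply Rabs_def2 in Hy. apply Hspace. lra. }
assert (E3 : 0 <= qxx x t - n * (2 * t / (1 + t * t))).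
{ apply (left_max_derive (fun r => q x r - n * ln (1 + r * r)) t _ (t + S)).
  - apply (is_derive_minus (fun r => q x r)); [exact Hd3|].
    pose proof (Hsq t). auto_derive; [lra|field; lra].
  - lra.
  - intros h Hh. specialize (Hmax x (t - h) Hx ltac:(lra)). unfold v in Hmax. lra. }
(* The time penalty decreases at a rate of at most [n], which the strict concavity in [x]
   outweighs. *)
assert (E4 : -1 <= 2 * t / (1 + t * t)).
{ apply Rmult_le_reg_r with (1 + t * t); [nra|].
  replace (2 * t / (1 + t * t) * (1 + t * t)) with (2 * t) by (field; nra).
  pose proof (Hsq (t + 1)). nra. }
assert (E5 : e / (1 + X) ^ 2 <= e / (1 + x) ^ 2).
{ apply Rmult_le_compat_l; [lra|]. apply Rinv_le_contravar; [apply pow_lt; lra|].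
  apply pow_incr; lra. }
nra.
Qed.

(** * Finite heat sums *)

Lemma is_derive_sum (F : nat -> R -> R) (F1 : nat -> R) (N : nat) (x : R) :
  (forall j, is_derive (F j) x (F1 j)) ->
  is_derive (fun y => sum_f_R0 (fun j => F j y) N) x (sum_f_R0 F1 N).
Proof.
intros H. induction N; simpl; [apply H|].
apply (is_derive_plus (fun y => sum_f_R0 (fun j => F j y) N)); auto.
Qed.

Lemma cont1_sum (F : nat -> R -> R) (N : nat) : (forall j, cont1 (F j)) ->
  cont1 (fun x => sum_f_R0 (fun j => F j x) N).
Proof. intros H; induction N; simpl; [apply H | apply cont1_plus; auto]. Qed.

Lemma cont2_sum (F : nat -> R -> R -> R) (N : nat) : (forall j, cont2 (F j)) ->
  cont2 (fun x y => sum_f_R0 (fun j => F j x y) N).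
Proof. intros H; induction N; simpl; [apply H | apply cont2_plus; auto]. Qed.

Lemma RInt_sum (F : nat -> R -> R) (a b : R) (N : nat) : (forall j, cont1 (F j)) ->
  RInt (fun x => sum_f_R0 (fun j => F j x) N) a b = sum_f_R0 (fun j => RInt (F j) a b) N :> R.
Proof.
intros H; induction N; simpl; [apply RInt_ext; auto|].
rewrite <- IHN. apply (RInt_plus_cont1 (fun x => sum_f_R0 (fun j => F j x) N)); auto.
apply cont1_sum, H.
Qed.

Lemma sum_extend (a : nat -> R) (n N : nat) : (n <= N)%nat -> (forall j, (n < j)%nat -> a j = 0) ->
  sum_f_R0 a N = sum_f_R0 a n.
Proof.
intros Hn Ha. induction Hn; auto. simpl. rewrite IHHn, Ha by lia. ring.
Qed.

Definition freq (j : nat) : R := INR j * (PI / 2).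
(** For odd [j] the function sin (freq j x) vanishes at 0 and has zero slope at 1: these are the
    eigenfunctions for the mixed boundary conditions of the rescaled problem. *)
Definition odd_seq (a : nat -> R) : Prop := forall j, Nat.even j = true -> a j = 0.
Definition mulfreq (a : nat -> R) (j : nat) : R := a j * freq j.

(* The phase [c * PI / 2] makes one family out of the heat sums and all their
   derivatives: differentiating in [x] multiplies by [freq] and increments [c]. *)
Definition heat_sum (a : nat -> R) (N c : nat) (x tau : R) : R :=
  sum_f_R0 (fun j => a j * exp (- freq j ^ 2 * tau) * sin (freq j * x + INR c * (PI / 2))) N.

Lemma cont2_heat_sum a N c : cont2 (heat_sum a N c).
Proof. apply cont2_sum. intros j. cont. Qed.

Lemma heat_sum_dx a N c x tau :
  is_derive (fun y => heat_sum a N c y tau) x (heat_sum (mulfreq a) N (S c) x tau).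
Proof.
apply (is_derive_sum (fun j y => a j * exp (- freq j ^ 2 * tau) * sin (freq j * y + INR c * (PI / 2)))).
intros j. auto_derive; [exact I|]. rewrite S_INR.
replace (freq j * x + (INR c + 1) * (PI / 2)) with (PI / 2 + (freq j * x + INR c * (PI / 2))) by field.
rewrite <- cos_sin. unfold mulfreq, Rdiv. simpl. ring.
Qed.

Lemma heat_sum_dt a N c x tau :
  is_derive (fun r => heat_sum a N c x r) tau (heat_sum (mulfreq (mulfreq a)) N (S (S c)) x tau).
Proof.
apply (is_derive_sum (fun j r => a j * exp (- freq j ^ 2 * r) * sin (freq j * x + INR c * (PI / 2)))).
intros j. auto_derive; [exact I|]. rewrite !S_INR.
replace (freq j * x + (INR c + 1 + 1) * (PI / 2)) with (freq j * x + INR c * (PI / 2) + PI) by field.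
rewrite neg_sin. unfold mulfreq. simpl. ring.
Qed.

Lemma sin_even_quarter (n : nat) : Nat.even n = true -> sin (INR n * (PI / 2)) = 0.
Proof.
intros H. apply Nat.even_spec in H. destruct H as [k ->].
rewrite mult_INR. simpl (INR 2). replace ((1 + 1) * INR k * (PI / 2)) with (INR k * PI) by field.
induction k; [simpl; rewrite Rmult_0_l; apply sin_0|].
rewrite S_INR. replace ((INR k + 1) * PI) with (INR k * PI + PI) by ring. rewrite neg_sin, IHk. ring.
Qed.

Lemma odd_mulfreq a : odd_seq a -> odd_seq (mulfreq a).
Proof. intros H j Hj. unfold mulfreq. rewrite H by exact Hj. ring. Qed.

Lemma sum_zero (a : nat -> R) (N : nat) : (forall j, a j = 0) -> sum_f_R0 a N = 0.
Proof. intros H; induction N; simpl; rewrite ?IHN, H; ring. Qed.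

Lemma heat_sum_left a N c tau : Nat.even c = true -> heat_sum a N c 0 tau = 0.
Proof.
intros H. apply sum_zero. intros j. rewrite Rmult_0_r, Rplus_0_l, (sin_even_quarter c H). ring.
Qed.

Lemma heat_sum_right a N c tau : odd_seq a -> Nat.even c = false -> heat_sum a N c 1 tau = 0.
Proof.
intros Ha H. apply sum_zero. intros j. destruct (Nat.even j) eqn:E; [rewrite Ha by exact E; ring|].
unfold freq. replace (INR j * (PI / 2) * 1 + INR c * (PI / 2)) with (INR (j + c) * (PI / 2))
  by (rewrite plus_INR; ring).
rewrite sin_even_quarter; [ring|]. rewrite Nat.even_add, E, H. reflexivity.
Qed.

(** The semigroup property: damping the coefficients restarts the flow at [tau0]. *)
Lemma heat_sum_shift a N c x tau0 tau :
  heat_sum (fun j => a j * exp (- freq j ^ 2 * tau0)) N c x tau = heat_sum a N c x (tau0 + tau).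
Proof.
apply sum_eq. intros j _. rewrite Rmult_plus_distr_l, exp_plus. ring.
Qed.

(* Bernstein's trick: [p^2 + 2 tau (p_x)^2] is a subsolution of the heat equation,
   and satisfies the Neumann condition at both ends. *)
Lemma heat_sum_bernstein a N c M : odd_seq a ->
  (forall x, 0 <= x <= 1 -> Rabs (heat_sum a N c x 0) <= M) ->
  forall x tau, 0 <= x <= 1 -> 0 <= tau ->
    heat_sum a N c x tau ^ 2 + 2 * tau * heat_sum (mulfreq a) N (S c) x tau ^ 2 <= M ^ 2.
Proof.
intros Ha HM.
set (a1 := mulfreq a). set (a2 := mulfreq a1). set (a3 := mulfreq a2).
pose proof (cont2_heat_sum a N c). pose proof (cont2_heat_sum a1 N (S c)).
apply (max_principle_neumann
  (fun x tau => heat_sum a N c x tau ^ 2 + 2 * tau * heat_sum a1 N (S c) x tau ^ 2)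
  (fun x tau => 2 * heat_sum a N c x tau * heat_sum a1 N (S c) x tau
     + 4 * tau * heat_sum a1 N (S c) x tau * heat_sum a2 N (S (S c)) x tau)
  (fun x tau => 2 * heat_sum a1 N (S c) x tau ^ 2 + 2 * heat_sum a N c x tau * heat_sum a2 N (S (S c)) x tau
     + 4 * tau * (heat_sum a2 N (S (S c)) x tau ^ 2 + heat_sum a1 N (S c) x tau * heat_sum a3 N (S (S (S c))) x tau))
  (fun x tau => 2 * heat_sum a N c x tau * heat_sum a2 N (S (S c)) x tau + 2 * heat_sum a1 N (S c) x tau ^ 2
     + 4 * tau * (heat_sum a1 N (S c) x tau * heat_sum a3 N (S (S (S c))) x tau))).
- cont.
- intros x t.
  pose proof (heat_sum_dx a N c x t) as D0. pose proof (heat_sum_dx a1 N (S c) x t) as D1.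
  pose proof (heat_sum_dx a2 N (S (S c)) x t) as D2.
  pose proof (heat_sum_dt a N c x t) as T0. pose proof (heat_sum_dt a1 N (S c) x t) as T1.
  fold a1 in D0, T0, T1. fold a2 in D1, T0, T1. fold a3 in D2, T1.
  split; [|split].
  + der. ring.
  + der. ring.
  + der. ring.
(* The factor 2 in 2 tau makes the terms 2 (p_x)^2 cancel; the difference of the two sides is 4 tau
   (p_xx)^2. *)
- intros x t _ Ht. nra.
(* The slope is 2 p p_x + 4 tau p_x p_xx, and at each end either p_x vanishes or p and p_xx both
   do. *)
- intros t. destruct (Nat.even c) eqn:E.
  + rewrite (heat_sum_left a) by exact E. rewrite (heat_sum_left a2) by exact E.
    rewrite (heat_sum_right a1); [lra | apply odd_mulfreq, Ha |].
    rewrite Nat.even_succ, <- Nat.negb_even, E; reflexivity.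
  + rewrite (heat_sum_right a) by assumption.
    rewrite (heat_sum_right a2) by (try apply odd_mulfreq, odd_mulfreq, Ha; exact E).
    rewrite (heat_sum_left a1); [lra|]. rewrite Nat.even_succ, <- Nat.negb_even, E; reflexivity.
- intros x Hx. specialize (HM x Hx). rewrite Rmult_0_r, Rmult_0_l, Rplus_0_r.
  rewrite <- (pow2_abs (heat_sum a N c x 0)). apply pow_incr. split; [apply Rabs_pos|exact HM].
Qed.

Lemma pow2_le_abs (x M : R) : 0 <= M -> x ^ 2 <= M ^ 2 -> Rabs x <= M.
Proof. intros HM H. apply Rabs_le. split; nra. Qed.

Lemma heat_sum_bound a N c M : odd_seq a ->
  (forall x, 0 <= x <= 1 -> Rabs (heat_sum a N c x 0) <= M) ->
  forall x tau, 0 <= x <= 1 -> 0 <= tau -> Rabs (heat_sum a N c x tau) <= M.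
Proof.
intros Ha HM x tau Hx Ht.
assert (HM0 : 0 <= M) by (eapply Rle_trans; [apply Rabs_pos | apply (HM 0); lra]).
pose proof (heat_sum_bernstein a N c M Ha HM x tau Hx Ht) as H.
apply pow2_le_abs; [exact HM0|].
nra.
Qed.

Lemma heat_sum_dx_bound a N c M : odd_seq a ->
  (forall x, 0 <= x <= 1 -> Rabs (heat_sum a N c x 0) <= M) ->
  forall x tau, 0 <= x <= 1 -> 0 < tau -> Rabs (heat_sum (mulfreq a) N (S c) x tau) <= M / sqrt tau.
Proof.
intros Ha HM x tau Hx Ht.
assert (HM0 : 0 <= M) by (eapply Rle_trans; [apply Rabs_pos | apply (HM 0); lra]).
pose proof (heat_sum_bernstein a N c M Ha HM x tau Hx ltac:(lra)) as H.
pose proof (sqrt_lt_R0 tau Ht) as Hs. pose proof (sqrt_sqrt tau ltac:(lra)) as Hss.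
apply Rmult_le_reg_r with (sqrt tau); [exact Hs|].
replace (M / sqrt tau * sqrt tau) with M by (field; lra).
rewrite <- (Rabs_pos_eq (sqrt tau)) by lra. rewrite <- Rabs_mult. apply pow2_le_abs; [exact HM0|].
rewrite Rpow_mult_distr. replace (sqrt tau ^ 2) with tau by (simpl; lra).
nra.
Qed.

(** The bound for one derivative is used twice, over each half of the elapsed time, which gives M /
    (tau / 2). *)
Lemma heat_sum_dxx_bound a N c M : odd_seq a ->
  (forall x, 0 <= x <= 1 -> Rabs (heat_sum a N c x 0) <= M) ->
  forall x tau, 0 <= x <= 1 -> 0 < tau ->
    Rabs (heat_sum (mulfreq (mulfreq a)) N (S (S c)) x tau) <= 2 * M / tau.
Proof.
intros Ha HM x tau Hx Ht.
set (b := fun j => mulfreq a j * exp (- freq j ^ 2 * (tau / 2))).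
assert (Hb : odd_seq b) by (intros j Hj; unfold b; rewrite odd_mulfreq by assumption; ring).
assert (HbM : forall x, 0 <= x <= 1 -> Rabs (heat_sum b N (S c) x 0) <= M / sqrt (tau / 2)).
{ intros y Hy. unfold b. rewrite heat_sum_shift, Rplus_0_r. apply heat_sum_dx_bound; auto; lra. }
pose proof (heat_sum_dx_bound b N (S c) _ Hb HbM x (tau / 2) Hx ltac:(lra)) as H.
replace (heat_sum (mulfreq (mulfreq a)) N (S (S c)) x tau) with (heat_sum (mulfreq b) N (S (S c)) x (tau / 2)).
- eapply Rle_trans; [exact H|]. apply Req_le.
  pose proof (sqrt_lt_R0 (tau / 2) ltac:(lra)) as Hs. pose proof (sqrt_sqrt (tau / 2) ltac:(lra)) as Hss.
  replace (M / sqrt (tau / 2) / sqrt (tau / 2)) with (M / (sqrt (tau / 2) * sqrt (tau / 2))) by (field; lra).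
  rewrite Hss. field. lra.
- replace tau with (tau / 2 + tau / 2) at 2 by field. rewrite <- heat_sum_shift.
  apply sum_eq. intros j _. unfold b, mulfreq. ring.
Qed.

(** * Damping by a positive trigonometric kernel *)

(* The de la Vallee Poussin kernel: positive, and a trigonometric polynomial. *)
Definition vp (n : nat) (z : R) : R := ((1 + cos (PI / 2 * z)) / 2) ^ n.

(** Only the existence of the coefficients matters: the kernel's coefficients are never computed,
    and all that is used of them comes from the closed form of [vp]. *)
Definition cos_poly (n : nat) (h : R -> R) : Prop :=
  exists v : nat -> R, (forall j, (n < j)%nat -> v j = 0) /\
    forall z, h z = sum_f_R0 (fun j => v j * cos (freq j * z)) n.

Lemma cos_poly_mono n m h : (n <= m)%nat -> cos_poly n h -> cos_poly m h.
Proof.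
intros Hn (v & Hv & E). exists v; split; [intros; apply Hv; lia|].
intros z. rewrite E. symmetry. apply sum_extend; [exact Hn|]. intros j Hj. rewrite Hv by exact Hj. ring.
Qed.

Lemma cos_poly_plus n f g : cos_poly n f -> cos_poly n g -> cos_poly n (fun z => f z + g z).
Proof.
intros (v & Hv & E) (w & Hw & F). exists (fun j => v j + w j); split.
- intros j Hj. rewrite Hv, Hw by exact Hj. ring.
- intros z. rewrite E, F, <- plus_sum. apply sum_eq. intros; ring.
Qed.

Lemma cos_poly_scal n c f : cos_poly n f -> cos_poly n (fun z => c * f z).
Proof.
intros (v & Hv & E). exists (fun j => c * v j); split.
- intros j Hj. rewrite Hv by exact Hj. ring.
- intros z. rewrite E, scal_sum. apply sum_eq. intros; ring.
Qed.

Lemma cos_poly_cos n j : (j <= n)%nat -> cos_poly n (fun z => cos (freq j * z)).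
Proof.
intros Hj. apply (cos_poly_mono j); [exact Hj|].
exists (fun i => if Nat.eqb i j then 1 else 0); split.
- intros i Hi. destruct (Nat.eqb_spec i j); [lia|reflexivity].
- intros z. destruct j; simpl; [ring|].
  rewrite Nat.eqb_refl.
  assert (E : sum_f_R0 (fun i => (if Nat.eqb i (S j) then 1 else 0) * cos (freq i * z)) j = sum_f_R0 (fun _ => 0) j).
  { apply sum_eq. intros i Hi. destruct (Nat.eqb_spec i (S j)); [lia|ring]. }
  rewrite E, sum_zero by auto. ring.
Qed.

Lemma cos_poly_ext n f g : (forall z, f z = g z) -> cos_poly n f -> cos_poly n g.
Proof. intros E (v & Hv & F). exists v; split; auto. intros z. rewrite <- E; auto. Qed.

(** The product formula for cosines couples [j] to its two neighbours; the [match] is |j - 1|, since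
    at j = 0 the index -1 is the same cosine as 1. *)
Lemma cos_poly_step_cos j : cos_poly (S j) (fun z => (1 + cos (PI / 2 * z)) / 2 * cos (freq j * z)).
Proof.
apply (cos_poly_ext _ (fun z => / 2 * cos (freq j * z) + (/ 4 * cos (freq (S j) * z) + / 4 * cos (freq (match j with O => 1 | S i => i end) * z)))).
- intros z. destruct j.
  + unfold freq. simpl INR. replace (1 * (PI / 2) * z) with (PI / 2 * z) by ring.
    replace (0 * (PI / 2) * z) with 0 by ring. rewrite cos_0. field.
  + 
    replace (freq (S (S j)) * z) with (freq (S j) * z + PI / 2 * z) by (unfold freq; rewrite !S_INR; ring).
    replace (freq j * z) with (freq (S j) * z - PI / 2 * z) by (unfold freq; rewrite !S_INR; ring).
    rewrite cos_plus, cos_minus. field.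
- repeat apply cos_poly_plus; apply cos_poly_scal, cos_poly_cos; destruct j; lia.
Qed.

Lemma vp_cos_poly n : cos_poly n (vp n).
Proof.
induction n.
- apply (cos_poly_ext _ (fun z => cos (freq 0 * z))); [|apply cos_poly_cos; lia].
  intros z. unfold freq, vp. simpl. rewrite !Rmult_0_l, cos_0. reflexivity.
- destruct IHn as (v & Hv & E).
  apply (cos_poly_ext _ (fun z => (1 + cos (PI / 2 * z)) / 2 * sum_f_R0 (fun j => v j * cos (freq j * z)) n)).
  + intros z. rewrite <- E. reflexivity.
  + clear E. assert (H : forall N, (N <= n)%nat ->
      cos_poly (S n) (fun z => (1 + cos (PI / 2 * z)) / 2 * sum_f_R0 (fun j => v j * cos (freq j * z)) N)).
    { assert (H0 : forall j, (j <= n)%nat ->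
        cos_poly (S n) (fun z => v j * ((1 + cos (PI / 2 * z)) / 2 * cos (freq j * z)))).
      { intros j Hj. apply cos_poly_scal. apply (cos_poly_mono (S j)); [lia|apply cos_poly_step_cos]. }
      induction N; intros HN.
      - eapply cos_poly_ext; [|apply (H0 0%nat); lia]. intros z; simpl; ring.
      - eapply cos_poly_ext; [|apply cos_poly_plus; [apply IHN; lia|apply (H0 (S N)); lia]].
        intros z; simpl; ring. }
    apply H; lia.
Qed.

Definition vp_coef (n : nat) : nat -> R :=
  proj1_sig (constructive_indefinite_description _ (vp_cos_poly n)).

Lemma vp_coef_spec n : (forall j, (n < j)%nat -> vp_coef n j = 0) /\
  forall z, vp n z = sum_f_R0 (fun j => vp_coef n j * cos (freq j * z)) n.
Proof. unfold vp_coef; destruct constructive_indefinite_description; auto. Qed.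

Lemma sin_cos_INR_PI k : sin (INR k * PI) = 0 /\ cos (INR k * PI) = if Nat.even k then 1 else -1.
Proof.
induction k; [simpl; rewrite Rmult_0_l, sin_0, cos_0; auto|].
destruct IHk as [S1 C1]. rewrite S_INR. replace ((INR k + 1) * PI) with (INR k * PI + PI) by ring.
rewrite neg_sin, neg_cos, S1, C1, Nat.even_succ, <- Nat.negb_even.
destruct (Nat.even k); simpl; split; ring.
Qed.

Lemma cos_freq_shift j z : cos (freq j * (z + 2)) = (if Nat.even j then 1 else -1) * cos (freq j * z).
Proof.
replace (freq j * (z + 2)) with (freq j * z + INR j * PI) by (unfold freq; field).
rewrite cos_plus. destruct (sin_cos_INR_PI j) as [-> ->]. ring.
Qed.

Lemma cos_freq_one j : Nat.even j = false -> cos (freq j * 1) = 0.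
Proof.
intros Hj. rewrite cos_sin. unfold freq.
replace (PI / 2 + INR j * (PI / 2) * 1) with (INR (S j) * (PI / 2)) by (rewrite S_INR; ring).
apply sin_even_quarter. rewrite Nat.even_succ, <- Nat.negb_even, Hj. reflexivity.
Qed.

(** The method of images. [vp n] has period 4, and a point [y] of [0, 1] has the images -y, 2 - y
    and y - 2 under reflection at 0 and 1. The signs -1, 1, -1 belong to functions odd about 0 and
    even about 1, the signs 1, -1, -1 to their derivatives, and 1, 1, 1 give the positive kernel
    that measures the mass. *)
Definition kernel (s1 s2 s3 : R) (n : nat) (x y : R) : R :=
  vp n (x - y) + s1 * vp n (x + y) + s2 * vp n (x + y - 2) + s3 * vp n (x - y + 2).

Lemma kernel_expand (s1 s2 s3 : R) (n : nat) (x y : R) :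
  kernel s1 s2 s3 n x y = sum_f_R0 (fun j => vp_coef n j *
    ((1 + s3 * (if Nat.even j then 1 else -1)) * cos (freq j * (x - y))
     + (s1 + s2 * (if Nat.even j then 1 else -1)) * cos (freq j * (x + y)))) n.
Proof.
unfold kernel. destruct (vp_coef_spec n) as [_ E]. rewrite !E.
rewrite (scal_sum _ n s1), (scal_sum _ n s2), (scal_sum _ n s3), <- !plus_sum. apply sum_eq. intros j _.
rewrite (cos_freq_shift j (x - y)).
replace (cos (freq j * (x + y))) with (cos (freq j * (x + y - 2 + 2))) by (f_equal; ring).
rewrite (cos_freq_shift j (x + y - 2)). destruct (Nat.even j); ring.
Qed.

(** The integral of [vp n] over a period of length 4, to which only the constant term
    contributes. *)
Definition vp_mass (n : nat) : R := 4 * vp_coef n 0.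

Lemma cont1_vp n : cont1 (vp n).
Proof. unfold vp. apply (cont1_pow (fun z => (1 + cos (PI / 2 * z)) / 2)). cont. intros; lra. Qed.

Lemma cont1_kernel s1 s2 s3 n x : cont1 (kernel s1 s2 s3 n x).
Proof. pose proof (cont1_vp n). unfold kernel. cont. Qed.

Lemma RInt_cos_freq j : Nat.even j = true -> j <> 0%nat -> RInt (fun y => cos (freq j * y)) 0 1 = 0 :> R.
Proof.
intros He Hj. assert (Hf : freq j <> 0).
{ unfold freq. apply Rmult_integral_contrapositive_currified; [apply not_0_INR, Hj|]. pose proof PI_RGT_0. lra. }
rewrite (ftc_open (fun y => sin (freq j * y) / freq j) (fun y => cos (freq j * y))); try lra.
- rewrite Rmult_0_r, sin_0. replace (freq j * 1) with (INR j * (PI / 2)) by (unfold freq; ring).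
  rewrite sin_even_quarter by exact He. unfold Rdiv; ring.
- cont. auto.
- cont.
- intros x _. der. field. exact Hf.
Qed.

(** The four images of [0, 1] cover one period. In coefficients: odd [j] cancel among the images,
    even [j] > 0 integrate to 0, and the constant term remains. *)
Lemma RInt_kernel_one n x : RInt (kernel 1 1 1 n x) 0 1 = vp_mass n :> R.
Proof.
rewrite (RInt_ext _ (fun y => sum_f_R0 (fun j => vp_coef n j * (2 * (1 + (if Nat.even j then 1 else -1)))
  * cos (freq j * x) * cos (freq j * y)) n)).
2:{ intros y _. rewrite kernel_expand. apply sum_eq. intros j _.
    rewrite !Rmult_plus_distr_l, Rmult_minus_distr_l, cos_plus, cos_minus. ring. }
rewrite (RInt_sum (fun j y => vp_coef n j * (2 * (1 + (if Nat.even j then 1 else -1)))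
  * cos (freq j * x) * cos (freq j * y))).
2:{ intros j. cont. }
rewrite (sum_eq _ (fun j => if Nat.eqb j 0 then vp_mass n else 0)).
- induction n; simpl; [reflexivity|].
  clear IHn. assert (E : forall m k, (forall i, (i <= k)%nat -> True) ->
    sum_f_R0 (fun j => if Nat.eqb j 0 then vp_mass m else 0) k = vp_mass m).
  { intros m k _. induction k; simpl; [reflexivity|]. rewrite IHk. ring. }
  rewrite E by auto. ring.
- intros j _.
  rewrite (RInt_scal_cont1 (fun y => cos (freq j * y))) by cont.
  
  destruct (Nat.even j) eqn:E; [|replace (1 + -1) with 0 by ring; destruct j; [discriminate|simpl; ring]].
  destruct (Nat.eqb_spec j 0) as [->|Hj]; [|rewrite (RInt_cos_freq j E Hj); ring].
  unfold freq, vp_mass. simpl INR. rewrite (RInt_ext _ (fun _ => 1)).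
  + rewrite RInt_const_R. rewrite !Rmult_0_l, cos_0. ring.
  + intros y _. rewrite !Rmult_0_l, cos_0. reflexivity.
Qed.

Lemma vp_nonneg n z : 0 <= vp n z.
Proof. apply pow_le. pose proof (COS_bound (PI / 2 * z)). lra. Qed.

Lemma vp_even n z : vp n (- z) = vp n z.
Proof. unfold vp. rewrite <- Ropp_mult_distr_r, cos_neg. reflexivity. Qed.

Lemma vp_abs n z : vp n (Rabs z) = vp n z.
Proof. unfold Rabs; destruct Rcase_abs; [apply vp_even | reflexivity]. Qed.

Lemma vp_decr n y z : 0 <= y <= z -> z <= 2 -> vp n z <= vp n y.
Proof.
intros Hy Hz. apply pow_incr. pose proof (COS_bound (PI / 2 * z)). pose proof PI_RGT_0.
enough (cos (PI / 2 * z) <= cos (PI / 2 * y)) by lra.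
apply cos_decr_1; nra.
Qed.

(** Of the four nonnegative images at x = 0 the first alone is kept, on [0, d], where monotonicity
    bounds it below by its value at [d]. *)
Lemma vp_mass_lower n d : 0 < d <= 1 -> d * vp n d <= vp_mass n.
Proof.
intros Hd. rewrite <- (RInt_kernel_one n 0).
assert (Hnn : forall y, 0 <= kernel 1 1 1 n 0 y).
{ intros y. unfold kernel. pose proof (vp_nonneg n (0 - y)). pose proof (vp_nonneg n (0 + y)).
  pose proof (vp_nonneg n (0 + y - 2)). pose proof (vp_nonneg n (0 - y + 2)). lra. }
assert (Hex : forall a b, ex_RInt (kernel 1 1 1 n 0) a b) by (intros; apply ex_RInt_cont1, cont1_kernel).
rewrite <- (RInt_Chasles (kernel 1 1 1 n 0) 0 d 1) by auto. unfold plus; simpl.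
assert (0 <= RInt (kernel 1 1 1 n 0) d 1) by (apply RInt_ge_0; auto; lra).
assert (d * vp n d <= RInt (kernel 1 1 1 n 0) 0 d); [|lra].
assert (E : d * vp n d = RInt (fun _ => vp n d) 0 d) by (rewrite RInt_const_R; ring).
rewrite E. apply RInt_le; auto; [lra| apply ex_RInt_const |].
intros y Hy. unfold kernel. pose proof (vp_nonneg n (0 + y)).
pose proof (vp_nonneg n (0 + y - 2)). pose proof (vp_nonneg n (0 - y + 2)).
pose proof (vp_decr n y d ltac:(lra) ltac:(lra)).
replace (0 - y) with (- y) at 1 by ring. rewrite vp_even. lra.
Qed.

Lemma vp_mass_pos n : 0 < vp_mass n.
Proof.
apply Rlt_le_trans with (1 * vp n 1); [|apply vp_mass_lower; lra].
rewrite Rmult_1_l. unfold vp. rewrite Rmult_1_r, cos_PI2. apply pow_lt. lra.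
Qed.

(** At odd [j] this is the ratio of the [j]-th coefficient of the kernel to the constant one; it
    absorbs the factor 2 that normalises the sine coefficients. *)
Definition multiplier (n j : nat) : R := if Nat.even j then 0 else 4 * vp_coef n j / vp_mass n.

Definition sine_coef (g : R -> R) (j : nat) : R := RInt (fun y => g y * sin (freq j * y)) 0 1.

Definition proj_coef (n : nat) (g : R -> R) (j : nat) : R := multiplier n j * sine_coef g j.

Lemma multiplier_odd n : odd_seq (multiplier n).
Proof. intros j Hj. unfold multiplier. rewrite Hj. reflexivity. Qed.

Lemma multiplier_high n j : (n < j)%nat -> multiplier n j = 0.
Proof.
intros Hj. unfold multiplier. destruct (Nat.even j); [reflexivity|].
rewrite (proj1 (vp_coef_spec n)) by exact Hj. unfold Rdiv. ring.
Qed.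

(** With the signs -1, 1, -1 the even indices cancel in [kernel_expand], and for odd ones the
    difference of the two cosines is twice a product of sines. The damped sine sum is thus an
    average of [g] against the kernel. *)
Lemma proj_kernel n g x : cont1 g ->
  heat_sum (proj_coef n g) n 0 x 0 = RInt (fun y => kernel (-1) 1 (-1) n x y * g y) 0 1 / vp_mass n.
Proof.
intros Hg. pose proof (vp_mass_pos n).
rewrite (RInt_ext _ (fun y => sum_f_R0 (fun j => vp_mass n * multiplier n j * sin (freq j * x)
   * (g y * sin (freq j * y))) n)).
2:{ intros y _. rewrite kernel_expand, Rmult_comm, scal_sum. apply sum_eq. intros j _. unfold multiplier.
    rewrite !Rmult_plus_distr_l, Rmult_minus_distr_l, cos_plus, cos_minus.
    destruct (Nat.even j); [ring|field; lra]. }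
rewrite (RInt_sum (fun j y => vp_mass n * multiplier n j * sin (freq j * x) * (g y * sin (freq j * y)))).
2:{ intros j. cont. }
unfold Rdiv. rewrite Rmult_comm, scal_sum. apply sum_eq. intros j _.
rewrite (RInt_scal_cont1 (fun y => g y * sin (freq j * y))) by cont.
unfold proj_coef, sine_coef.
rewrite !Rmult_0_l, Rplus_0_r, Rmult_0_r, exp_0. field. lra.
Qed.

(** Integration by parts moves the derivative onto [g]; the boundary terms vanish because [g 0 = 0]
    and cos (freq j) = 0 for odd [j]. Damping therefore preserves bounds on the first derivative
    too. *)
Lemma proj_dx_kernel n g g1 x : cont1 g -> cont1 g1 ->
  (forall y, 0 < y < 1 -> is_derive g y (g1 y)) -> g 0 = 0 ->
  heat_sum (mulfreq (proj_coef n g)) n 1 x 0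
  = RInt (fun y => kernel 1 (-1) (-1) n x y * g1 y) 0 1 / vp_mass n.
Proof.
intros Hg Hg1 Hd H0. pose proof (vp_mass_pos n).
assert (Hparts : forall j, Nat.even j = false ->
  freq j * sine_coef g j = RInt (fun y => g1 y * cos (freq j * y)) 0 1).
{ intros j Hj. unfold sine_coef.
  assert (E : RInt (fun y => g1 y * cos (freq j * y) - freq j * (g y * sin (freq j * y))) 0 1
     = g 1 * cos (freq j * 1) - g 0 * cos (freq j * 0)).
  { apply (ftc_open (fun y => g y * cos (freq j * y))); [lra|cont|cont|].
    intros y Hy. specialize (Hd y Hy). der. ring. }
  rewrite (RInt_minus_cont1 (fun y => g1 y * cos (freq j * y)) (fun y => freq j * (g y * sin (freq j * y)))) in E by cont.
  rewrite (RInt_scal_cont1 (fun y => g y * sin (freq j * y))) in E by cont.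
  rewrite (cos_freq_one j Hj), H0 in E. lra. }
rewrite (RInt_ext _ (fun y => sum_f_R0 (fun j => vp_mass n * multiplier n j * cos (freq j * x)
   * (g1 y * cos (freq j * y))) n)).
2:{ intros y _. rewrite kernel_expand, Rmult_comm, scal_sum. apply sum_eq. intros j _. unfold multiplier.
    rewrite !Rmult_plus_distr_l, Rmult_minus_distr_l, cos_plus, cos_minus.
    destruct (Nat.even j); [ring|field; lra]. }
rewrite (RInt_sum (fun j y => vp_mass n * multiplier n j * cos (freq j * x) * (g1 y * cos (freq j * y)))).
2:{ intros j. cont. }
unfold Rdiv. rewrite Rmult_comm, scal_sum. apply sum_eq. intros j _.
rewrite (RInt_scal_cont1 (fun y => g1 y * cos (freq j * y))) by cont.
unfold mulfreq, proj_coef. simpl INR.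
rewrite Rmult_0_r, exp_0. replace (freq j * x + 1 * (PI / 2)) with (PI / 2 + freq j * x) by ring.
rewrite <- cos_sin.
destruct (Nat.even j) eqn:E.
- rewrite multiplier_odd by exact E. ring.
- rewrite <- Hparts by exact E. field. lra.
Qed.

Lemma kernel_abs s1 s2 s3 n x y : Rabs s1 <= 1 -> Rabs s2 <= 1 -> Rabs s3 <= 1 ->
  Rabs (kernel s1 s2 s3 n x y) <= kernel 1 1 1 n x y.
Proof.
intros H1 H2 H3. unfold kernel.
apply Rabs_le_between in H1, H2, H3.
pose proof (vp_nonneg n (x - y)). pose proof (vp_nonneg n (x + y)).
pose proof (vp_nonneg n (x + y - 2)). pose proof (vp_nonneg n (x - y + 2)).
apply Rabs_le. split; nra.
Qed.

(** The signed kernel is dominated by the positive one, whose mass is exactly the divisor. *)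
Lemma kernel_average s1 s2 s3 n x (g : R -> R) M : Rabs s1 <= 1 -> Rabs s2 <= 1 -> Rabs s3 <= 1 ->
  cont1 g -> (forall y, 0 <= y <= 1 -> Rabs (g y) <= M) ->
  Rabs (RInt (fun y => kernel s1 s2 s3 n x y * g y) 0 1 / vp_mass n) <= M.
Proof.
intros H1 H2 H3 Hg HM. pose proof (vp_mass_pos n) as Hp.
pose proof (cont1_kernel s1 s2 s3 n x). pose proof (cont1_kernel 1 1 1 n x) as Hk.
unfold Rdiv. rewrite Rabs_mult, Rabs_inv, (Rabs_pos_eq (vp_mass n)) by lra.
apply Rmult_le_reg_r with (vp_mass n); [exact Hp|]. rewrite Rmult_assoc, Rinv_l, Rmult_1_r by lra.
rewrite <- (RInt_kernel_one n x).
eapply Rle_trans.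
- apply (abs_RInt_le_prim _ (fun r => M * RInt (kernel 1 1 1 n x) 0 r) (fun r => M * kernel 1 1 1 n x r));
    [lra|cont| | |].
  + apply cont1_mult; [cont|apply cont1_RInt, Hk].
  + intros r _. apply (is_derive_scal (RInt (kernel 1 1 1 n x) 0)), is_derive_RInt_cont1, Hk.
  + intros r Hr. rewrite Rabs_mult, Rmult_comm. apply Rmult_le_compat; try apply Rabs_pos.
    * apply HM; lra.
    * apply kernel_abs; auto.
- rewrite RInt_point_R. lra.
Qed.

Lemma Rabs_one_le (s : R) : s = 1 \/ s = -1 -> Rabs s <= 1.
Proof. intros [-> | ->]; apply Rabs_le; lra. Qed.

Lemma proj_bound n g M : cont1 g -> (forall y, 0 <= y <= 1 -> Rabs (g y) <= M) ->
  forall x, Rabs (heat_sum (proj_coef n g) n 0 x 0) <= M.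
Proof.
intros Hg HM x. rewrite proj_kernel by exact Hg.
apply kernel_average; auto; apply Rabs_one_le; auto.
Qed.

Lemma proj_dx_bound n g g1 M : cont1 g -> cont1 g1 ->
  (forall y, 0 < y < 1 -> is_derive g y (g1 y)) -> g 0 = 0 ->
  (forall y, 0 <= y <= 1 -> Rabs (g1 y) <= M) ->
  forall x, Rabs (heat_sum (mulfreq (proj_coef n g)) n 1 x 0) <= M.
Proof.
intros Hg Hg1 Hd H0 HM x. rewrite (proj_dx_kernel n g g1) by assumption.
apply kernel_average; auto; apply Rabs_one_le; auto.
Qed.

(** The index [N] serves all [g] with the same bound and modulus of continuity, in particular all
    times at once. The kernel concentrates: at distance [d] or more it is at most q^n, while its
    mass is at least (d / 2) q'^n with q < q'. *)
Lemma proj_converges M e d : 0 < e -> 0 < d <= 1 ->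
  exists N, forall n g, (N <= n)%nat -> cont1 g -> g 0 = 0 ->
    (forall y, 0 <= y <= 1 -> Rabs (g y) <= M) ->
    (forall x y, 0 <= x <= 1 -> 0 <= y <= 1 -> Rabs (x - y) < d -> Rabs (g x - g y) <= e) ->
    forall x, 0 <= x <= 1 -> Rabs (heat_sum (proj_coef n g) n 0 x 0 - g x) <= 3 * e.
Proof.
intros He Hd. pose proof PI_RGT_0 as Hpi.
set (q := (1 + cos (PI / 2 * d)) / 2). set (q' := (1 + cos (PI / 2 * (d / 2))) / 2).
assert (Hqq : q < q').
{ unfold q, q'. enough (cos (PI / 2 * d) < cos (PI / 2 * (d / 2))) by lra. apply cos_decreasing_1; nra. }
assert (Hq0 : 0 <= q) by (unfold q; pose proof (COS_bound (PI / 2 * d)); lra).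
destruct (pow_lt_1_zero (q / q')) with (y := e * (d / 2) / (8 * (Rabs M + 1))) as [N HN].
{ rewrite Rabs_pos_eq by (apply Rdiv_le_0_compat; lra).
  apply Rmult_lt_reg_r with q'; [lra|]. unfold Rdiv. rewrite Rmult_assoc, Rinv_l; lra. }
{ pose proof (Rabs_pos M). apply Rdiv_lt_0_compat; nra. }
exists N. intros n g Hn Hg H0 HM Hmod x Hx. specialize (HN n Hn).
pose proof (vp_mass_pos n) as Hp. pose proof (vp_mass_lower n (d / 2) ltac:(lra)) as Hlow.
change (vp n (d / 2)) with (q' ^ n) in Hlow.
assert (Hq'n : 0 < q' ^ n) by (apply pow_lt; lra).
assert (HM0 : 0 <= M) by (eapply Rle_trans; [apply Rabs_pos | apply (HM 0); lra]).
rewrite (Rabs_pos_eq M) in HN by exact HM0.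
assert (Hqn0 : 0 <= q ^ n) by (apply pow_le; exact Hq0).
assert (Hsmall : 8 * M * q ^ n <= e * vp_mass n).
{ apply Rle_trans with (e * (d / 2 * q' ^ n)); [|apply Rmult_le_compat_l; lra].
  unfold Rdiv in HN at 1. rewrite Rpow_mult_distr, pow_inv in HN.
  rewrite Rabs_pos_eq in HN by (apply Rmult_le_pos; [exact Hqn0|apply Rlt_le, Rinv_0_lt_compat, Hq'n]).
  apply (Rmult_lt_compat_r (q' ^ n * (8 * (M + 1)))) in HN; [|nra].
  replace (q ^ n * / q' ^ n * (q' ^ n * (8 * (M + 1)))) with (8 * M * q ^ n + 8 * q ^ n) in HN by (field; lra).
  replace (e * (d / 2) / (8 * (M + 1)) * (q' ^ n * (8 * (M + 1)))) with (e * (d / 2 * q' ^ n)) in HN by (field; lra).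
  lra. }
rewrite proj_kernel by exact Hg.
pose proof (cont1_kernel (-1) 1 (-1) n x) as Hk1. pose proof (cont1_kernel 1 1 1 n x) as Hk.
replace (RInt (fun y => kernel (-1) 1 (-1) n x y * g y) 0 1 / vp_mass n - g x)
  with (RInt (fun y => kernel (-1) 1 (-1) n x y * g y - kernel 1 1 1 n x y * g x) 0 1 / vp_mass n).
2:{ rewrite (RInt_minus_cont1 (fun y => kernel (-1) 1 (-1) n x y * g y) (fun y => kernel 1 1 1 n x y * g x)) by cont.
    rewrite (RInt_ext (fun y => kernel 1 1 1 n x y * g x) (fun y => g x * kernel 1 1 1 n x y))
      by (intros; apply Rmult_comm).
    rewrite (RInt_scal_cont1 (kernel 1 1 1 n x)) by cont. rewrite RInt_kernel_one.
    field. lra. }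
(* Each of the four images is treated alike: where [z] is near 0 the increment [c] is small,
   elsewhere the kernel is. *)
assert (Hterm : forall z c, Rabs z <= 2 -> (Rabs z < d -> Rabs c <= 2 * e) -> Rabs c <= 2 * M ->
  Rabs (vp n z * c) <= 2 * e * vp n z + 2 * M * q ^ n).
{ intros z c Hz Hc1 Hc2. pose proof (vp_nonneg n z) as Hv. rewrite Rabs_mult, (Rabs_pos_eq (vp n z)) by exact Hv.
  destruct (Rlt_dec (Rabs z) d) as [Hlt|Hge].
  - specialize (Hc1 Hlt). nra.
  - assert (vp n z <= q ^ n).
    { rewrite <- vp_abs. change (q ^ n) with (vp n d). apply vp_decr; lra. }
    nra. }
assert (Hpt : forall y, 0 <= y <= 1 ->
  Rabs (kernel (-1) 1 (-1) n x y * g y - kernel 1 1 1 n x y * g x) <= 2 * e * kernel 1 1 1 n x y + 8 * M * q ^ n).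
{ intros y Hy. pose proof (HM x Hx) as Mx. pose proof (HM y Hy) as My.
  assert (G0 : forall z, 0 <= z < d -> z <= 1 -> Rabs (g z) <= e).
  { intros z Hz Hz1. rewrite <- (Rminus_0_r (g z)), <- H0. apply Hmod; try lra. apply Rabs_def1; lra. }
  assert (Gm : Rabs (g y - g x) <= 2 * M /\ Rabs (- g y - g x) <= 2 * M).
  { apply Rabs_le_between in Mx, My. split; apply Rabs_le; lra. }
  assert (T1 : Rabs (vp n (x - y) * (g y - g x)) <= 2 * e * vp n (x - y) + 2 * M * q ^ n).
  { apply Hterm; [apply Rabs_le; lra| |apply Gm]. intros Hz. rewrite Rabs_minus_sym.
    specialize (Hmod x y Hx Hy Hz). lra. }
  (* Here x + y < d puts both points near 0, where [g 0 = 0] makes [g] itself small. *)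
  assert (T2 : Rabs (vp n (x + y) * (- g y - g x)) <= 2 * e * vp n (x + y) + 2 * M * q ^ n).
  { apply Hterm; [apply Rabs_le; lra| |apply Gm]. intros Hz. apply Rabs_def2 in Hz.
    pose proof (G0 x ltac:(lra) ltac:(lra)) as A. pose proof (G0 y ltac:(lra) ltac:(lra)) as B.
    apply Rabs_le_between in A, B. apply Rabs_le; lra. }
  assert (T3 : Rabs (vp n (x + y - 2) * (g y - g x)) <= 2 * e * vp n (x + y - 2) + 2 * M * q ^ n).
  { apply Hterm; [apply Rabs_le; lra| |apply Gm]. intros Hz. apply Rabs_def2 in Hz.
    assert (K : Rabs (g y - g x) <= e) by (apply Hmod; try lra; apply Rabs_def1; lra). lra. }
  (* By evenness and period 4 the last image counts at distance 2 - |x - y| >= 1 from 0, which is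
     never less than [d]. *)
  assert (E4 : vp n (x - y + 2) = vp n (2 - Rabs (x - y))).
  { unfold vp. do 3 f_equal. replace (PI / 2 * (x - y + 2)) with (PI / 2 * (x - y) + PI) by field.
    replace (PI / 2 * (2 - Rabs (x - y))) with (- (PI / 2 * Rabs (x - y)) + PI) by field.
    rewrite !neg_cos, cos_neg. unfold Rabs; destruct Rcase_abs; [|reflexivity].
    rewrite <- Ropp_mult_distr_r, cos_neg. reflexivity. }
  assert (T4 : Rabs (vp n (x - y + 2) * (- g y - g x)) <= 2 * e * vp n (x - y + 2) + 2 * M * q ^ n).
  { rewrite E4. assert (A : 0 <= Rabs (x - y) <= 1) by (split; [apply Rabs_pos|apply Rabs_le; lra]).
    apply Hterm; [rewrite Rabs_pos_eq; lra| |apply Gm]. rewrite Rabs_pos_eq by lra. intros; lra. }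
  unfold kernel.
  apply Rabs_le_between in T1, T2, T3, T4. apply Rabs_le. lra. }
unfold Rdiv. rewrite Rabs_mult, Rabs_inv, (Rabs_pos_eq (vp_mass n)) by lra.
apply Rmult_le_reg_r with (vp_mass n); [exact Hp|]. rewrite Rmult_assoc, Rinv_l, Rmult_1_r by lra.
eapply Rle_trans.
- apply (abs_RInt_le_prim _ (fun r => 2 * e * RInt (kernel 1 1 1 n x) 0 r + 8 * M * q ^ n * r)
    (fun r => 2 * e * kernel 1 1 1 n x r + 8 * M * q ^ n)); [lra|cont| | |].
  + apply cont1_plus; [apply cont1_mult; [cont|apply cont1_RInt, Hk]|cont].
  + intros r _. evar_last; [apply derive_plus|].
    * apply (is_derive_scal (RInt (kernel 1 1 1 n x) 0)), is_derive_RInt_cont1, Hk.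
    * apply (is_derive_scal (fun r => r) r _ 1), derive_id.
    * simpl. ring.
  + intros r Hr. apply Hpt; lra.
- rewrite RInt_kernel_one, RInt_point_R. lra.
Qed.

(** * Duhamel's formula for sine sums *)

(** In the time [theta] the equation W_t = theta1 W_yy becomes the heat equation. Later [theta1] is
    1 / s^2, and [kappa] bounds it from below, so that elapsed time keeps its smoothing effect. *)
Definition time_change (T kappa : R) (theta theta1 : R -> R) : Prop :=
  0 < kappa /\ theta 0 = 0 /\ (forall t, is_derive theta t (theta1 t)) /\
  forall t, 0 <= t <= T -> kappa <= theta1 t.

Definition profile (W0 W01 W02 : R -> R) : Prop :=
  cont1 W0 /\ cont1 W01 /\ cont1 W02 /\
  (forall y, 0 < y < 1 -> is_derive W0 y (W01 y) /\ is_derive W01 y (W02 y)) /\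
  W0 0 = 0 /\ W01 1 = 0.

Lemma profile_zero : profile (fun _ => 0) (fun _ => 0) (fun _ => 0).
Proof. do 3 (split; [apply cont1_const|]). split; [intros; split; apply derive_const|auto]. Qed.

Definition forced_coef (g : nat -> R) (F : R -> R -> R) (r : R) (j : nat) : R :=
  g j * sine_coef (fun y => F y r) j.

(** Variation of constants for c' = - (freq j)^2 theta' c + f, where f is the sine coefficient of
    the forcing. *)
Definition duhamel_coef (theta : R -> R) (F : R -> R -> R) (W0 : R -> R) (j : nat) (t : R) : R :=
  exp (- freq j ^ 2 * theta t) * (sine_coef W0 j
    + RInt (fun r => exp (freq j ^ 2 * theta r) * sine_coef (fun y => F y r) j) 0 t).

(** As in [heat_sum], [c] counts derivatives in [x] through a phase; here the powers of [freq] are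
    written out. *)
Definition duhamel_sum theta F W0 (g : nat -> R) (N c : nat) (x t : R) : R :=
  sum_f_R0 (fun j => g j * freq j ^ c * duhamel_coef theta F W0 j t * sin (freq j * x + INR c * (PI / 2))) N.

Lemma cont1_sine_coef_param F j : cont2 F -> cont1 (fun r => sine_coef (fun y => F y r) j).
Proof.
intros HF. apply (cont1_RInt_param (fun y r => F y r * sin (freq j * y))); [cont|lra].
Qed.

Lemma duhamel_coef_derive theta dtheta F W0 j t : cont1 theta -> is_derive theta t dtheta -> cont2 F ->
  is_derive (duhamel_coef theta F W0 j) t
    (- freq j ^ 2 * dtheta * duhamel_coef theta F W0 j t + sine_coef (fun y => F y t) j).
Proof.
intros Hth Hd HF. pose proof (cont1_sine_coef_param F j HF) as Hs.
assert (D : is_derive (fun t => RInt (fun r => exp (freq j ^ 2 * theta r) * sine_coef (fun y => F y r) j) 0 t) t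
  (exp (freq j ^ 2 * theta t) * sine_coef (fun y => F y t) j)).
{ apply (is_derive_RInt_cont1 (fun r => exp (freq j ^ 2 * theta r) * sine_coef (fun y => F y r) j)). cont. }
unfold duhamel_coef. der.
assert (E : exp (- (freq j * (freq j * 1)) * theta t) * exp (freq j * (freq j * 1) * theta t) = 1).
{ rewrite <- exp_plus, <- exp_0. f_equal. ring. }
apply Rminus_diag_uniq. ring_simplify.
replace (exp (- freq j ^ 2 * theta t)) with (exp (- (freq j * (freq j * 1)) * theta t)) by (f_equal; ring).
replace (exp (freq j ^ 2 * theta t)) with (exp (freq j * (freq j * 1) * theta t)) by (f_equal; ring).
replace (exp (- (freq j * (freq j * 1)) * theta t) * exp (freq j * (freq j * 1) * theta t) * sine_coef (fun y => F y t) j)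
  with (sine_coef (fun y => F y t) j) by (rewrite E; ring).
ring.
Qed.

Lemma cont1_duhamel_coef theta theta1 F W0 j : (forall t, is_derive theta t (theta1 t)) -> cont2 F ->
  cont1 (duhamel_coef theta F W0 j).
Proof.
intros Hd HF. pose proof (cont1_derive theta theta1 Hd).
apply (cont1_derive _ (fun t => - freq j ^ 2 * theta1 t * duhamel_coef theta F W0 j t + sine_coef (fun y => F y t) j)).
intros t. apply duhamel_coef_derive; auto.
Qed.

Lemma duhamel_sum_dx theta F W0 g N c x t :
  is_derive (fun y => duhamel_sum theta F W0 g N c y t) x (duhamel_sum theta F W0 g N (S c) x t).
Proof.
apply (is_derive_sum (fun j y => g j * freq j ^ c * duhamel_coef theta F W0 j t * sin (freq j * y + INR c * (PI / 2)))).
intros j. rewrite S_INR.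
replace (freq j * x + (INR c + 1) * (PI / 2)) with (PI / 2 + (freq j * x + INR c * (PI / 2))) by field.
rewrite <- cos_sin. der. ring.
Qed.

Lemma duhamel_sum_dt theta theta1 F W0 n x t : (forall t, is_derive theta t (theta1 t)) -> cont2 F ->
  is_derive (fun r => duhamel_sum theta F W0 (multiplier n) n 0 x r) t
    (theta1 t * duhamel_sum theta F W0 (multiplier n) n 2 x t
     + heat_sum (proj_coef n (fun y => F y t)) n 0 x 0).
Proof.
intros Hd HF. pose proof (cont1_derive theta theta1 Hd) as Hc.
evar_last.
- apply (is_derive_sum (fun j r => multiplier n j * freq j ^ 0 * duhamel_coef theta F W0 j r * sin (freq j * x + INR 0 * (PI / 2)))).
  intros j. pose proof (duhamel_coef_derive theta (theta1 t) F W0 j t Hc (Hd t) HF) as D. 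
  apply (derive_mult (fun r => multiplier n j * freq j ^ 0 * duhamel_coef theta F W0 j r) (fun _ => sin (freq j * x + INR 0 * (PI / 2))));
    [|apply derive_const].
  apply (is_derive_scal (duhamel_coef theta F W0 j)). exact D.
- unfold duhamel_sum, heat_sum. rewrite scal_sum, <- plus_sum. apply sum_eq. intros j _.
  unfold proj_coef. simpl. rewrite !Rmult_0_r, exp_0.
  replace (freq j * x + 0 * (PI / 2)) with (freq j * x) by ring.
  replace (freq j * x + (1 + 1) * (PI / 2)) with (freq j * x + PI) by field. rewrite neg_sin. ring.
Qed.

Lemma cont2_duhamel_sum theta theta1 F W0 g N c : (forall t, is_derive theta t (theta1 t)) -> cont2 F ->
  cont2 (duhamel_sum theta F W0 g N c).
Proof.
intros Hd HF. apply cont2_sum. intros j.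
pose proof (cont1_duhamel_coef theta theta1 F W0 j Hd HF). cont.
Qed.

(** Two integrations by parts; the conditions in [profile] and the odd index remove every boundary
    term. *)
Lemma sine_coef_second w w1 w2 j : profile w w1 w2 -> Nat.even j = false -> sine_coef w2 j = - freq j ^ 2 * sine_coef w j.
Proof.
intros (Hw & Hw1 & Hw2 & Hd & E0 & E1) Hj. unfold sine_coef.
assert (E : RInt (fun y => w2 y * sin (freq j * y) + freq j ^ 2 * (w y * sin (freq j * y))) 0 1
   = (w1 1 * sin (freq j * 1) - freq j * (w 1 * cos (freq j * 1)))
     - (w1 0 * sin (freq j * 0) - freq j * (w 0 * cos (freq j * 0)))).
{ apply (ftc_open (fun y => w1 y * sin (freq j * y) - freq j * (w y * cos (freq j * y)))); [lra|cont|cont|].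
  intros y Hy. destruct (Hd y Hy) as [D1 D2]. der. ring. }
rewrite (RInt_plus_cont1 (fun y => w2 y * sin (freq j * y)) (fun y => freq j ^ 2 * (w y * sin (freq j * y)))) in E by cont.
rewrite (RInt_scal_cont1 (fun y => w y * sin (freq j * y))) in E by cont.
rewrite (cos_freq_one j Hj), E0, E1, !Rmult_0_r, sin_0 in E. simpl. lra.
Qed.

(** Two derivatives of the initial part are moved onto the initial value, so that this part is a
    heat flow of [W02], bounded by the maximum principle. In the integral the two derivatives stay
    on the flow. *)
Lemma duhamel_dxx_split theta theta1 F W0 W01 W02 g N x t :
  (forall t, is_derive theta t (theta1 t)) -> cont2 F ->
  profile W0 W01 W02 -> odd_seq g ->
  duhamel_sum theta F W0 g N 2 x t
  = heat_sum (fun j => g j * sine_coef W02 j) N 0 x (theta t)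
    + RInt (fun r => heat_sum (mulfreq (mulfreq (forced_coef g F r))) N 2 x
        (theta t - theta r)) 0 t.
Proof.
intros Hd HF Hp Hg.
pose proof (cont1_derive theta theta1 Hd) as Hc.
unfold heat_sum.
rewrite (RInt_sum (fun j r => mulfreq (mulfreq (forced_coef g F r)) j *
   exp (- freq j ^ 2 * (theta t - theta r)) * sin (freq j * x + INR 2 * (PI / 2)))).
2:{ intros j. unfold mulfreq, forced_coef. pose proof (cont1_sine_coef_param F j HF). cont. }
unfold duhamel_sum. rewrite <- plus_sum. apply sum_eq. intros j _. pose proof (cont1_sine_coef_param F j HF).
rewrite (RInt_ext _ (fun r => (g j * freq j ^ 2 * exp (- freq j ^ 2 * theta t) * sin (freq j * x + INR 2 * (PI / 2)))
   * (exp (freq j ^ 2 * theta r) * sine_coef (fun y => F y r) j))).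
2:{ intros r _. unfold mulfreq, forced_coef.
    replace (- freq j ^ 2 * (theta t - theta r)) with (- freq j ^ 2 * theta t + freq j ^ 2 * theta r) by ring.
    rewrite exp_plus. simpl. ring. }
rewrite (RInt_scal_cont1 (fun r => exp (freq j ^ 2 * theta r) * sine_coef (fun y => F y r) j)) by cont.
unfold duhamel_coef. simpl INR.
replace (freq j * x + (1 + 1) * (PI / 2)) with (freq j * x + PI) by field. rewrite neg_sin.
replace (freq j * x + 0 * (PI / 2)) with (freq j * x) by ring.
destruct (Nat.even j) eqn:E; [rewrite Hg by exact E; ring|].
rewrite (sine_coef_second W0 W01 W02 j) by assumption. simpl. ring.
Qed.

Lemma abs_RInt_sqrt (g : R -> R) (t1 t b : R) : t1 <= t -> cont1 g ->
  (forall r, t1 < r < t -> Rabs (g r) <= b / sqrt (t - r)) ->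
  Rabs (RInt g t1 t) <= 2 * b * sqrt (t - t1).
Proof.
intros Ht Hg Hb.
replace (2 * b * sqrt (t - t1)) with (- 2 * b * sqrt (t - t) - - 2 * b * sqrt (t - t1))
  by (rewrite Rminus_diag, sqrt_0; ring).
apply (abs_RInt_le_prim g (fun r => - 2 * b * sqrt (t - r)) (fun r => b / sqrt (t - r))); auto.
- apply cont1_mult; [cont|]. apply (cont1_comp sqrt (fun r => t - r)); [|cont].
  intros x. apply continuous_sqrt.
- intros r Hr. assert (0 < sqrt (t - r)) by (apply sqrt_lt_R0; lra).
  auto_derive; [lra|]. unfold Rminus in *. field. lra.
Qed.

Lemma theta_growth theta theta1 kappa T : time_change T kappa theta theta1 ->
  forall r t, 0 <= r <= t -> t <= T -> kappa * (t - r) <= theta t - theta r.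
Proof.
intros (_ & _ & Hd & Hk) r t Hr Ht. pose proof (cont1_derive theta theta1 Hd) as Hc.
enough (theta r - kappa * r <= theta t - kappa * t) by lra.
apply (mono_open (fun t => theta t - kappa * t) (fun t => theta1 t - kappa)); [lra| | |].
- intros x _. apply cont1_pt. cont.
- intros x _. specialize (Hd x). der. ring.
- intros x Hx. specialize (Hk x ltac:(lra)). lra.
Qed.

(** Two competing bounds. Leaving one derivative on the forcing gives an integrable singularity but
    only boundedness; leaving none uses smallness of the forcing in the supremum norm, at the price
    of the singularity 1 / (t - r), which is not integrable. *)
Lemma duhamel_integrand_bounds theta theta1 kappa T F g N x t r L :
  time_change T kappa theta theta1 -> odd_seq g ->
  0 <= r < t -> t <= T -> 0 <= x <= 1 ->
  (forall z, 0 <= z <= 1 -> Rabs (heat_sum (mulfreq (forced_coef g F r)) N 1 z 0) <= L) ->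
  Rabs (heat_sum (mulfreq (mulfreq (forced_coef g F r))) N 2 x (theta t - theta r))
    <= L / sqrt kappa / sqrt (t - r) /\
  forall e, (forall z, 0 <= z <= 1 -> Rabs (heat_sum (forced_coef g F r) N 0 z 0) <= e) ->
  Rabs (heat_sum (mulfreq (mulfreq (forced_coef g F r))) N 2 x (theta t - theta r))
    <= 2 * e / kappa / (t - r).
Proof.
intros HT Hg Hr Ht Hx HL. pose proof (proj1 HT) as Hk0.
pose proof (theta_growth theta theta1 kappa T HT r t ltac:(lra) Ht) as Hgr.
assert (Hpos : 0 < kappa * (t - r)) by (apply Rmult_lt_0_compat; lra).
assert (Ho : odd_seq (forced_coef g F r)) by (intros j Hj; unfold forced_coef; rewrite Hg by exact Hj; ring).
assert (HL0 : 0 <= L) by (eapply Rle_trans; [apply Rabs_pos | apply (HL 0); lra]).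
split.
- eapply Rle_trans; [apply (heat_sum_dx_bound _ N 1 L (odd_mulfreq _ Ho) HL x); lra|].
  assert (0 < sqrt kappa) by (apply sqrt_lt_R0; lra). assert (0 < sqrt (t - r)) by (apply sqrt_lt_R0; lra).
  replace (L / sqrt kappa / sqrt (t - r)) with (L / sqrt (kappa * (t - r)))
    by (rewrite sqrt_mult by lra; field; lra).
  apply Rmult_le_compat_l; [exact HL0|]. apply Rinv_le_contravar; [apply sqrt_lt_R0; lra|].
  apply sqrt_le_1; lra.
- intros e He. assert (He0 : 0 <= e) by (eapply Rle_trans; [apply Rabs_pos | apply (He 0); lra]).
  eapply Rle_trans; [apply (heat_sum_dxx_bound _ N 0 e Ho He x); lra|].
  replace (2 * e / kappa / (t - r)) with (2 * e / (kappa * (t - r))) by (field; lra).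
  apply Rmult_le_compat_l; [lra|]. apply Rinv_le_contravar; lra.
Qed.

Lemma cont1_duhamel_integrand theta F g N x t : cont1 theta -> cont2 F ->
  cont1 (fun r => heat_sum (mulfreq (mulfreq (forced_coef g F r))) N 2 x (theta t - theta r)).
Proof.
intros Hc HF. apply cont1_sum. intros j. unfold mulfreq, forced_coef. pose proof (cont1_sine_coef_param F j HF). cont.
Qed.

(** The integrable singularity is used on the last stretch of length [d] only, where it contributes
    a multiple of sqrt d. *)
Lemma RInt_split_bound (g : R -> R) (t d b h1 : R) : cont1 g -> 0 <= t -> 0 < d -> 0 <= b -> 0 <= h1 ->
  (forall r, 0 <= r < t -> Rabs (g r) <= b / sqrt (t - r)) ->
  (d < t -> Rabs (RInt g 0 (t - d)) <= h1) ->
  Rabs (RInt g 0 t) <= 2 * b * sqrt d + h1.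
Proof.
intros Hg Ht Hd Hb Hh1 H1 H2.
destruct (Rlt_dec d t) as [Hlt|Hge].
- rewrite <- (RInt_Chasles g 0 (t - d) t) by (apply ex_RInt_cont1; auto). unfold plus; simpl.
  eapply Rle_trans; [apply Rabs_triang|]. specialize (H2 Hlt).
  pose proof (abs_RInt_sqrt g (t - d) t b ltac:(lra) Hg) as K.
  replace (t - (t - d)) with d in K by ring.
  assert (Rabs (RInt g (t - d) t) <= 2 * b * sqrt d) by (apply K; intros; apply H1; lra). lra.
- pose proof (abs_RInt_sqrt g 0 t b Ht Hg) as K. rewrite Rminus_0_r in K.
  assert (Rabs (RInt g 0 t) <= 2 * b * sqrt t) by (apply K; intros; apply H1; lra).
  assert (sqrt t <= sqrt d) by (apply sqrt_le_1; lra). nra.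
Qed.

Lemma heat_sum_minus (g h k : nat -> R) N c x tau :
  heat_sum (fun j => (g j - h j) * k j) N c x tau
  = heat_sum (fun j => g j * k j) N c x tau - heat_sum (fun j => h j * k j) N c x tau.
Proof. unfold heat_sum. rewrite <- minus_sum. apply sum_eq. intros; ring. Qed.

Lemma heat_sum_minus_dx (g h k : nat -> R) N c x tau :
  heat_sum (mulfreq (fun j => (g j - h j) * k j)) N c x tau
  = heat_sum (mulfreq (fun j => g j * k j)) N c x tau - heat_sum (mulfreq (fun j => h j * k j)) N c x tau.
Proof. unfold heat_sum, mulfreq. rewrite <- minus_sum. apply sum_eq. intros; ring. Qed.

Lemma heat_sum_extend a n N c x tau : (n <= N)%nat -> (forall j, (n < j)%nat -> a j = 0) ->
  heat_sum a N c x tau = heat_sum a n c x tau.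
Proof. intros Hn Ha. apply sum_extend; [exact Hn|]. intros j Hj. rewrite Ha by exact Hj. ring. Qed.

Lemma proj_extend g n N c x tau : (n <= N)%nat ->
  heat_sum (proj_coef n g) N c x tau = heat_sum (proj_coef n g) n c x tau.
Proof.
intros Hn. apply heat_sum_extend; [exact Hn|]. intros j Hj.
unfold proj_coef. rewrite multiplier_high by exact Hj. ring.
Qed.

Lemma proj_dx_extend g n N c x tau : (n <= N)%nat ->
  heat_sum (mulfreq (proj_coef n g)) N c x tau = heat_sum (mulfreq (proj_coef n g)) n c x tau.
Proof.
intros Hn. apply heat_sum_extend; [exact Hn|]. intros j Hj.
unfold mulfreq, proj_coef. rewrite multiplier_high by exact Hj. ring.
Qed.

Lemma duhamel_minus theta F W0 n m c x t :
  duhamel_sum theta F W0 (multiplier n) n c x t - duhamel_sum theta F W0 (multiplier m) m c x t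
  = duhamel_sum theta F W0 (fun j => multiplier n j - multiplier m j) (max n m) c x t.
Proof.
assert (E : forall n N, (n <= N)%nat ->
  duhamel_sum theta F W0 (multiplier n) n c x t = duhamel_sum theta F W0 (multiplier n) N c x t).
{ intros k N Hk. symmetry. apply sum_extend; [exact Hk|]. intros j Hj. rewrite multiplier_high by exact Hj. ring. }
rewrite (E n (max n m)), (E m (max n m)) by lia. unfold duhamel_sum. rewrite <- minus_sum.
apply sum_eq. intros; ring.
Qed.

(* Near [r = t] the integrand is at most [L / sqrt (t - r)]; [h] bounds the rest of the integral. *)
Lemma duhamel_dxx_bound theta theta1 kappa T F W0 W01 W02 g N e0 L d h x t :
  time_change T kappa theta theta1 -> cont2 F -> profile W0 W01 W02 -> odd_seq g -> 0 < d -> 0 <= h ->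
  (forall x, 0 <= x <= 1 -> Rabs (heat_sum (fun j => g j * sine_coef W02 j) N 0 x 0) <= e0) ->
  in_rect 1 T x t ->
  (forall z r, 0 <= z <= 1 -> 0 <= r <= t -> Rabs (heat_sum (mulfreq (forced_coef g F r)) N 1 z 0) <= L) ->
  (d < t -> Rabs (RInt (fun r => heat_sum (mulfreq (mulfreq (forced_coef g F r))) N 2 x (theta t - theta r)) 0 (t - d)) <= h) ->
  Rabs (duhamel_sum theta F W0 g N 2 x t) <= e0 + (2 * (L / sqrt kappa) * sqrt d + h).
Proof.
intros Hth HF Hp Hg Hd0 Hh He0 [Hx Ht] HL Hrest. assert (Hth' := Hth). destruct Hth' as (Hk0 & Hth0 & Hd & Hk).
pose proof (cont1_derive theta theta1 Hd) as Hc.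
rewrite (duhamel_dxx_split theta theta1 F W0 W01 W02) by assumption.
eapply Rle_trans; [apply Rabs_triang|]. apply Rplus_le_compat.
- apply heat_sum_bound; auto.
  + intros j Hj. rewrite Hg by exact Hj. ring.
  + pose proof (theta_growth theta theta1 kappa T Hth 0 t ltac:(lra) ltac:(lra)). nra.
- apply RInt_split_bound; auto; try lra.
  + apply cont1_duhamel_integrand; auto.
  + apply Rdiv_le_0_compat; [|apply sqrt_lt_R0, Hk0]. eapply Rle_trans; [apply Rabs_pos | apply (HL 0 t); lra].
  + intros r Hr. apply (duhamel_integrand_bounds theta theta1 kappa T); auto; try lra. intros z Hz. apply HL; lra.
Qed.

(** Meant for the difference of two damped sums, whose forcing is small while its derivative is
    merely bounded: first [d] is chosen to make the term with [L] small, then [e] according to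
    [d]. *)
Lemma duhamel_dxx_small theta theta1 kappa T F W0 W01 W02 g N e0 e L d :
  time_change T kappa theta theta1 -> cont2 F -> profile W0 W01 W02 -> odd_seq g -> 0 < d ->
  (forall x, 0 <= x <= 1 -> Rabs (heat_sum (fun j => g j * sine_coef W02 j) N 0 x 0) <= e0) ->
  (forall x r, in_rect 1 T x r -> Rabs (heat_sum (forced_coef g F r) N 0 x 0) <= e) ->
  (forall x r, in_rect 1 T x r -> Rabs (heat_sum (mulfreq (forced_coef g F r)) N 1 x 0) <= L) ->
  forall x t, in_rect 1 T x t -> Rabs (duhamel_sum theta F W0 g N 2 x t)
    <= e0 + (2 * (L / sqrt kappa) * sqrt d + 2 * e / kappa / d * T).
Proof.
intros Hth HF Hp Hg Hd0 He0 He HL x t Hxt. assert (Hth' := Hth). destruct Hth' as (Hk0 & _ & Hd & _).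
assert (Hxt' := Hxt). destruct Hxt' as [Hx Ht].
assert (He00 : 0 <= e) by (eapply Rle_trans; [apply Rabs_pos | apply (He 0 t); split; lra]).
assert (Hb : 0 <= 2 * e / kappa) by (apply Rdiv_le_0_compat; lra).
assert (Hb2 : 0 <= 2 * e / kappa / d) by (apply Rdiv_le_0_compat; lra).
apply (duhamel_dxx_bound theta theta1 kappa T F W0 W01 W02); auto.
- nra.
- intros z r Hz Hr. apply HL; split; lra.
- intros Hdt. eapply Rle_trans.
  + apply (abs_RInt_le _ 0 (t - d) (2 * e / kappa / d));
      [lra|apply cont1_duhamel_integrand; [apply (cont1_derive theta theta1 Hd)|exact HF]|].
    intros r Hr.
    destruct (duhamel_integrand_bounds theta theta1 kappa T F g N x t r L) as [_ H]; auto; try lra.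
    { intros z Hz. apply HL; split; lra. }
    eapply Rle_trans; [apply (H e); intros z Hz; apply He; split; lra|].
    apply Rmult_le_compat_l; [exact Hb|]. apply Rinv_le_contravar; lra.
  + apply Rmult_le_compat_l; lra.
Qed.

(** Away from r = t the singularity is at most 1 / sqrt d and integrating the exponential gains 1 /
    k. For small [d] and large [k] the factor in front of [A] is therefore as small as desired. *)
Lemma duhamel_dxx_weighted theta theta1 kappa T F W0 W01 W02 g N B0 A k d :
  time_change T kappa theta theta1 -> cont2 F -> profile W0 W01 W02 -> odd_seq g -> 0 < d -> 0 < k -> 0 <= A ->
  (forall x, 0 <= x <= 1 -> Rabs (heat_sum (fun j => g j * sine_coef W02 j) N 0 x 0) <= B0) ->
  (forall x r, in_rect 1 T x r ->
     Rabs (heat_sum (mulfreq (forced_coef g F r)) N 1 x 0) <= A * exp (k * r)) ->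
  forall x t, in_rect 1 T x t -> Rabs (duhamel_sum theta F W0 g N 2 x t)
    <= B0 + A * exp (k * t) * (2 * sqrt d + / (k * sqrt d)) / sqrt kappa.
Proof.
intros Hth HF Hp Hg Hd0 Hkk HA HB HL x t Hxt. assert (Hth' := Hth). destruct Hth' as (Hk0 & _ & Hd & _).
assert (Hxt' := Hxt). destruct Hxt' as [Hx Ht].
assert (Hsk : 0 < sqrt kappa) by (apply sqrt_lt_R0; lra).
assert (Hsd : 0 < sqrt d) by (apply sqrt_lt_R0; lra).
replace (A * exp (k * t) * (2 * sqrt d + / (k * sqrt d)) / sqrt kappa)
  with (2 * (A * exp (k * t) / sqrt kappa) * sqrt d + A / sqrt kappa / sqrt d / k * exp (k * t))
  by (field; repeat split; lra).
assert (Hpos : 0 <= A / sqrt kappa / sqrt d / k) by (repeat apply Rdiv_le_0_compat; lra).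
apply (duhamel_dxx_bound theta theta1 kappa T F W0 W01 W02); auto.
- pose proof (exp_pos (k * t)). nra.
- intros z r Hz Hr. eapply Rle_trans; [apply HL; split; lra|].
  apply Rmult_le_compat_l; [exact HA|]. apply exp_le. nra.
- intros Hdt. eapply Rle_trans.
  + apply (abs_RInt_le_prim _ (fun r => A / sqrt kappa / sqrt d / k * exp (k * r))
      (fun r => A / sqrt kappa / sqrt d * exp (k * r)) 0 (t - d));
      [lra|apply cont1_duhamel_integrand; [apply (cont1_derive theta theta1 Hd)|exact HF]|cont| |].
    { intros r _. der. field. repeat split; lra. }
    intros r Hr. pose proof (exp_pos (k * r)).
    destruct (duhamel_integrand_bounds theta theta1 kappa T F g N x t r (A * exp (k * r))) as [Hi _]; auto; try lra.
    { intros z Hz. apply HL; split; lra. }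
    eapply Rle_trans; [exact Hi|].
    replace (A / sqrt kappa / sqrt d * exp (k * r)) with (A * exp (k * r) / sqrt kappa / sqrt d) by (field; lra).
    apply Rmult_le_compat_l; [apply Rdiv_le_0_compat; nra|].
    apply Rinv_le_contravar; [lra|apply sqrt_le_1; lra].
  + assert (exp (k * (t - d)) <= exp (k * t)) by (apply exp_le; nra).
    pose proof (exp_pos (k * 0)). nra.
Qed.

Lemma ulimit_eq X T (G : nat -> R -> R -> R) g (h : R -> R -> R) : ulimit X T G g ->
  (forall e, 0 < e -> exists N, forall n, (N <= n)%nat -> forall x t, in_rect X T x t -> Rabs (G n x t - h x t) <= e) ->
  forall x t, in_rect X T x t -> g x t = h x t.
Proof.
intros H1 H2 x t Hxt. apply Rminus_diag_uniq. destruct (Req_dec (g x t - h x t) 0) as [|Hn]; [auto|exfalso].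
apply Rabs_pos_lt in Hn. set (D := Rabs (g x t - h x t)) in *.
destruct (H1 (D / 3)) as [N1 K1]; [lra|]. destruct (H2 (D / 3)) as [N2 K2]; [lra|].
specialize (K1 (max N1 N2) ltac:(lia) x t Hxt). specialize (K2 (max N1 N2) ltac:(lia) x t Hxt).
assert (D <= Rabs (G (max N1 N2) x t - h x t) + Rabs (G (max N1 N2) x t - g x t)); [|lra].
unfold D. replace (g x t - h x t) with ((G (max N1 N2) x t - h x t) - (G (max N1 N2) x t - g x t)) by ring.
eapply Rle_trans; [apply Rabs_triang|]. rewrite Rabs_Ropp. lra.
Qed.

Lemma ulimit_bound X T (G : nat -> R -> R -> R) g (B : R -> R -> R) : ulimit X T G g ->
  (forall n x t, in_rect X T x t -> Rabs (G n x t) <= B x t) ->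
  forall x t, in_rect X T x t -> Rabs (g x t) <= B x t.
Proof.
intros H HB x t Hxt. rewrite <- (Rminus_0_r (g x t)).
apply (Un_cv_le_bound (fun n => G n x t) _ 0 _ 0 (ulimit_cv X T G g x t H Hxt)).
intros n _. rewrite Rminus_0_r. auto.
Qed.

(** On [0, T] the functions [F] share a Lipschitz constant, hence a bound and a modulus, so one
    index serves all times. *)
Lemma proj_converges_lip (T L : R) (F : R -> R -> R) : cont2 F -> 0 < T ->
  (forall t, 0 <= t <= T -> F 0 t = 0) -> 0 <= L ->
  (forall t, 0 <= t <= T -> forall x y, 0 <= x <= 1 -> 0 <= y <= 1 -> Rabs (F x t - F y t) <= L * Rabs (x - y)) ->
  forall e, 0 < e -> exists N, forall n, (N <= n)%nat -> forall x t, in_rect 1 T x t ->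
    Rabs (heat_sum (proj_coef n (fun y => F y t)) n 0 x 0 - F x t) <= e.
Proof.
intros HF HT H0 HL Hlip e He.
set (d := Rmin 1 (e / 3 / (L + 1))).
assert (Hq : 0 < e / 3 / (L + 1)) by (repeat apply Rdiv_lt_0_compat; lra).
assert (Hd : 0 < d <= 1) by (split; [apply Rmin_pos; lra|apply Rmin_l]).
destruct (proj_converges L (e / 3) d) as [N HN]; [lra|exact Hd|].
exists N. intros n Hn x t [Hx Ht].
replace e with (3 * (e / 3)) by field. apply (HN n (fun y => F y t)); auto.
- cont.
- intros y Hy. rewrite <- (Rminus_0_r (F y t)), <- (H0 t Ht).
  eapply Rle_trans; [apply Hlip; auto; lra|]. rewrite Rminus_0_r, Rabs_pos_eq by lra. nra.
- intros y z Hy Hz Hyz. eapply Rle_trans; [apply Hlip; auto|].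
  pose proof (Rmin_r 1 (e / 3 / (L + 1))) as Hm. fold d in Hm.
  apply Rle_trans with ((L + 1) * (e / 3 / (L + 1))); [|apply Req_le; field; lra].
  pose proof (Rabs_pos (y - z)). apply Rmult_le_compat; lra.
Qed.

Lemma proj_converges_continuous (g : R -> R) : cont1 g -> g 0 = 0 -> forall e, 0 < e ->
  exists N, forall n, (N <= n)%nat ->
    forall x, 0 <= x <= 1 -> Rabs (heat_sum (proj_coef n g) n 0 x 0 - g x) <= e.
Proof.
intros Hg Hg0 e He. destruct (bounded1 g 0 1 Hg) as (M & HM & HMb); [lra|].
  destruct (uniform_continuity_2d (fun x _ => g x) 0 1 0 0) with (eps := mkposreal (e / 3) ltac:(lra)) as [d' Hd'].
  { intros x y _ _. assert (K : cont2 (fun x _ => g x)) by cont. apply K. }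
  simpl in Hd'. set (d := Rmin 1 d').
  assert (Hdd : 0 < d <= 1) by (split; [apply Rmin_pos; [lra|apply cond_pos]|apply Rmin_l]).
  assert (Hdd' : d <= d') by apply Rmin_r.
  destruct (proj_converges M (e / 3) d) as [N HN]; [lra|exact Hdd|].
  exists N. intros n Hn x Hx. replace e with (3 * (e / 3)) by field. apply HN; auto.
  intros y z Hy Hz Hyz. apply Rlt_le. rewrite Rabs_minus_sym.
  assert (Rabs (0 - 0) < d') by (rewrite Rminus_diag, Rabs_R0; lra).
  apply (Hd' y 0 z 0); try lra. rewrite Rabs_minus_sym; lra.
Qed.

(** Convergence of the damped Duhamel sums is proved for the second derivative; the lower ones
    follow by integration and the time derivative from the equation. The weighted bound is kept for
    all [k] and [d], which are chosen when the drift is added. *)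
Theorem heat_forced (T kappa : R) (theta theta1 : R -> R) (F F1 : R -> R -> R) (W0 W01 W02 : R -> R) :
  0 < T -> time_change T kappa theta theta1 -> cont1 theta1 ->
  cont2 F -> cont2 F1 -> (forall y t, 0 < y < 1 -> 0 <= t <= T -> is_derive (fun z => F z t) y (F1 y t)) ->
  (forall t, 0 <= t <= T -> F 0 t = 0) ->
  profile W0 W01 W02 -> W02 0 = 0 ->
  exists W W1 W2 Wt, rect_C21 1 T W W1 W2 Wt /\
    (forall x t, in_rect 1 T x t -> Wt x t = theta1 t * W2 x t + F x t) /\
    (forall t, 0 <= t <= T -> W 0 t = 0 /\ W1 1 t = 0) /\
    (forall x, 0 <= x <= 1 -> W x 0 = W0 x) /\
    forall A B0 k d, 0 <= A -> 0 < k -> 0 < d ->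
      (forall x t, in_rect 1 T x t -> Rabs (F1 x t) <= A * exp (k * t)) ->
      (forall x, 0 <= x <= 1 -> Rabs (W02 x) <= B0) ->
      forall x t, in_rect 1 T x t ->
        Rabs (W2 x t) <= B0 + A * exp (k * t) * (2 * sqrt d + / (k * sqrt d)) / sqrt kappa.
Proof.
intros HT Hth Hth1 HF HF1 HdF HF0 Hp E2. assert (Hp' := Hp). destruct Hp' as (Hw & Hw1 & Hw2 & Hdw & E0 & E1).
assert (Hth' := Hth). destruct Hth' as (Hk0 & Hth0 & Hd & Hk).
destruct (bounded2 F1 0 1 0 T HF1) as (L & HL & HLb); try lra.
assert (Hlip : forall t, 0 <= t <= T -> forall x y, 0 <= x <= 1 -> 0 <= y <= 1 ->
  Rabs (F x t - F y t) <= L * Rabs (x - y)).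
{ intros t Ht. apply (lipschitz_open (fun x => F x t) (fun x => F1 x t)); [cont| |].
  - intros; apply HdF; auto.
  - intros; apply HLb; lra. }
assert (HPF := proj_converges_lip T L F HF HT HF0 (Rlt_le _ _ HL) Hlip).
assert (HPW := proj_converges_continuous).
pose (W := fun n c x t => duhamel_sum theta F W0 (multiplier n) n c x t).
pose (PF := fun n x t => heat_sum (proj_coef n (fun y => F y t)) n 0 x 0).
pose (Wt := fun n x t => theta1 t * W n 2%nat x t + PF n x t).
assert (HcW : forall n c, cont2 (W n c)) by (intros; apply (cont2_duhamel_sum theta theta1); auto).
assert (HcPF : forall n, cont2 (PF n)).
{ intros n. apply cont2_sum. intros j. unfold proj_coef.
  pose proof (cont2_comp1 _ (fun _ t => t) (cont1_sine_coef_param F j HF) cont2_snd) as Hs.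
  apply cont2_mult; [apply cont2_mult; [apply cont2_mult; [cont|exact Hs]|cont]|cont]. }
assert (Hrect : forall n, rect_C21 1 T (W n 0%nat) (W n 1%nat) (W n 2%nat) (Wt n)).
{ intros n. split; [|split].
  - repeat split; auto. pose proof (HcW n 2%nat). pose proof (HcPF n). unfold Wt. cont.
  - intros x t _ _. split; apply duhamel_sum_dx.
  - intros x t _ _. apply (duhamel_sum_dt theta theta1); auto. }
assert (HW0 : forall n t, W n 0%nat 0 t = 0 /\ W n 1%nat 1 t = 0).
{ intros n t. split; apply sum_zero; intros j.
  - simpl. replace (freq j * 0 + 0 * (PI / 2)) with 0 by ring. rewrite sin_0. ring.
  - destruct (Nat.even j) eqn:E; [rewrite multiplier_odd by exact E; ring|].
    unfold freq at 2. replace (INR j * (PI / 2) * 1 + INR 1 * (PI / 2)) with (INR (S j) * (PI / 2))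
      by (rewrite S_INR; simpl; ring).
    rewrite sin_even_quarter; [ring|]. rewrite Nat.even_succ, <- Nat.negb_even, E. reflexivity. }
assert (C2 : ucauchy 1 T (fun n => W n 2%nat)).
{ intros e He.
  assert (Hsk : 0 < sqrt kappa) by (apply sqrt_lt_R0; lra).
  (* [sd] stands for sqrt d and makes the integral near r = t at most e / 3; [e1] is the accuracy of
     the damped forcing that makes the rest of the integral at most e / 3. *)
  set (sd := e * sqrt kappa / (12 * (L + 1))).
  assert (Hsd : 0 < sd) by (apply Rdiv_lt_0_compat; [apply Rmult_lt_0_compat; lra|lra]).
  set (e1 := e * kappa * (sd * sd) / (12 * (T + 1))).
  assert (He1 : 0 < e1).
  { apply Rdiv_lt_0_compat; [|lra]. assert (0 < e * kappa) by nra. assert (0 < sd * sd) by nra. nra. }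
  destruct (HPF e1 He1) as [N1 HN1]. destruct (HPW W02 Hw2 E2 (e / 6)) as [N2 HN2]; [lra|].
  exists (max N1 N2). intros n m Hn Hm x t Hxt. unfold W. rewrite duhamel_minus.
  eapply Rle_trans.
  - apply (duhamel_dxx_small theta theta1 kappa T F W0 W01 W02 _ _ (e / 3) (2 * e1) (2 * L) (sd * sd)); auto.
    + intros j Hj. rewrite !multiplier_odd by exact Hj. ring.
    + nra.
    + intros z Hz. rewrite heat_sum_minus.
      change (Rabs (heat_sum (proj_coef n W02) (max n m) 0 z 0 - heat_sum (proj_coef m W02) (max n m) 0 z 0) <= e / 3).
      rewrite (proj_extend W02 n), (proj_extend W02 m) by lia.
      pose proof (HN2 n ltac:(lia) z Hz) as A. pose proof (HN2 m ltac:(lia) z Hz) as B.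
      apply Rabs_le_between in A, B. apply Rabs_le; lra.
    + intros z r Hz. unfold forced_coef. rewrite heat_sum_minus.
      change (Rabs (heat_sum (proj_coef n (fun y => F y r)) (max n m) 0 z 0
        - heat_sum (proj_coef m (fun y => F y r)) (max n m) 0 z 0) <= 2 * e1).
      rewrite (proj_extend (fun y => F y r) n), (proj_extend (fun y => F y r) m) by lia.
      pose proof (HN1 n ltac:(lia) z r Hz) as A. pose proof (HN1 m ltac:(lia) z r Hz) as B.
      apply Rabs_le_between in A, B. apply Rabs_le; lra.
    + intros z r [Hz Hr]. unfold forced_coef. rewrite heat_sum_minus_dx.
      change (Rabs (heat_sum (mulfreq (proj_coef n (fun y => F y r))) (max n m) 1 z 0
        - heat_sum (mulfreq (proj_coef m (fun y => F y r))) (max n m) 1 z 0) <= 2 * L).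
      rewrite (proj_dx_extend (fun y => F y r) n), (proj_dx_extend (fun y => F y r) m) by lia.
      assert (K : forall k, Rabs (heat_sum (mulfreq (proj_coef k (fun y => F y r))) k 1 z 0) <= L).
      { intros k. apply (proj_dx_bound k (fun y => F y r) (fun y => F1 y r)); auto; [cont|cont]. }
      pose proof (K n) as A. pose proof (K m) as B. apply Rabs_le_between in A, B. apply Rabs_le; lra.
  - rewrite sqrt_square by lra.
    assert (A1 : 2 * (2 * L / sqrt kappa) * sd <= e / 3).
    { unfold sd. replace (2 * (2 * L / sqrt kappa) * (e * sqrt kappa / (12 * (L + 1))))
        with (e / 3 * (L / (L + 1))) by (field; lra).
      rewrite <- (Rmult_1_r (e / 3)) at 2. apply Rmult_le_compat_l; [lra|].
      apply Rmult_le_reg_r with (L + 1); [lra|]. unfold Rdiv. rewrite Rmult_assoc, Rinv_l; lra. }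
    assert (A2 : 2 * (2 * e1) / kappa / (sd * sd) * T <= e / 3).
    { unfold e1. replace (2 * (2 * (e * kappa * (sd * sd) / (12 * (T + 1)))) / kappa / (sd * sd) * T)
        with (e / 3 * (T / (T + 1))) by (field; repeat split; lra).
      rewrite <- (Rmult_1_r (e / 3)) at 2. apply Rmult_le_compat_l; [lra|].
      apply Rmult_le_reg_r with (T + 1); [lra|]. unfold Rdiv. rewrite Rmult_assoc, Rinv_l; lra. }
    lra. }
assert (C01 : ucauchy 1 T (fun n => W n 0%nat) /\ ucauchy 1 T (fun n => W n 1%nat)).
{ assert (K : forall e, 0 < e -> exists N, forall n m, (N <= n)%nat -> (N <= m)%nat -> forall x t, in_rect 1 T x t ->
    Rabs (W n 1%nat x t - W m 1%nat x t) <= e /\ Rabs (W n 0%nat x t - W m 0%nat x t) <= e).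
  { intros e He. destruct (C2 e He) as [N HN]. exists N. intros n m Hn Hm x t [Hx Ht].
    pose proof (HcW n 0%nat). pose proof (HcW m 0%nat). pose proof (HcW n 1%nat). pose proof (HcW m 1%nat).
    apply (second_derivative_bound (fun x => W n 0%nat x t - W m 0%nat x t) (fun x => W n 1%nat x t - W m 1%nat x t)
      (fun x => W n 2%nat x t - W m 2%nat x t) e); auto; try cont.
    - intros z Hz. split; apply derive_minus; apply duhamel_sum_dx.
    - rewrite (proj1 (HW0 n t)), (proj1 (HW0 m t)). ring.
    - rewrite (proj2 (HW0 n t)), (proj2 (HW0 m t)). ring.
    - intros z Hz. apply HN; auto. split; auto. }
  split; intros e He; destruct (K e He) as [N HN]; exists N; intros; apply HN; auto. }
destruct C01 as [C0 C1].
destruct (bounded1 theta1 0 T Hth1) as (B & HB & HBb); [lra|].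
assert (Ct : ucauchy 1 T Wt).
{ intros e He. destruct (C2 (e / (3 * B))) as [N1 HN1]; [apply Rdiv_lt_0_compat; lra|].
  destruct (HPF (e / 3)) as [N2 HN2]; [lra|].
  exists (max N1 N2). intros n m Hn Hm x t Hxt.
  pose proof (HN1 n m ltac:(lia) ltac:(lia) x t Hxt) as A1.
  pose proof (HN2 n ltac:(lia) x t Hxt) as A2. pose proof (HN2 m ltac:(lia) x t Hxt) as A3.
  unfold Wt. fold (PF n x t) in A2. fold (PF m x t) in A3.
  assert (A4 : Rabs (theta1 t * (W n 2%nat x t - W m 2%nat x t)) <= e / 3).
  { rewrite Rabs_mult. replace (e / 3) with (B * (e / (3 * B))) by (field; lra).
    apply Rmult_le_compat; try apply Rabs_pos; [apply HBb, Hxt|exact A1]. }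
  apply Rabs_le_between in A2, A3, A4. apply Rabs_le; lra. }
destruct (rect_C21_limit 1 T _ _ _ _ ltac:(lra) HT Hrect C0 C1 C2 Ct)
  as (V & V1 & V2 & Vt & HV & LV & LV1 & LV2 & LVt).
exists V, V1, V2, Vt. split; [exact HV|]. split; [|split; [|split]].
- apply (ulimit_eq 1 T Wt); [exact LVt|]. intros e He.
  destruct (LV2 (e / (2 * B))) as [N1 HN1]; [apply Rdiv_lt_0_compat; lra|].
  destruct (HPF (e / 2)) as [N2 HN2]; [lra|].
  exists (max N1 N2). intros n Hn x t Hxt.
  pose proof (HN1 n ltac:(lia) x t Hxt) as A1. pose proof (HN2 n ltac:(lia) x t Hxt) as A2.
  unfold Wt. fold (PF n x t) in A2.
  assert (A4 : Rabs (theta1 t * (W n 2%nat x t - V2 x t)) <= e / 2).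
  { rewrite Rabs_mult. replace (e / 2) with (B * (e / (2 * B))) by (field; lra).
    apply Rmult_le_compat; try apply Rabs_pos; [apply HBb, Hxt|exact A1]. }
  apply Rabs_le_between in A2, A4. apply Rabs_le; lra.
- intros t Ht.
  assert (I0 : in_rect 1 T 0 t) by (split; lra). assert (I1 : in_rect 1 T 1 t) by (split; lra).
  split; eapply UL_sequence.
  + apply (ulimit_cv 1 T _ V 0 t LV I0).
  + intros e He. exists 0%nat. intros n _. rewrite (proj1 (HW0 n t)). unfold Rdist. rewrite Rminus_diag, Rabs_R0. lra.
  + apply (ulimit_cv 1 T _ V1 1 t LV1 I1).
  + intros e He. exists 0%nat. intros n _. rewrite (proj2 (HW0 n t)). unfold Rdist. rewrite Rminus_diag, Rabs_R0. lra.
- intros x Hx. assert (I0 : in_rect 1 T x 0) by (split; lra).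
  eapply UL_sequence; [apply (ulimit_cv 1 T _ V x 0 LV I0)|].
  intros e He. destruct (HPW W0 Hw E0 (e / 2)) as [N HN]; [lra|].
  exists N. intros n Hn. unfold Rdist. specialize (HN n Hn x Hx).
  replace (W n 0%nat x 0) with (heat_sum (proj_coef n W0) n 0 x 0); [lra|].
  apply sum_eq. intros j _. unfold proj_coef, duhamel_coef. rewrite Hth0, RInt_point_R.
  simpl. rewrite !Rmult_0_r, exp_0. ring.
- intros A B0 k d HA Hkk Hdd HFA HB0.
  apply (ulimit_bound 1 T (fun n => W n 2%nat) V2
    (fun x t => B0 + A * exp (k * t) * (2 * sqrt d + / (k * sqrt d)) / sqrt kappa)); [exact LV2|].
  intros n. apply (duhamel_dxx_weighted theta theta1 kappa T F W0 W01 W02); auto.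
  + apply multiplier_odd.
  + intros x Hx. apply proj_bound; auto.
  + intros x r [Hx Hr]. apply (proj_dx_bound n (fun y => F y r) (fun y => F1 y r)); auto; [cont|cont|].
    intros y Hy. apply HFA; split; auto.
Qed.

(** * Lifting the boundary value *)

(** Sines of odd index are odd about 0 and even about 1, so reflections carry every real point into
    [0, 1] up to a sign. *)
Lemma sine_sum_fold a N M : odd_seq a ->
  (forall z, 0 <= z <= 1 -> Rabs (heat_sum a N 0 z 0) <= M) -> forall z, Rabs (heat_sum a N 0 z 0) <= M.
Proof.
intros Ha HM.
assert (Eo : forall z, heat_sum a N 0 (- z) 0 = - heat_sum a N 0 z 0).
{ intros z. unfold heat_sum. rewrite <- Rmult_1_l at 1. replace (- sum_f_R0 _ N) with (-1 * sum_f_R0 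
    (fun j => a j * exp (- freq j ^ 2 * 0) * sin (freq j * z + INR 0 * (PI / 2))) N) by ring.
  rewrite Rmult_1_l, scal_sum. apply sum_eq. intros j _. simpl.
  replace (freq j * - z + 0 * (PI / 2)) with (- (freq j * z + 0 * (PI / 2))) by ring. rewrite sin_neg. ring. }
assert (Er : forall z, heat_sum a N 0 (2 - z) 0 = heat_sum a N 0 z 0).
{ intros z. apply sum_eq. intros j _. destruct (Nat.even j) eqn:E; [rewrite Ha by exact E; ring|].
  simpl. replace (freq j * (2 - z) + 0 * (PI / 2)) with (INR j * PI - (freq j * z + 0 * (PI / 2)))
    by (unfold freq; field).
  rewrite sin_minus. destruct (sin_cos_INR_PI j) as [-> ->]. rewrite E. ring. }
assert (Hn : forall n z, 0 <= z <= 2 -> Rabs (heat_sum a N 0 (z + 2 * INR n) 0) <= M).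
{ induction n; intros z Hz.
  - simpl. rewrite Rmult_0_r, Rplus_0_r. destruct (Rle_dec z 1); [apply HM; lra|].
    rewrite <- Er. apply HM; lra.
  - rewrite S_INR. replace (z + 2 * (INR n + 1)) with (2 - - (z + 2 * INR n)) by ring.
    rewrite Er, Eo, Rabs_Ropp. apply IHn, Hz. }
assert (Hp : forall z, 0 <= z -> Rabs (heat_sum a N 0 z 0) <= M).
{ intros z Hz. destruct (nfloor_ex (z / 2)) as [n Hn2]; [lra|].
  replace z with ((z - 2 * INR n) + 2 * INR n) by ring. apply Hn. lra. }
intros z. destruct (Rle_dec 0 z); [apply Hp; auto|].
rewrite <- (Ropp_involutive z), Eo, Rabs_Ropp. apply Hp. lra.
Qed.

(** The function exp (- d x) sin (w t - d x) solves the heat equation exactly when 2 d^2 = w; these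
    are the thermal waves below a periodically heated surface. Here w is [freq j / T]. *)
Definition decay (T : R) (j : nat) : R := sqrt (freq j / T / 2).

Lemma freq_nonneg j : 0 <= freq j.
Proof. apply Rmult_le_pos; [apply pos_INR|pose proof PI_RGT_0; lra]. Qed.

Lemma decay_sq T j : 0 < T -> decay T j * decay T j = freq j / T / 2.
Proof.
intros HT. apply sqrt_sqrt. pose proof (freq_nonneg j).
apply Rdiv_le_0_compat; [apply Rdiv_le_0_compat; lra|lra].
Qed.

(* Solutions on the half-line for all times, negative ones included: their boundary
   values lift data given on [0, T] without an initial layer. *)
Definition ancient (T : R) (a : nat -> R) (s : R) (N : nat) (x t : R) : R :=
  sum_f_R0 (fun j => a j * exp (- decay T j * x) * sin (freq j / T * t - decay T j * x + s)) N.

Definition ancient_dx (T : R) (a : nat -> R) (s : R) (N : nat) (x t : R) : R :=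
  sum_f_R0 (fun j => a j * (- decay T j * exp (- decay T j * x) *
    (sin (freq j / T * t - decay T j * x + s) + cos (freq j / T * t - decay T j * x + s)))) N.

Definition ancient_dt (T : R) (a : nat -> R) (s : R) (N : nat) (x t : R) : R :=
  sum_f_R0 (fun j => a j * (freq j / T) * exp (- decay T j * x) * cos (freq j / T * t - decay T j * x + s)) N.

Lemma ancient_derive T a s N x t : 0 < T ->
  is_derive (fun y => ancient T a s N y t) x (ancient_dx T a s N x t) /\
  is_derive (fun y => ancient_dx T a s N y t) x (ancient_dt T a s N x t) /\
  is_derive (fun r => ancient T a s N x r) t (ancient_dt T a s N x t).
Proof.
intros HT. split; [|split].
- apply (is_derive_sum (fun j y => a j * exp (- decay T j * y) * sin (freq j / T * t - decay T j * y + s))).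
  intros j. der. ring.
- apply (is_derive_sum (fun j y => a j * (- decay T j * exp (- decay T j * y) *
    (sin (freq j / T * t - decay T j * y + s) + cos (freq j / T * t - decay T j * y + s))))).
  intros j. replace (freq j / T) with (2 * (decay T j * decay T j)) by (rewrite decay_sq by exact HT; field; lra).
  der. ring.
- apply (is_derive_sum (fun j r => a j * exp (- decay T j * x) * sin (freq j / T * r - decay T j * x + s))).
  intros j. der. ring.
Qed.

Lemma cont2_ancient T a s N : cont2 (ancient T a s N) /\ cont2 (ancient_dx T a s N) /\ cont2 (ancient_dt T a s N).
Proof. unfold ancient, ancient_dx, ancient_dt. repeat split; apply cont2_sum; intros j; cont. Qed.

(** The sum of the |a_j| enters only as the qualitative growth bound that [max_principle_ancient]
    asks for; the estimate itself comes from the boundary values. *)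
Lemma ancient_bound T a s N C M : 0 < T -> (forall t, Rabs (C + ancient T a s N 0 t) <= M) ->
  forall x t, 0 <= x -> Rabs (C + ancient T a s N x t) <= M.
Proof.
intros HT HM.
assert (HK : forall x t, 0 <= x -> Rabs (ancient T a s N x t) <= sum_f_R0 (fun j => Rabs (a j)) N).
{ intros x t Hx. eapply Rle_trans; [apply sum_f_R0_triangle|]. apply sum_Rle. intros j _.
  rewrite Rmult_assoc, Rabs_mult. rewrite <- (Rmult_1_r (Rabs (a j))) at 2.
  apply Rmult_le_compat_l; [apply Rabs_pos|]. rewrite Rabs_mult, <- (Rmult_1_r 1).
  apply Rmult_le_compat; try apply Rabs_pos.
  - rewrite Rabs_pos_eq by apply Rlt_le, exp_pos. rewrite <- exp_0.
    assert (0 <= decay T j) by apply sqrt_pos.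
    destruct (Req_dec (- decay T j * x) 0) as [->|]; [lra|]. apply Rlt_le, exp_increasing. nra.
  - apply Rabs_le, SIN_bound. }
destruct (cont2_ancient T a s N) as (H0 & H1 & H2).
assert (K : forall sg, (sg = 1 \/ sg = -1) -> forall x t, 0 <= x -> sg * (C + ancient T a s N x t) <= M).
{ intros sg Hsg.
  apply (max_principle_ancient (fun x t => sg * (C + ancient T a s N x t))
    (fun x t => sg * ancient_dx T a s N x t) (fun x t => sg * ancient_dt T a s N x t) M
    (Rabs C + sum_f_R0 (fun j => Rabs (a j)) N)).
  - cont.
  - intros x t. destruct (ancient_derive T a s N x t HT) as (D1 & D2 & D3).
    split; [|split]; der; ring.
  - intros x t Hx. specialize (HK x t Hx). apply Rabs_le_between in HK.
    pose proof (Rle_abs C). pose proof (Rle_abs (- C)) as Hc. rewrite Rabs_Ropp in Hc.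
    destruct Hsg as [-> | ->]; lra.
  - intros t. specialize (HM t). apply Rabs_le_between in HM. destruct Hsg as [-> | ->]; lra. }
intros x t Hx. apply Rabs_le.
pose proof (K 1 (or_introl eq_refl) x t Hx). pose proof (K (-1) (or_intror eq_refl) x t Hx). lra.
Qed.

Lemma ancient_origin T b N : ancient T b (PI / 2) N 0 0 = sum_f_R0 b N.
Proof. apply sum_eq. intros j _. rewrite !Rmult_0_r, exp_0, Rminus_0_r, Rplus_0_l, sin_PI2. ring. Qed.

(* The boundary value of [sum b - ancient b] vanishes at [t = 0] and has time derivative
   [sum a_j sin (freq j t / T)], small by assumption. *)
Lemma ancient_primitive_bound T a b N e : 0 < T -> odd_seq a -> (forall j, b j * (freq j / T) = a j) ->
  (forall z, 0 <= z <= 1 -> Rabs (heat_sum a N 0 z 0) <= e) ->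
  forall x t, 0 <= x ->
    Rabs (ancient_dt T b (PI / 2) N x t) <= e /\
    Rabs (sum_f_R0 b N - ancient T b (PI / 2) N x t) <= 4 * T * e /\
    Rabs (ancient_dx T b (PI / 2) N x t) <= (8 * T + 1) * e.
Proof.
intros HT Ha Hb He.
assert (He0 : 0 <= e) by (eapply Rle_trans; [apply Rabs_pos | apply (He 0); lra]).
pose proof (sine_sum_fold a N e Ha He) as Hf.
(* Differentiating in time turns [b] into [a] and cosines into sines: the result is again an ancient
   solution, and its boundary value is the given sine sum, small on the whole line. *)
assert (Edt : forall x t, ancient_dt T b (PI / 2) N x t = - (0 + ancient T a 0 N x t)).
{ intros x t. unfold ancient_dt, ancient. rewrite Rplus_0_l.
  replace (- sum_f_R0 _ N) with (-1 * sum_f_R0 (fun j => a j * exp (- decay T j * x) *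
    sin (freq j / T * t - decay T j * x + 0)) N) by ring.
  rewrite scal_sum. apply sum_eq. intros j _. rewrite Hb.
  rewrite (Rplus_comm _ (PI / 2)), <- Rplus_0_r, Rplus_0_r.
  replace (PI / 2 + (freq j / T * t - decay T j * x)) with (PI / 2 - - (freq j / T * t - decay T j * x)) by ring.
  rewrite cos_shift, sin_neg, Rplus_0_r. ring. }
assert (E0 : forall t, ancient T a 0 N 0 t = heat_sum a N 0 (t / T) 0).
{ intros t. apply sum_eq. intros j _. rewrite !Rmult_0_r, !exp_0. simpl. f_equal. f_equal. unfold Rdiv. ring. }
assert (B2 : forall x t, 0 <= x -> Rabs (ancient_dt T b (PI / 2) N x t) <= e).
{ intros x t Hx. rewrite Edt, Rabs_Ropp. apply ancient_bound; auto. intros r. rewrite Rplus_0_l, E0. apply Hf. }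
(* Period 4 T and evenness in time reduce the bound on the primitive to one period, over which a
   derivative of size [e] accumulates at most 4 T e. *)
assert (Eper : forall n t, ancient T b (PI / 2) N 0 (t + 4 * T * INR n) = ancient T b (PI / 2) N 0 t).
{ intros n t. apply sum_eq. intros j _. f_equal. rewrite !Rmult_0_r, !Rminus_0_r.
  rewrite !(Rplus_comm _ (PI / 2)), <- !cos_sin.
  replace (freq j / T * (t + 4 * T * INR n)) with (freq j / T * t + 2 * INR (j * n) * PI)
    by (rewrite mult_INR; unfold freq; field; lra).
  apply cos_period. }
assert (Eev : forall t, ancient T b (PI / 2) N 0 (- t) = ancient T b (PI / 2) N 0 t).
{ intros t. apply sum_eq. intros j _. f_equal. rewrite !Rmult_0_r, !Rminus_0_r.
  rewrite !(Rplus_comm _ (PI / 2)), <- !cos_sin, <- Ropp_mult_distr_r, cos_neg. reflexivity. }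
pose proof (ancient_origin T b N) as Ez.
assert (B0s : forall t, 0 <= t <= 4 * T -> Rabs (sum_f_R0 b N - ancient T b (PI / 2) N 0 t) <= 4 * T * e).
{ intros t Ht. rewrite <- Ez. eapply Rle_trans.
  - destruct (cont2_ancient T b (PI / 2) N) as (H0 & _).
    apply (lipschitz_open (fun t => ancient T b (PI / 2) N 0 t) (fun t => ancient_dt T b (PI / 2) N 0 t) 0 (4 * T) e).
    + cont.
    + intros r _. apply ancient_derive, HT.
    + intros r _. apply B2; lra.
    + lra.
    + lra.
  - rewrite Rmult_comm. apply Rmult_le_compat_r; [exact He0|]. apply Rabs_le; lra. }
assert (B0p : forall t, 0 <= t -> Rabs (sum_f_R0 b N - ancient T b (PI / 2) N 0 t) <= 4 * T * e).
{ intros t Ht. destruct (nfloor_ex (t / (4 * T))) as [n Hn]; [apply Rdiv_le_0_compat; lra|].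
  assert (Et : t / (4 * T) * (4 * T) = t) by (field; lra).
  replace t with ((t - 4 * T * INR n) + 4 * T * INR n) by ring. rewrite Eper. apply B0s. nra. }
assert (B0 : forall x t, 0 <= x -> Rabs (sum_f_R0 b N - ancient T b (PI / 2) N x t) <= 4 * T * e).
{ intros x t Hx.
  replace (sum_f_R0 b N - ancient T b (PI / 2) N x t) with (- (- sum_f_R0 b N + ancient T b (PI / 2) N x t)) by ring.
  rewrite Rabs_Ropp. apply ancient_bound; auto. intros r.
  replace (- sum_f_R0 b N + ancient T b (PI / 2) N 0 r) with (- (sum_f_R0 b N - ancient T b (PI / 2) N 0 r)) by ring.
  rewrite Rabs_Ropp. destruct (Rle_dec 0 r); [apply B0p; auto|].
  rewrite <- (Eev r). apply B0p. lra. }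
intros x t Hx. split; [apply B2, Hx|]. split; [apply B0, Hx|].
destruct (cont2_ancient T b (PI / 2) N) as (H0 & H1 & _).
(* Interpolation: over an interval of length 1 the mean value theorem finds a slope of at most 8 T
   e, and the second derivative, bounded by [e], carries it back to [x]. *)
destruct (mvt_open (fun x => ancient T b (PI / 2) N x t) (fun x => ancient_dx T b (PI / 2) N x t) x (x + 1)) as (c & Hc & Ec).
{ lra. } { intros y _. apply cont1_pt. cont. } { intros y _. apply ancient_derive, HT. }
assert (Hl : Rabs (ancient_dx T b (PI / 2) N x t - ancient_dx T b (PI / 2) N c t) <= e * Rabs (x - c)).
{ apply (lipschitz_open (fun x => ancient_dx T b (PI / 2) N x t) (fun x => ancient_dt T b (PI / 2) N x t) x (x + 1) e).
  - cont.
  - intros y _. apply ancient_derive, HT.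
  - intros y Hy. apply B2; lra.
  - lra.
  - lra. }
assert (Rabs (x - c) <= 1) by (apply Rabs_le; lra).
assert (Hl2 : Rabs (ancient_dx T b (PI / 2) N x t - ancient_dx T b (PI / 2) N c t) <= e) by nra.
pose proof (B0 x t Hx) as P0. pose proof (B0 (x + 1) t ltac:(lra)) as P1.
replace (ancient_dx T b (PI / 2) N c t * (x + 1 - x)) with (ancient_dx T b (PI / 2) N c t) in Ec by ring.
apply Rabs_le_between in P0, P1, Hl2. apply Rabs_le. lra.
Qed.

Lemma heat_lift (T X : R) (F F1 : R -> R) : 0 < T -> 0 < X ->
  (forall t, is_derive F t (F1 t)) -> cont1 F1 ->
  exists U U1 U2, rect_C21 X T U U1 U2 U2 /\
    (forall t, 0 <= t <= T -> U 0 t = F t /\ U2 0 t = F1 t).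
Proof.
intros HT HX HF HF1.
(* A sine sum needs a function that vanishes at 0; the constant [F1 0] is carried by the caloric
   polynomial t + x^2 / 2 in [U] below. *)
set (g := fun z => F1 (T * z) - F1 0).
assert (Hg : cont1 g) by (unfold g; cont).
assert (Hg0 : g 0 = 0) by (unfold g; rewrite Rmult_0_r; ring).
pose (a := fun n => proj_coef n g).
(* Division by the frequency integrates in time; at j = 0 the numerator is zero. *)
pose (b := fun n j => a n j / (freq j / T)).
assert (Ha : forall n, odd_seq (a n)).
{ intros n j Hj. unfold a, proj_coef. rewrite multiplier_odd by exact Hj. ring. }
assert (Hb : forall n j, b n j * (freq j / T) = a n j).
{ intros n j. unfold b. destruct j.
  - rewrite (Ha n 0%nat) by reflexivity. unfold Rdiv. ring.
  - assert (freq (S j) <> 0).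
    { apply Rmult_integral_contrapositive_currified; [apply not_0_INR; lia|]. pose proof PI_RGT_0. lra. }
    field. split; lra. }
assert (Hhigh : forall n j, (n < j)%nat -> b n j = 0).
{ intros n j Hj. unfold b, a, proj_coef. rewrite multiplier_high by exact Hj. unfold Rdiv. ring. }
pose (A0 := fun n x t => sum_f_R0 (b n) n - ancient T (b n) (PI / 2) n x t).
pose (A1 := fun n x t => - ancient_dx T (b n) (PI / 2) n x t).
pose (A2 := fun n x t => - ancient_dt T (b n) (PI / 2) n x t).
assert (Hcauchy : forall e, 0 < e -> exists N, forall n m, (N <= n)%nat -> (N <= m)%nat ->
  forall x t, in_rect X T x t -> Rabs (A0 n x t - A0 m x t) <= 4 * T * e /\
    Rabs (A1 n x t - A1 m x t) <= (8 * T + 1) * e /\ Rabs (A2 n x t - A2 m x t) <= e).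
{ intros e He. destruct (proj_converges_continuous g Hg Hg0 (e / 2)) as [N HN]; [lra|].
  exists N. intros n m Hn Hm x t [Hx Ht].
  set (K := max n m).
  destruct (ancient_primitive_bound T (fun j => a n j - a m j) (fun j => b n j - b m j) K e HT) with (x := x) (t := t)
    as (P2 & P0 & P1).
  - intros j Hj. rewrite !Ha by exact Hj. ring.
  - intros j. rewrite <- !Hb. ring.
  - intros z Hz.
    replace (heat_sum (fun j => a n j - a m j) K 0 z 0) with (heat_sum (a n) n 0 z 0 - heat_sum (a m) m 0 z 0).
    + pose proof (HN n Hn z Hz) as Q1. pose proof (HN m Hm z Hz) as Q2.
      fold (a n) in Q1. fold (a m) in Q2. apply Rabs_le_between in Q1, Q2. apply Rabs_le; lra.
    + unfold a. rewrite <- (proj_extend g n K), <- (proj_extend g m K) by (unfold K; lia).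
      unfold heat_sum. rewrite <- minus_sum. apply sum_eq. intros; ring.
  - lra.
  - assert (E : forall (G : nat -> R -> R), (forall j u v, G j (u - v) = G j u - G j v) -> (forall j, G j 0 = 0) ->
      sum_f_R0 (fun j => G j (b n j - b m j)) K = sum_f_R0 (fun j => G j (b n j)) n - sum_f_R0 (fun j => G j (b m j)) m).
    { intros G Gm G0. rewrite <- (sum_extend (fun j => G j (b n j)) n K), <- (sum_extend (fun j => G j (b m j)) m K)
        by (try (unfold K; lia); intros j Hj; rewrite Hhigh by exact Hj; apply G0).
      rewrite <- minus_sum. apply sum_eq. intros j _. apply Gm. }
    unfold A0, A1, A2. unfold ancient_dt, ancient_dx, ancient in *.
    rewrite (E (fun j u => u * (freq j / T) * exp (- decay T j * x) * cos (freq j / T * t - decay T j * x + PI / 2))) in P2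
      by (intros; ring).
    rewrite (E (fun j u => u * (- decay T j * exp (- decay T j * x) *
      (sin (freq j / T * t - decay T j * x + PI / 2) + cos (freq j / T * t - decay T j * x + PI / 2))))) in P1
      by (intros; ring).
    rewrite (E (fun j u => u)) in P0 by (intros; ring).
    rewrite (E (fun j u => u * exp (- decay T j * x) * sin (freq j / T * t - decay T j * x + PI / 2))) in P0
      by (intros; ring).
    cbv beta in P0, P1, P2.
    change (sum_f_R0 (fun j => b n j) n) with (sum_f_R0 (b n) n) in P0.
    change (sum_f_R0 (fun j => b m j) m) with (sum_f_R0 (b m) m) in P0.
    apply Rabs_le_between in P0, P1, P2. split; [|split]; apply Rabs_le; lra. }
pose (U := fun n x t => F 0 + F1 0 * (t + x ^ 2 / 2) + A0 n x t).
pose (U1 := fun n x t => F1 0 * x + A1 n x t).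
pose (U2 := fun n x t => F1 0 + A2 n x t).
assert (Hrect : forall n, rect_C21 X T (U n) (U1 n) (U2 n) (U2 n)).
{ intros n. destruct (cont2_ancient T (b n) (PI / 2) n) as (H0 & H1 & H2).
  unfold U, U1, U2, A0, A1, A2. split; [|split].
  - repeat split; cont; intros; lra.
  - intros x t _ _. destruct (ancient_derive T (b n) (PI / 2) n x t HT) as (D1 & D2 & _).
    split; der; field.
  - intros x t _ _. destruct (ancient_derive T (b n) (PI / 2) n x t HT) as (_ & _ & D3).
    der. field. }
assert (Hu : forall (G H : nat -> R -> R -> R) c, 0 < c -> (forall n m x t, G n x t - G m x t = H n x t - H m x t) ->
  (forall e, 0 < e -> exists N, forall n m, (N <= n)%nat -> (N <= m)%nat ->
    forall x t, in_rect X T x t -> Rabs (H n x t - H m x t) <= c * e) -> ucauchy X T G).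
{ intros G H c Hc E K e He. destruct (K (e / c)) as [N HN]; [apply Rdiv_lt_0_compat; lra|].
  exists N. intros n m Hn Hm x t Hxt. rewrite E. replace e with (c * (e / c)) by (field; lra). apply HN; auto. }
assert (C0 : ucauchy X T U).
{ apply (Hu U A0 (4 * T)); [lra|intros; unfold U; ring|].
  intros e He. destruct (Hcauchy e He) as [N HN]. exists N. intros; apply HN; auto. }
assert (C1 : ucauchy X T U1).
{ apply (Hu U1 A1 (8 * T + 1)); [lra|intros; unfold U1; ring|].
  intros e He. destruct (Hcauchy e He) as [N HN]. exists N. intros; apply HN; auto. }
assert (C2 : ucauchy X T U2).
{ apply (Hu U2 A2 1); [lra|intros; unfold U2; ring|].
  intros e He. destruct (Hcauchy e He) as [N HN]. exists N. intros; rewrite Rmult_1_l; apply HN; auto. }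
destruct (rect_C21_limit X T _ _ _ _ HX HT Hrect C0 C1 C2 C2)
  as (V & V1 & V2 & Vt & HV & LV & LV1 & LV2 & LVt).
assert (Et : forall x t, in_rect X T x t -> Vt x t = V2 x t).
{ apply (ulimit_eq X T U2); [exact LVt|exact LV2]. }
assert (HU2 : forall e, 0 < e -> exists N, forall n, (N <= n)%nat -> forall r, 0 <= r <= T ->
  Rabs (U2 n 0 r - F1 r) <= e).
{ intros e He. destruct (proj_converges_continuous g Hg Hg0 e He) as [N HN].
  exists N. intros n Hn r Hr. specialize (HN n Hn (r / T)).
  assert (Hq : 0 <= r / T <= 1).
  { apply ratio_unit; lra. }
  specialize (HN Hq). unfold g in HN at 2. replace (T * (r / T)) with r in HN by (field; lra).
  replace (U2 n 0 r - F1 r) with (heat_sum (proj_coef n g) n 0 (r / T) 0 - (F1 r - F1 0)); [exact HN|].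
  unfold U2, A2. enough (E : ancient_dt T (b n) (PI / 2) n 0 r = - heat_sum (proj_coef n g) n 0 (r / T) 0) by (rewrite E; ring).
  unfold ancient_dt, heat_sum.
  replace (- sum_f_R0 _ n) with (-1 * sum_f_R0 (fun j => proj_coef n g j * exp (- freq j ^ 2 * 0) *
     sin (freq j * (r / T) + INR 0 * (PI / 2))) n) by ring.
  rewrite scal_sum. apply sum_eq. intros j _. rewrite Hb, !Rmult_0_r, exp_0. simpl INR. rewrite Rmult_0_l, Rplus_0_r, Rminus_0_r.
  rewrite (Rplus_comm _ (PI / 2)).
  replace (PI / 2 + freq j / T * r) with (PI / 2 - - (freq j / T * r)) by ring.
  rewrite cos_shift, sin_neg. unfold a. replace (freq j * (r / T)) with (freq j / T * r) by (unfold Rdiv; ring). ring. }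
exists V, V1, V2. split.
- destruct HV as ((c0 & c1 & c2 & _) & Hx & Ht). split; [auto|]. split; [exact Hx|].
  intros x t Hxx Htt. rewrite <- Et by (split; lra). apply Ht; auto.
- intros t Ht. assert (I0 : in_rect X T 0 t) by (split; lra). split.
  2:{ eapply UL_sequence; [apply (ulimit_cv X T _ V2 0 t LV2 I0)|].
      intros e He. destruct (HU2 (e / 2)) as [N HN]; [lra|]. exists N. intros n Hn. unfold Rdist.
      specialize (HN n Hn t Ht). lra. }
  eapply UL_sequence; [apply (ulimit_cv X T _ V 0 t LV I0)|].
  intros e He. destruct (HU2 (e / (2 * T))) as [N HN]; [apply Rdiv_lt_0_compat; lra|].
  exists N. intros n Hn. unfold Rdist.
  destruct (cont2_ancient T (b n) (PI / 2) n) as (H0 & H1 & H2). pose proof (cont1_derive F F1 HF) as HcF.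
  (* The boundary value is exact at t = 0 and its time derivative converges uniformly, hence it
     converges itself. *)
  assert (E0 : U n 0 0 - F 0 = 0).
  { unfold U, A0. rewrite ancient_origin. simpl. field. }
  replace (U n 0 t - F t) with ((U n 0 t - F t) - (U n 0 0 - F 0)) by lra.
  eapply Rle_lt_trans.
  + apply (lipschitz_open (fun r => U n 0 r - F r) (fun r => U2 n 0 r - F1 r) 0 T (e / (2 * T))); try lra.
    * unfold U, A0. cont.
    * intros r _. apply derive_minus; [|apply HF]. destruct (ancient_derive T (b n) (PI / 2) n 0 r HT) as (_ & _ & D3).
      unfold U, U2, A0, A2. der. field.
    * intros r Hr. apply HN; [exact Hn|lra].
  + rewrite Rminus_0_r, Rabs_pos_eq by lra.
    apply Rle_lt_trans with (e / (2 * T) * T); [apply Rmult_le_compat_l; [apply Rdiv_le_0_compat; lra|lra]|].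
    replace (e / (2 * T) * T) with (e / 2) by (field; lra). lra.
Qed.

(** * The drift term *)

(** Deciding [P n x] classically makes the step total, so that the sequence is a plain recursion
    carrying no proofs. *)
Lemma dependent_choice_seq (X : Type) (P : nat -> X -> Prop) (Q : nat -> X -> X -> Prop) (x0 : X) :
  P 0%nat x0 -> (forall n x, P n x -> exists y, P (S n) y /\ Q n x y) ->
  exists f : nat -> X, f 0%nat = x0 /\ forall n, P n (f n) /\ Q n (f n) (f (S n)).
Proof.
intros H0 Hs.
assert (Hs' : forall n x, exists y, P n x -> P (S n) y /\ Q n x y).
{ intros n x. destruct (classic (P n x)) as [H|H]; [destruct (Hs n x H) as [y Hy]; exists y; auto|].
  exists x; tauto. }
set (step := fun n x => proj1_sig (constructive_indefinite_description _ (Hs' n x))).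
assert (Hstep : forall n x, P n x -> P (S n) (step n x) /\ Q n x (step n x)).
{ intros n x. unfold step. destruct constructive_indefinite_description; auto. }
set (f := fix f n := match n with O => x0 | S m => step m (f m) end).
exists f. split; [reflexivity|].
assert (HP : forall n, P n (f n)) by (induction n; [exact H0|apply Hstep, IHn]).
intros n; split; [apply HP|apply Hstep, HP].
Qed.

Lemma rect_C21_sum X T (f : nat -> nat -> R -> R -> R) (N : nat) :
  (forall i, rect_C21 X T (f i 0%nat) (f i 1%nat) (f i 2%nat) (f i 3%nat)) ->
  rect_C21 X T (fun x t => sum_f_R0 (fun i => f i 0%nat x t) N) (fun x t => sum_f_R0 (fun i => f i 1%nat x t) N)
    (fun x t => sum_f_R0 (fun i => f i 2%nat x t) N) (fun x t => sum_f_R0 (fun i => f i 3%nat x t) N).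
Proof.
intros H. split; [|split].
- repeat split; apply cont2_sum; intros i; apply H.
- intros x t Hx Ht. split.
  + apply (is_derive_sum (fun i y => f i 0%nat y t)). intros i. apply H; auto.
  + apply (is_derive_sum (fun i y => f i 1%nat y t)). intros i. apply H; auto.
- intros x t Hx Ht. apply (is_derive_sum (fun i r => f i 0%nat x r)). intros i. apply H; auto.
Qed.

Lemma geometric_tail (K : R) (g : nat -> R) (n m : nat) : (forall i, Rabs (g i) <= K / 2 ^ i) -> (n <= m)%nat ->
  Rabs (sum_f_R0 g m - sum_f_R0 g n) <= K / 2 ^ n.
Proof.
intros Hg Hnm.
assert (HK : 0 <= K).
{ pose proof (Hg 0%nat) as H. simpl in H. pose proof (Rabs_pos (g 0%nat)). lra. }
(* The sharper bound, with K / 2^m subtracted, is the one that passes through the induction. *)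
assert (H : Rabs (sum_f_R0 g m - sum_f_R0 g n) <= K / 2 ^ n - K / 2 ^ m).
{ induction Hnm.
  - rewrite !Rminus_diag, Rabs_R0. lra.
  - simpl sum_f_R0. pose proof (Hg (S m)) as Hm. simpl pow in *.
    assert (0 < 2 ^ m) by (apply pow_lt; lra).
    replace (K / (2 * 2 ^ m)) with (K / 2 ^ m / 2) in * by (field; lra).
    replace (sum_f_R0 g m + g (S m) - sum_f_R0 g n) with ((sum_f_R0 g m - sum_f_R0 g n) + g (S m)) by ring.
    eapply Rle_trans; [apply Rabs_triang|]. lra. }
assert (0 <= K / 2 ^ m) by (apply Rdiv_le_0_compat; [exact HK|apply pow_lt; lra]). lra.
Qed.

Lemma geometric_small (K e : R) : 0 <= K -> 0 < e -> exists N, forall n, (N <= n)%nat -> K / 2 ^ n <= e.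
Proof.
intros HK He. destruct (pow_lt_1_zero (/ 2)) with (y := e / (K + 1)) as [N HN].
{ rewrite Rabs_pos_eq; lra. } { apply Rdiv_lt_0_compat; lra. }
exists N. intros n Hn. specialize (HN n Hn). rewrite Rabs_pos_eq in HN by (apply pow_le; lra).
rewrite pow_inv in HN. unfold Rdiv.
apply Rle_trans with ((K + 1) * (e / (K + 1))); [|apply Req_le; field; lra].
assert (0 < / 2 ^ n) by (apply Rinv_0_lt_compat, pow_lt; lra). apply Rmult_le_compat; lra.
Qed.

Lemma geometric_sum_cauchy X T K (g : nat -> R -> R -> R) : 0 <= K ->
  (forall i x t, in_rect X T x t -> Rabs (g i x t) <= K / 2 ^ i) ->
  ucauchy X T (fun n x t => sum_f_R0 (fun i => g i x t) n).
Proof.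
intros HK Hg e He. destruct (geometric_small K e HK He) as [N HN].
exists N. intros n m Hn Hm x t Hxt. destruct (Nat.le_ge_cases n m) as [H|H].
- rewrite Rabs_minus_sym. eapply Rle_trans; [apply (geometric_tail K (fun i => g i x t)); auto|]. apply HN, Hn.
- eapply Rle_trans; [apply (geometric_tail K (fun i => g i x t)); auto|]. apply HN, Hm.
Qed.

(** [C] is fixed before [theta], [rho] and the data functions: the fixed point argument needs one
    bound for all iterates. *)
Theorem heat_drift (T kappa L BR B0 : R) : 0 < T -> 0 < kappa -> 0 <= L -> 0 <= BR -> 0 <= B0 ->
  exists C, forall (theta theta1 rho : R -> R) (Rf Rf1 : R -> R -> R) (W0 W01 W02 : R -> R),
  time_change T kappa theta theta1 -> cont1 theta1 ->
  cont1 rho -> (forall t, 0 <= t <= T -> Rabs (rho t) <= L) ->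
  cont2 Rf -> cont2 Rf1 -> (forall y t, 0 < y < 1 -> 0 <= t <= T -> is_derive (fun z => Rf z t) y (Rf1 y t)) ->
  (forall t, 0 <= t <= T -> Rf 0 t = 0) -> (forall y t, in_rect 1 T y t -> Rabs (Rf1 y t) <= BR) ->
  profile W0 W01 W02 -> W02 0 = 0 -> (forall y, 0 <= y <= 1 -> Rabs (W02 y) <= B0) ->
  exists W W1 W2 Wt, rect_C21 1 T W W1 W2 Wt /\
    (forall y t, in_rect 1 T y t -> Wt y t = theta1 t * W2 y t + y * rho t * W1 y t + Rf y t) /\
    (forall t, 0 <= t <= T -> W 0 t = 0 /\ W1 1 t = 0) /\
    (forall y, 0 <= y <= 1 -> W y 0 = W0 y) /\
    (forall y t, in_rect 1 T y t -> Rabs (W2 y t) <= C).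
Proof.
intros HT Hk0 HL HBR HB0.
assert (Hsk : 0 < sqrt kappa) by (apply sqrt_lt_R0; lra).
(* With d = sd^2 and k = 1 / sd^2 the weighted estimate has the factor 3 sd / sqrt kappa, and [sd]
   is so small that the drift, which contributes 2 L, halves every correction. *)
set (sd := sqrt kappa / (16 * (L + 1))).
assert (Hsd : 0 < sd) by (apply Rdiv_lt_0_compat; lra).
set (k := / (sd * sd)). assert (Hk : 0 < k) by (apply Rinv_0_lt_compat; nra).
assert (Hdd : 0 < sd * sd) by nra.
assert (Hfac : 2 * sqrt (sd * sd) + / (k * sqrt (sd * sd)) = 3 * sd).
{ rewrite sqrt_square by lra. unfold k. field. lra. }
assert (Hhalf : 2 * L * (3 * sd) / sqrt kappa <= / 2).
{ unfold sd. replace (2 * L * (3 * (sqrt kappa / (16 * (L + 1)))) / sqrt kappa) with (6 * L / (16 * (L + 1))) by (field; lra).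
  apply Rmult_le_reg_r with (16 * (L + 1)); [lra|]. unfold Rdiv. rewrite Rmult_assoc, Rinv_l; lra. }
set (A := B0 + BR * (3 * sd) / sqrt kappa).
assert (HA : 0 <= A).
{ unfold A. assert (0 <= BR * (3 * sd) / sqrt kappa) by (apply Rdiv_le_0_compat; nra). lra. }
exists (2 * A * exp (k * T)).
intros theta theta1 rho Rf Rf1 W0 W01 W02 Hth Hth1 Hrho HrhoL HRf HRf1 HdR HR0 HRB Hp E2 HWB.
assert (Hexp1 : forall t, 0 <= t -> 1 <= exp (k * t)).
{ intros t Ht. rewrite <- exp_0. destruct (Req_dec t 0) as [->|]; [rewrite Rmult_0_r; lra|].
  apply Rlt_le, exp_increasing. nra. }
assert (HexpT : forall t, 0 <= t <= T -> exp (k * t) <= exp (k * T)).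
{ intros t Ht. destruct (Req_dec t T) as [->|]; [lra|]. apply Rlt_le, exp_increasing. nra. }
(* Neumann series: each correction solves the heat equation forced by the drift of the previous one. *)
set (P := fun (n : nat) (V : nat -> R -> R -> R) =>
  rect_C21 1 T (V 0%nat) (V 1%nat) (V 2%nat) (V 3%nat) /\
  (forall t, 0 <= t <= T -> V 0%nat 0 t = 0 /\ V 1%nat 1 t = 0) /\
  (forall y t, in_rect 1 T y t -> Rabs (V 2%nat y t) <= A / 2 ^ n * exp (k * t))).
set (Q := fun (n : nat) (V V' : nat -> R -> R -> R) =>
  (forall y t, in_rect 1 T y t -> V' 3%nat y t = theta1 t * V' 2%nat y t + y * rho t * V 1%nat y t) /\
  (forall y, 0 <= y <= 1 -> V' 0%nat y 0 = 0)).
assert (Hlow : forall n V, P n V -> forall y t, in_rect 1 T y t ->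
  Rabs (V 1%nat y t) <= A / 2 ^ n * exp (k * t) /\ Rabs (V 0%nat y t) <= A / 2 ^ n * exp (k * t)).
{ intros n V (HV & Hb & HV2) y t [Hy Ht]. destruct HV as ((c0 & c1 & _) & HVx & _).
  apply (second_derivative_bound (fun y => V 0%nat y t) (fun y => V 1%nat y t) (fun y => V 2%nat y t)); auto.
  - cont.
  - cont.
  - apply Hb, Ht.
  - apply Hb, Ht.
  - intros x Hx. apply HV2. split; auto. }
destruct (heat_forced T kappa theta theta1 Rf Rf1 W0 W01 W02) as (V & V1 & V2 & Vt & HV & HVe & HVb & HVi & HVB); auto.
set (X0 := fun c : nat => match c with 0%nat => V | 1%nat => V1 | 2%nat => V2 | _ => Vt end).
assert (HP0 : P 0%nat X0).
{ split; [exact HV|]. split; [exact HVb|]. intros y t Hyt.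
  eapply Rle_trans; [apply (HVB BR B0 k (sd * sd)); auto|].
  - intros x r Hxr. eapply Rle_trans; [apply HRB, Hxr|]. destruct Hxr as [_ Hr].
    pose proof (Hexp1 r ltac:(lra)). nra.
  - rewrite Hfac. unfold A. simpl pow. destruct Hyt as [_ Ht]. pose proof (Hexp1 t ltac:(lra)) as He.
    replace ((B0 + BR * (3 * sd) / sqrt kappa) / 1 * exp (k * t))
      with (B0 * exp (k * t) + BR * exp (k * t) * (3 * sd) / sqrt kappa) by (field; lra). nra. }
assert (Hstep : forall n V, P n V -> exists V', P (S n) V' /\ Q n V V').
{ intros n X HX. pose proof (Hlow n X HX) as HX1. destruct HX as (HX & Hb & HX2).
  assert (Hrec := HX). destruct Hrec as ((c0 & c1 & c2 & c3) & HXx & HXt).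
  (* The factor [y] makes the forcing vanish at 0, as the sine sums require; its derivative contains
     [X] up to second order, which the induction controls. *)
  destruct (heat_forced T kappa theta theta1 (fun y t => y * rho t * X 1%nat y t)
    (fun y t => rho t * (X 1%nat y t + y * X 2%nat y t)) (fun _ => 0) (fun _ => 0) (fun _ => 0))
    as (Y & Y1 & Y2 & Yt & HY & HYe & HYb & HYi & HYB); auto; try (cont; fail).
  - intros y t Hy Ht. destruct (HXx y t Hy Ht) as [_ D]. der. ring.
  - intros t _. ring.
  - apply profile_zero.
  - exists (fun c : nat => match c with 0%nat => Y | 1%nat => Y1 | 2%nat => Y2 | _ => Yt end). split; [|split].
    + split; [exact HY|]. split; [exact HYb|]. intros y t Hyt.
      assert (HAn : 0 <= A / 2 ^ n) by (apply Rdiv_le_0_compat; [exact HA|apply pow_lt; lra]).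
      assert (H2n : 0 < 2 ^ n) by (apply pow_lt; lra).
      eapply Rle_trans; [apply (HYB (2 * L * (A / 2 ^ n)) 0 k (sd * sd)); auto|].
      * nra.
      * intros x r Hxr. destruct (HX1 x r Hxr) as [B1 _]. pose proof (HX2 x r Hxr) as B2.
        assert (B3 : Rabs (X 1%nat x r + x * X 2%nat x r) <= 2 * (A / 2 ^ n * exp (k * r))).
        { eapply Rle_trans; [apply Rabs_triang|]. rewrite Rabs_mult. destruct Hxr as [Hx _].
          rewrite (Rabs_pos_eq x) by lra. pose proof (Rabs_pos (X 2%nat x r)). nra. }
        rewrite Rabs_mult. pose proof (HrhoL r (proj2 Hxr)). pose proof (Rabs_pos (rho r)).
        pose proof (Rabs_pos (X 1%nat x r + x * X 2%nat x r)).
        replace (2 * L * (A / 2 ^ n) * exp (k * r)) with (L * (2 * (A / 2 ^ n * exp (k * r)))) by ring.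
        apply Rmult_le_compat; auto.
      * intros x _. rewrite Rabs_R0. lra.
      * rewrite Hfac, Rplus_0_l. simpl pow. pose proof (exp_pos (k * t)).
        replace (2 * L * (A / 2 ^ n) * exp (k * t) * (3 * sd) / sqrt kappa)
          with (2 * L * (3 * sd) / sqrt kappa * (A / 2 ^ n * exp (k * t))) by (field; lra).
        replace (A / (2 * 2 ^ n) * exp (k * t)) with (/ 2 * (A / 2 ^ n * exp (k * t))) by (field; lra).
        apply Rmult_le_compat_r; [nra|exact Hhalf].
    + exact HYe.
    + exact HYi. }
destruct (dependent_choice_seq _ P Q X0 HP0 Hstep) as (f & Hf0 & Hf).
assert (HfP : forall n, P n (f n)) by (intros; apply Hf).
assert (HfQ : forall n, Q n (f n) (f (S n))) by (intros; apply Hf).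
set (A' := A * exp (k * T)).
assert (HA' : 0 <= A') by (pose proof (exp_pos (k * T)); unfold A'; nra).
assert (Hf2 : forall i y t, in_rect 1 T y t -> Rabs (f i 0%nat y t) <= A' / 2 ^ i /\
  Rabs (f i 1%nat y t) <= A' / 2 ^ i /\ Rabs (f i 2%nat y t) <= A' / 2 ^ i).
{ intros i y t Hyt. destruct (Hlow i (f i) (HfP i) y t Hyt) as [K1 K0].
  destruct (HfP i) as (_ & _ & K2). specialize (K2 y t Hyt). specialize (HexpT t (proj2 Hyt)).
  assert (0 < 2 ^ i) by (apply pow_lt; lra).
  assert (A / 2 ^ i * exp (k * t) <= A' / 2 ^ i).
  { unfold A'. replace (A * exp (k * T) / 2 ^ i) with (A / 2 ^ i * exp (k * T)) by (field; lra).
    apply Rmult_le_compat_l; [apply Rdiv_le_0_compat; lra|exact HexpT]. }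
  repeat split; lra. }
destruct (bounded1 theta1 0 T Hth1) as (B & HB & HBb); [lra|].
destruct (bounded2 Rf 0 1 0 T HRf) as (M & HM & HMb); try lra.
assert (Hf3 : forall i y t, in_rect 1 T y t -> Rabs (f i 3%nat y t) <= (B * A' + M + 2 * L * A') / 2 ^ i).
{ intros i y t Hyt. destruct (Hf2 i y t Hyt) as (_ & _ & K2).
  assert (Hi : 0 < 2 ^ i) by (apply pow_lt; lra).
  assert (Kth : Rabs (theta1 t * f i 2%nat y t) <= B * A' / 2 ^ i).
  { rewrite Rabs_mult. unfold Rdiv. rewrite Rmult_assoc. apply Rmult_le_compat; try apply Rabs_pos; [apply HBb, Hyt|exact K2]. }
  destruct i.
  - rewrite Hf0 in *. simpl in Kth |- *. rewrite (HVe y t Hyt). eapply Rle_trans; [apply Rabs_triang|].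
    pose proof (HMb y t (proj1 Hyt) (proj2 Hyt)). assert (0 <= L * A') by nra. lra.
  - destruct (HfQ i) as [Ke _]. rewrite (Ke y t Hyt). eapply Rle_trans; [apply Rabs_triang|].
    destruct (Hf2 i y t Hyt) as (_ & K1 & _).
    assert (Ky : Rabs (y * rho t * f i 1%nat y t) <= L * (A' / 2 ^ i)).
    { rewrite Rabs_mult. apply Rmult_le_compat; try apply Rabs_pos; [|exact K1].
      rewrite Rabs_mult, (Rabs_pos_eq y) by apply Hyt. pose proof (HrhoL t (proj2 Hyt)).
      destruct Hyt as [Hy _]. nra. }
    simpl pow in *.
    assert (0 <= M / (2 * 2 ^ i)) by (apply Rdiv_le_0_compat; lra).
    replace ((B * A' + M + 2 * L * A') / (2 * 2 ^ i)) with (B * A' / (2 * 2 ^ i) + M / (2 * 2 ^ i) + L * (A' / 2 ^ i)) by (field; lra).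
    lra. }
assert (Hrect : forall n, rect_C21 1 T (fun x t => sum_f_R0 (fun i => f i 0%nat x t) n)
   (fun x t => sum_f_R0 (fun i => f i 1%nat x t) n) (fun x t => sum_f_R0 (fun i => f i 2%nat x t) n)
   (fun x t => sum_f_R0 (fun i => f i 3%nat x t) n)).
{ intros n. apply rect_C21_sum. intros i. apply HfP. }
destruct (rect_C21_limit 1 T _ _ _ _ ltac:(lra) HT Hrect) as (W & W1 & W2 & Wt & HW & LW & LW1 & LW2 & LWt).
{ apply (geometric_sum_cauchy 1 T A'); auto. intros; apply Hf2; auto. }
{ apply (geometric_sum_cauchy 1 T A'); auto. intros; apply Hf2; auto. }
{ apply (geometric_sum_cauchy 1 T A'); auto. intros; apply Hf2; auto. }
{ apply (geometric_sum_cauchy 1 T (B * A' + M + 2 * L * A')); auto. nra. }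
exists W, W1, W2, Wt. split; [exact HW|]. split; [|split; [|split]].
- intros y t Hyt.
  pose proof (ulimit_cv 1 T _ W1 y t LW1 Hyt) as c1. pose proof (ulimit_cv 1 T _ W2 y t LW2 Hyt) as c2.
  pose proof (ulimit_cv 1 T _ Wt y t LWt Hyt) as ct.
  apply is_lim_seq_Reals in c1, c2, ct.
  apply is_lim_seq_incr_1 in c2, ct.
  (* The partial sums satisfy the equation with a drift that lags by one index; the lag disappears
     in the limit. *)
  assert (E : forall n, sum_f_R0 (fun i => f i 3%nat y t) (S n) = theta1 t * sum_f_R0 (fun i => f i 2%nat y t) (S n)
    + y * rho t * sum_f_R0 (fun i => f i 1%nat y t) n + Rf y t).
  { intros n. destruct (HfQ 0%nat) as [Q0 _]. induction n.
    - simpl. rewrite (Q0 y t Hyt), Hf0. simpl. rewrite (HVe y t Hyt). ring.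
    - destruct (HfQ (S n)) as [Qn _].
      change (sum_f_R0 (fun i => f i 3%nat y t) (S (S n))) with (sum_f_R0 (fun i => f i 3%nat y t) (S n) + f (S (S n)) 3%nat y t).
      rewrite IHn, (Qn y t Hyt). simpl. ring. }
  apply Rbar_finite_eq. rewrite <- (is_lim_seq_unique _ _ ct). symmetry. symmetry.
  apply is_lim_seq_unique.
  apply (is_lim_seq_ext (fun n => theta1 t * sum_f_R0 (fun i => f i 2%nat y t) (S n)
    + y * rho t * sum_f_R0 (fun i => f i 1%nat y t) n + Rf y t)); [intros; symmetry; apply E|].
  apply is_lim_seq_plus'; [apply is_lim_seq_plus'|apply is_lim_seq_const].
  + apply (is_lim_seq_scal_l _ (theta1 t) (W2 y t)), c2.
  + apply (is_lim_seq_scal_l _ (y * rho t) (W1 y t)), c1.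
- intros t Ht.
  assert (I0 : in_rect 1 T 0 t) by (split; lra). assert (I1 : in_rect 1 T 1 t) by (split; lra).
  split; eapply UL_sequence.
  + apply (ulimit_cv 1 T _ W 0 t LW I0).
  + intros e He. exists 0%nat. intros n _. rewrite sum_zero by (intros i; apply (HfP i); auto).
    unfold Rdist. rewrite Rminus_diag, Rabs_R0. lra.
  + apply (ulimit_cv 1 T _ W1 1 t LW1 I1).
  + intros e He. exists 0%nat. intros n _. rewrite sum_zero by (intros i; apply (HfP i); auto).
    unfold Rdist. rewrite Rminus_diag, Rabs_R0. lra.
- intros y Hy. assert (I0 : in_rect 1 T y 0) by (split; lra).
  eapply UL_sequence; [apply (ulimit_cv 1 T _ W y 0 LW I0)|].
  intros e He. exists 0%nat. intros n _.
  rewrite (sum_extend _ 0 n) by first [lia | intros j Hj; destruct j; [lia|apply (HfQ j); auto]].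
  simpl. rewrite Hf0. simpl. rewrite HVi by exact Hy. unfold Rdist. rewrite Rminus_diag, Rabs_R0. lra.
- intros y t Hyt.
  apply (ulimit_bound 1 T _ W2 (fun _ _ => 2 * A * exp (k * T)) LW2); auto.
  intros n x r Hxr. pose proof (geometric_tail A' (fun i => f i 2%nat x r) 0 n) as G.
  simpl in G. specialize (G ltac:(intros i; apply Hf2; auto) ltac:(lia)).
  destruct (Hf2 0%nat x r Hxr) as (_ & _ & K). simpl in K. fold A' . unfold A' in *.
  apply Rabs_le_between in G, K. apply Rabs_le. lra.
Qed.

(** * The linear problem for a prescribed boundary motion *)

Definition radius (b : R) (rho : R -> R) (t : R) : R := b * exp (RInt rho 0 t).

Lemma radius_pos b rho t : 0 < b -> 0 < radius b rho t.
Proof. intros Hb. apply Rmult_lt_0_compat; [exact Hb|apply exp_pos]. Qed.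

Lemma radius_derive b rho t : cont1 rho -> is_derive (radius b rho) t (rho t * radius b rho t).
Proof.
intros Hr. unfold radius. pose proof (is_derive_RInt_cont1 rho 0 t Hr). der. ring.
Qed.

Lemma cont1_radius b rho : cont1 rho -> cont1 (radius b rho).
Proof. intros Hr. apply (cont1_derive _ (fun t => rho t * radius b rho t)). intros; apply radius_derive, Hr. Qed.

Lemma radius_0 b rho : radius b rho 0 = b.
Proof. unfold radius. rewrite RInt_point_R. rewrite exp_0. ring. Qed.

Lemma radius_bounds b rho L T t : 0 < b -> cont1 rho -> (forall t, 0 <= t <= T -> Rabs (rho t) <= L) ->
  0 <= t <= T -> b * exp (- (L * T)) <= radius b rho t <= b * exp (L * T).
Proof.
intros Hb Hr HL Ht.
assert (HL0 : 0 <= L) by (eapply Rle_trans; [apply Rabs_pos|apply (HL t Ht)]).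
pose proof (abs_RInt_le rho 0 t L ltac:(lra) Hr ltac:(intros; apply HL; lra)) as H.
apply Rabs_le_between in H.
assert (L * (t - 0) <= L * T) by (apply Rmult_le_compat_l; lra).
split; apply Rmult_le_compat_l; try lra; apply exp_le; lra.
Qed.

Definition linear_solution (T b : R) (F p rho : R -> R) (w w1 w2 wt : R -> R -> R) : Prop :=
  rect_C21 1 T w w1 w2 wt /\
  (forall y t, 0 < y < 1 -> 0 < t < T ->
     wt y t = w2 y t / radius b rho t ^ 2 + y * rho t * w1 y t) /\
  (forall t, 0 <= t <= T -> w 0 t = F t /\ w1 1 t = 0) /\
  (forall y, 0 <= y <= 1 -> w y 0 = p (b * y)).

Lemma abs_add_le (x y A B : R) : Rabs x <= A -> Rabs y <= B -> Rabs (x + y) <= A + B.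
Proof. intros; eapply Rle_trans; [apply Rabs_triang|]; lra. Qed.
Lemma abs_mul_le (x y A B : R) : Rabs x <= A -> Rabs y <= B -> Rabs (x * y) <= A * B.
Proof. intros; rewrite Rabs_mult; apply Rmult_le_compat; auto; apply Rabs_pos. Qed.

(* The lowest-degree polynomial equal to [1 + O(y^3)] at [0] and [O((1 - y)^2)] at [1]. *)
Definition cut (y : R) : R := 1 - 4 * y ^ 3 + 3 * y ^ 4.
Definition cut1 (y : R) : R := - 12 * y ^ 2 + 12 * y ^ 3.
Definition cut2 (y : R) : R := - 24 * y + 36 * y ^ 2.
Definition cut3 (y : R) : R := - 24 + 72 * y.

Lemma cut_derive y : is_derive cut y (cut1 y) /\ is_derive cut1 y (cut2 y) /\ is_derive cut2 y (cut3 y).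
Proof. unfold cut, cut1, cut2, cut3. split; [|split]; der; ring. Qed.

Lemma cut_bounds y : 0 <= y <= 1 ->
  Rabs (cut y) <= 8 /\ Rabs (cut1 y) <= 24 /\ Rabs (cut2 y) <= 60 /\ Rabs (cut3 y) <= 96.
Proof.
intros Hy. assert (0 <= y ^ 2 <= 1) by nra. assert (0 <= y ^ 3 <= 1) by nra. assert (0 <= y ^ 4 <= 1) by nra.
unfold cut, cut1, cut2, cut3. repeat split; apply Rabs_le; lra.
Qed.

Lemma cut_cont : cont1 cut /\ cont1 cut1 /\ cont1 cut2 /\ cont1 cut3.
Proof. unfold cut, cut1, cut2, cut3. repeat split; cont. Qed.

(** The solution is [cut y * U (s t * y) t + W y t]: [U] lifts the boundary value at 0, the cut-off
    restores the Neumann condition at 1, and [W] solves a drift problem with zero boundary values.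
    [C] can precede [rho] because one [U] serves every [rho]. *)
Theorem linear_solution_exists (T b L : R) (F F1 p p1 p2 : R -> R) : 0 < T -> 0 < b -> 0 <= L ->
  (forall t, is_derive F t (F1 t)) -> cont1 F1 ->
  (forall x, is_derive p x (p1 x)) -> (forall x, is_derive p1 x (p2 x)) -> cont1 p2 ->
  F 0 = p 0 -> F1 0 = p2 0 -> p1 b = 0 ->
  exists C, forall rho, cont1 rho -> (forall t, 0 <= t <= T -> Rabs (rho t) <= L) ->
    exists w w1 w2 wt, linear_solution T b F p rho w w1 w2 wt /\
      forall y t, in_rect 1 T y t -> Rabs (w1 y t) <= C /\ Rabs (w2 y t) <= C.
Proof.
intros HT Hb HL HF HF1 Hp Hp1 Hp2 EF0 EF1 Epb.
set (Ms := b * exp (L * T)). set (ms := b * exp (- (L * T))).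
assert (HMs : 0 < Ms) by (apply Rmult_lt_0_compat; [lra|apply exp_pos]).
assert (Hms : 0 < ms) by (apply Rmult_lt_0_compat; [lra|apply exp_pos]).
(* One rectangle contains the moving domains of all [rho] bounded by [L] on [0, T]. *)
set (X := Ms + 1).
destruct (heat_lift T X F F1) as (U & U1 & U2 & HU & HU0); auto; [unfold X; lra|].
destruct HU as ((cU & cU1 & cU2 & _) & HUx & HUt).
destruct (bounded2 U 0 X 0 T cU) as (BU0 & HBU0 & BU0b); try (unfold X; lra).
destruct (bounded2 U1 0 X 0 T cU1) as (BU1 & HBU1 & BU1b); try (unfold X; lra).
destruct (bounded2 U2 0 X 0 T cU2) as (BU2 & HBU2 & BU2b); try (unfold X; lra).
pose proof (cont1_derive p p1 Hp) as cp. pose proof (cont1_derive p1 p2 Hp1) as cp1.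
destruct cut_cont as (k0 & k1 & k2 & k3).
set (W0 := fun y => p (b * y) - cut y * U (b * y) 0).
set (W01 := fun y => b * p1 (b * y) - (cut1 y * U (b * y) 0 + cut y * (b * U1 (b * y) 0))).
set (W02 := fun y => b * (b * p2 (b * y)) - (cut2 y * U (b * y) 0 + 2 * (cut1 y * (b * U1 (b * y) 0))
   + cut y * (b * (b * U2 (b * y) 0)))).
assert (cW0 : cont1 W0) by (unfold W0; cont). assert (cW01 : cont1 W01) by (unfold W01; cont).
assert (cW02 : cont1 W02) by (unfold W02; cont).
destruct (bounded1 W02 0 1 cW02) as (B0 & HB0 & B0b); [lra|].
assert (HbM : b <= Ms).
{ unfold Ms. rewrite <- (Rmult_1_r b) at 1. apply Rmult_le_compat_l; [lra|]. rewrite <- exp_0. apply exp_le. nra. }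
assert (DW0 : forall y, 0 < y < 1 -> is_derive W0 y (W01 y) /\ is_derive W01 y (W02 y)).
{ intros y Hy. destruct (cut_derive y) as (D0 & D1 & D2).
  assert (Hby : 0 < b * y < X) by (unfold X; nra).
  destruct (HUx (b * y) 0 Hby ltac:(lra)) as [DU DU1].
  assert (Dl : is_derive (fun y => b * y) y b) by (der; ring).
  pose proof (derive_comp (fun z => U z 0) (fun y => b * y) y b _ DU Dl) as E0.
  pose proof (derive_comp (fun z => U1 z 0) (fun y => b * y) y b _ DU1 Dl) as E1.
  split; [unfold W0, W01|unfold W01, W02]; der; ring. }
set (q := / ms). assert (Hq : 0 < q) by (apply Rinv_0_lt_compat, Hms).
(* The summands follow those of [Rf1] below, so that the bound can be read off term by term. *)
set (BR := 96 * BU0 * (q * q) + 3 * (60 * BU1 * q) + 2 * (24 * BU2)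
           + L * (24 * BU0 + 1 * (60 * BU0) + 1 * (24 * (Ms * BU1)))).
destruct (heat_drift T (/ Ms ^ 2) L BR B0) as [C HC]; auto; try lra.
{ apply Rinv_0_lt_compat, pow_lt, HMs. }
{ unfold BR.
  assert (0 < Ms * BU1) by nra.
  nra. }
exists (60 * BU0 + 2 * (24 * (Ms * BU1)) + 8 * (Ms * (Ms * BU2)) + C).
intros rho Hrho HrhoL.
set (s := radius b rho).
pose proof (cont1_radius b rho Hrho) as cs. fold s in cs.
assert (Hsp : forall t, s t <> 0) by (intros t; pose proof (radius_pos b rho t Hb); unfold s; lra).
assert (Hsp' : forall t, 0 < s t) by (intros t; apply radius_pos, Hb).
assert (Hsb : forall t, 0 <= t <= T -> ms <= s t <= Ms) by (intros; apply (radius_bounds b rho L T); auto).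
assert (Ds : forall t, is_derive s t (rho t * s t)) by (intros; apply radius_derive, Hrho).
assert (cth : cont1 (fun t => / s t ^ 2)) by (cont; intros; apply pow_nonzero, Hsp).
(* The error of the lift in the transformed equation. Since [U] solves the heat equation, every term
   contains a derivative of [cut], and these vanish at y = 0 up to second order. *)
set (Rf := fun y t => cut2 y * U (s t * y) t * (/ s t * / s t) + 2 * (cut1 y * U1 (s t * y) t * / s t)
   + rho t * (y * (cut1 y * U (s t * y) t))).
set (Rf1 := fun y t => cut3 y * U (s t * y) t * (/ s t * / s t) + 3 * (cut2 y * U1 (s t * y) t * / s t)
   + 2 * (cut1 y * U2 (s t * y) t)
   + rho t * (cut1 y * U (s t * y) t + y * (cut2 y * U (s t * y) t) + y * (cut1 y * (s t * U1 (s t * y) t)))).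
assert (Hin : forall y t, 0 < y < 1 -> 0 <= t <= T -> 0 < s t * y < X).
{ intros y t Hy Ht. destruct (Hsb t Ht). unfold X. split; [apply Rmult_lt_0_compat; lra|nra]. }
assert (DUx : forall y t, 0 < y < 1 -> 0 <= t <= T ->
  is_derive (fun y => U (s t * y) t) y (s t * U1 (s t * y) t) /\
  is_derive (fun y => U1 (s t * y) t) y (s t * U2 (s t * y) t)).
{ intros y t Hy Ht. destruct (HUx (s t * y) t (Hin y t Hy Ht) Ht) as [DU DU1].
  assert (Dl : is_derive (fun y => s t * y) y (s t)) by (der; ring).
  split; [exact (derive_comp (fun z => U z t) _ y _ _ DU Dl)|exact (derive_comp (fun z => U1 z t) _ y _ _ DU1 Dl)]. }
assert (HUb : forall y t, in_rect 1 T y t -> Rabs (U (s t * y) t) <= BU0 /\ Rabs (U1 (s t * y) t) <= BU1 /\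
  Rabs (U2 (s t * y) t) <= BU2 /\ Rabs (/ s t) <= q /\ Rabs (s t) <= Ms /\ Rabs y <= 1).
{ intros y t [Hy Ht]. destruct (Hsb t Ht) as [A1 A2].
  assert (0 <= s t * y <= X) by (unfold X; split; [apply Rmult_le_pos; lra|nra]).
  repeat split; auto.
  - rewrite Rabs_pos_eq by (apply Rlt_le, Rinv_0_lt_compat; lra). unfold q. apply Rinv_le_contravar; lra.
  - rewrite Rabs_pos_eq; lra.
  - apply Rabs_le; lra. }
destruct (HC (fun t => RInt (fun r => / s r ^ 2) 0 t) (fun t => / s t ^ 2) rho Rf Rf1 W0 W01 W02)
  as (W & W1 & W2 & Wt & HW & HWe & HWb & HWi & HWB); auto.
{ split; [apply Rinv_0_lt_compat, pow_lt, HMs|]. split; [apply RInt_point_R|]. split.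
  - intros t. apply (is_derive_RInt_cont1 (fun r => / s r ^ 2)), cth.
  - intros t Ht. apply Rinv_le_contravar; [apply pow_lt, Hsp'|]. apply pow_incr. destruct (Hsb t Ht). lra. }
{ unfold Rf. cont; auto. }
{ unfold Rf1. cont; auto. }
{ intros y t Hy Ht. destruct (DUx y t Hy Ht) as [E0 E1]. destruct (cut_derive y) as (D0 & D1 & D2).
  unfold Rf, Rf1. der. specialize (Hsp t). field. exact Hsp. }
{ intros t Ht. unfold Rf, cut1, cut2. ring. }
{ intros y t Hyt. destruct (HUb y t Hyt) as (A0 & A1 & A2 & A3 & A4 & A5).
  destruct (cut_bounds y (proj1 Hyt)) as (_ & C1 & C2 & C3). pose proof (HrhoL t (proj2 Hyt)) as Hr.
  assert (N2 : Rabs 2 <= 2) by (rewrite Rabs_pos_eq; lra). assert (N3 : Rabs 3 <= 3) by (rewrite Rabs_pos_eq; lra).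
  unfold Rf1, BR. repeat first [assumption | apply abs_add_le | apply abs_mul_le]. }
{ do 4 (split; [assumption|]). split.
  - unfold W0. rewrite Rmult_0_r. destruct (HU0 0 ltac:(lra)) as [-> _]. unfold cut. rewrite EF0. ring.
  - unfold W01, cut1, cut. rewrite Rmult_1_r, Epb. ring. }
(* The compatibility condition on the derivatives is spent here: the second derivative of the
   initial profile vanishes at 0. *)
{ unfold W02. rewrite Rmult_0_r. destruct (HU0 0 ltac:(lra)) as [_ ->]. unfold cut, cut1, cut2. rewrite EF1. ring. }
exists (fun y t => cut y * U (s t * y) t + W y t),
  (fun y t => cut1 y * U (s t * y) t + cut y * (s t * U1 (s t * y) t) + W1 y t),
  (fun y t => cut2 y * U (s t * y) t + 2 * (cut1 y * (s t * U1 (s t * y) t)) + cut y * (s t * (s t * U2 (s t * y) t)) + W2 y t),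
  (fun y t => cut y * (U1 (s t * y) t * (rho t * s t * y) + U2 (s t * y) t) + Wt y t).
destruct HW as ((cW & cW1 & cW2 & cWt) & HWx & HWt).
assert (Hlin : linear_solution T b F p rho (fun y t => cut y * U (s t * y) t + W y t)
  (fun y t => cut1 y * U (s t * y) t + cut y * (s t * U1 (s t * y) t) + W1 y t)
  (fun y t => cut2 y * U (s t * y) t + 2 * (cut1 y * (s t * U1 (s t * y) t)) + cut y * (s t * (s t * U2 (s t * y) t)) + W2 y t)
  (fun y t => cut y * (U1 (s t * y) t * (rho t * s t * y) + U2 (s t * y) t) + Wt y t)).
{ split; [|split; [|split]].
  - split; [repeat split; cont|]. split.
    + intros y t Hy Ht. destruct (DUx y t Hy Ht) as [E0 E1]. destruct (cut_derive y) as (D0 & D1 & D2).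
      destruct (HWx y t Hy Ht) as [F0 F1']. split; der; ring.
    + intros y t Hy Ht. specialize (HWt y t Hy Ht).
      assert (E : is_derive (fun r => U (s r * y) r) t (U1 (s t * y) t * (rho t * s t * y) + U2 (s t * y) t)).
      { specialize (Ds t). pose proof (Hin y t Hy ltac:(lra)) as HinX.
        apply (is_derive_chain2 U U1 (fun r => s r * y)); auto.
        - der. ring.
        - set (d := Rmin (Rmin (s t * y) (X - s t * y)) (Rmin t (T - t))).
          exists d. split; [repeat apply Rmin_pos; lra|].
          intros x r Hx Hr.
          assert (d <= s t * y /\ d <= X - s t * y /\ d <= t /\ d <= T - t).
          { unfold d, Rmin. repeat destruct Rle_dec; repeat split; lra. }
          apply Rabs_def2 in Hx. apply Rabs_def2 in Hr. apply HUx; lra. }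
      der. ring.
  - intros y t Hy Ht. rewrite HWe by (split; lra). unfold Rf. change (radius b rho t) with (s t).
    specialize (Hsp t). field. exact Hsp.
  - intros t Ht. destruct (HWb t Ht) as [-> ->]. rewrite Rmult_0_r. destruct (HU0 t Ht) as [-> _].
    unfold cut, cut1. split; ring.
  - intros y Hy. rewrite HWi by exact Hy. unfold W0. change (s 0) with (radius b rho 0). rewrite radius_0. ring. }
split; [exact Hlin|].
assert (H2 : forall y t, in_rect 1 T y t -> Rabs (cut2 y * U (s t * y) t + 2 * (cut1 y * (s t * U1 (s t * y) t))
  + cut y * (s t * (s t * U2 (s t * y) t)) + W2 y t) <= 60 * BU0 + 2 * (24 * (Ms * BU1)) + 8 * (Ms * (Ms * BU2)) + C).
{ intros y t Hyt. destruct (HUb y t Hyt) as (A0 & A1 & A2 & A3 & A4 & A5).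
  destruct (cut_bounds y (proj1 Hyt)) as (C0 & C1 & C2 & C3). specialize (HWB y t Hyt).
  assert (N2 : Rabs 2 <= 2) by (rewrite Rabs_pos_eq; lra).
  repeat first [assumption | apply abs_add_le | apply abs_mul_le]. }
intros y t Hyt. split; [|apply H2, Hyt]. destruct Hlin as ((c & Hx & _) & _ & Hbd & _). destruct c as (c0 & c1 & c2 & _).
destruct Hyt as [Hy Ht].
pose (w1 := fun y t => cut1 y * U (s t * y) t + cut y * (s t * U1 (s t * y) t) + W1 y t).
change (Rabs (w1 y t) <= 60 * BU0 + 2 * (24 * (Ms * BU1)) + 8 * (Ms * (Ms * BU2)) + C).
replace (w1 y t) with (w1 y t - w1 1 t) by (rewrite (proj2 (Hbd t Ht) : w1 1 t = 0); ring).
change (cont2 w1) in c1.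
eapply Rle_trans; [apply (lipschitz_open (fun y => w1 y t) (fun y => cut2 y * U (s t * y) t + 2 * (cut1 y * (s t * U1 (s t * y) t))
  + cut y * (s t * (s t * U2 (s t * y) t)) + W2 y t) 0 1 (60 * BU0 + 2 * (24 * (Ms * BU1)) + 8 * (Ms * (Ms * BU2)) + C)); try lra; [cont| |]|].
- intros z Hz. apply (Hx z t Hz Ht).
- intros z Hz. apply H2. split; lra.
- rewrite <- (Rmult_1_r (60 * BU0 + _ + _ + C)) at 2. apply Rmult_le_compat_l.
  + eapply Rle_trans; [apply Rabs_pos|apply (H2 0 t); split; lra].
  + apply Rabs_le; lra.
Qed.

(** * The fixed point for the free boundary *)

Lemma max_principle_rect (T Cc : R) (D D1 D2 Dt a c : R -> R -> R) (mu m : R -> R) :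
  0 < T -> 0 <= Cc -> rect_C21 1 T D D1 D2 Dt -> cont1 mu ->
  (forall y t, 0 < y < 1 -> 0 < t < T -> 0 <= a y t /\ Rabs (c y t) <= Cc /\
     Dt y t <= a y t * D2 y t + c y t * D1 y t + m t) ->
  (forall t, 0 <= t <= T -> D1 1 t = 0) ->
  (forall t, 0 < t < T -> is_derive mu t (m t)) -> (forall t, 0 <= t <= T -> 0 <= mu t) ->
  (forall t, 0 <= t <= T -> D 0 t <= mu t) -> (forall y, 0 <= y <= 1 -> D y 0 <= mu 0) ->
  forall y t, in_rect 1 T y t -> D y t <= mu t.
Proof.
intros HT HC ((c0 & c1 & _) & HDx & HDt) Hmu Hpde Hn Hdmu Hmup Hd0 Hi y t [Hy Ht].
apply (max_principle_moving T Cc (fun _ => 1) D D1 D2 Dt a c mu m); auto; try lra.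
- cont.
- intros; lra.
- pose proof (cont1_clamp 0 T). pose proof (cont1_clamp 0 1). cont.
- intros x r Hr Hx. destruct (HDx x r Hx ltac:(lra)). auto.
- intros x r Hr Hx. destruct (Hpde x r Hx Hr) as (A1 & A2 & A3). auto.
- intros r e Hr He. assert (Hc : cont1 (fun x => D1 x r)) by cont.
  destruct (cont1_eps _ 1 e Hc He) as (d & Hd & H). exists d; split; [exact Hd|].
  intros x _ Hx. specialize (H x). rewrite Hn, Rminus_0_r in H by lra.
  specialize (H ltac:(apply Rabs_def1; lra)). apply Rabs_def2 in H. lra.
Qed.

Lemma rect_C21_scal_minus X T v v1 v2 vt w w1 w2 wt (sg : R) :
  rect_C21 X T v v1 v2 vt -> rect_C21 X T w w1 w2 wt ->
  rect_C21 X T (fun x t => sg * (v x t - w x t)) (fun x t => sg * (v1 x t - w1 x t))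
    (fun x t => sg * (v2 x t - w2 x t)) (fun x t => sg * (vt x t - wt x t)).
Proof.
intros ((a0 & a1 & a2 & at') & Hvx & Hvt) ((b0 & b1 & b2 & bt) & Hwx & Hwt).
split; [repeat split; cont|]. split.
- intros x t Hx Ht. destruct (Hvx x t Hx Ht) as [D0 D1]. destruct (Hwx x t Hx Ht) as [E0 E1].
  split; der; ring.
- intros x t Hx Ht. specialize (Hvt x t Hx Ht). specialize (Hwt x t Hx Ht). der. ring.
Qed.

Lemma rect_C21_zero X T : rect_C21 X T (fun _ _ => 0) (fun _ _ => 0) (fun _ _ => 0) (fun _ _ => 0).
Proof. split; [repeat split; cont|]. split; intros; [split|]; apply derive_const. Qed.

(** Constants solve the equation, so the data bound the solution whatever [rho] is. *)
Lemma linear_solution_bound T b F p rho w w1 w2 wt M : 0 < T -> 0 < b -> cont1 rho ->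
  linear_solution T b F p rho w w1 w2 wt ->
  (forall t, 0 <= t <= T -> Rabs (F t) <= M) -> (forall x, 0 <= x <= b -> Rabs (p x) <= M) ->
  forall y t, in_rect 1 T y t -> Rabs (w y t) <= M.
Proof.
intros HT Hb Hrho (HR & He & Hbd & Hi) HF Hp.
assert (HM : 0 <= M) by (eapply Rle_trans; [apply Rabs_pos|apply (HF 0); lra]).
destruct (bounded1 rho 0 T Hrho) as (L & HL & HLb); [lra|].
assert (K : forall sg, (sg = 1 \/ sg = -1) -> forall y t, in_rect 1 T y t -> sg * (w y t - 0) <= M).
{ intros sg Hsg.
  apply (max_principle_rect T L _ _ _ _ (fun _ t => / radius b rho t ^ 2) (fun y t => y * rho t) (fun _ => M) (fun _ => 0) HT
    ltac:(lra) (rect_C21_scal_minus 1 T _ _ _ _ _ _ _ _ sg HR (rect_C21_zero 1 T))).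
  - cont.
  - intros y t Hy Ht. split; [|split].
    + apply Rlt_le, Rinv_0_lt_compat, pow_lt, radius_pos, Hb.
    + rewrite <- (Rmult_1_l L). apply abs_mul_le; [apply Rabs_le; lra|apply HLb; lra].
    + rewrite He by auto. apply Req_le. field. pose proof (radius_pos b rho t Hb). lra.
  - intros t Ht. rewrite (proj2 (Hbd t Ht)). ring.
  - intros t _. apply derive_const.
  - auto.
  - intros t Ht. rewrite (proj1 (Hbd t Ht)). specialize (HF t Ht). apply Rabs_le_between in HF. destruct Hsg as [-> | ->]; lra.
  - intros y Hy. rewrite Hi by exact Hy. specialize (Hp (b * y) ltac:(nra)). apply Rabs_le_between in Hp.
    destruct Hsg as [-> | ->]; lra. }
intros y t Hyt. apply Rabs_le.
pose proof (K 1 (or_introl eq_refl) y t Hyt). pose proof (K (-1) (or_intror eq_refl) y t Hyt). lra.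
Qed.

Lemma exp_lip (x y B : R) : x <= B -> y <= B -> Rabs (exp x - exp y) <= exp B * Rabs (x - y).
Proof.
intros Hx Hy.
apply (lipschitz_open exp exp (Rmin x y) B (exp B)).
- apply cont1_exp.
- intros z _. apply is_derive_Reals, derivable_pt_lim_exp.
- intros z Hz. rewrite Rabs_pos_eq by apply Rlt_le, exp_pos. apply exp_le; lra.
- split; [apply Rmin_l|exact Hx].
- split; [apply Rmin_r|exact Hy].
Qed.

(* The equation satisfied by the difference is forced by the difference of the
   coefficients, and the exponential weight turns the time integral into a factor [1/2]. *)
Lemma linear_difference (T b L C : R) : 0 < T -> 0 < b -> 0 <= L -> 0 <= C ->
  exists k, 0 < k /\ forall F p rho1 rho2 w w1 w2 wt v v1 v2 vt A,
  cont1 rho1 -> cont1 rho2 ->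
  (forall t, 0 <= t <= T -> Rabs (rho1 t) <= L) -> (forall t, 0 <= t <= T -> Rabs (rho2 t) <= L) ->
  linear_solution T b F p rho1 w w1 w2 wt -> linear_solution T b F p rho2 v v1 v2 vt ->
  (forall y t, in_rect 1 T y t -> Rabs (v1 y t) <= C /\ Rabs (v2 y t) <= C) ->
  (forall t, 0 <= t <= T -> Rabs (rho1 t - rho2 t) <= A * exp (k * t)) ->
  forall y t, in_rect 1 T y t -> Rabs (w y t - v y t) <= A / 2 * exp (k * t).
Proof.
intros HT Hb HL HC.
(* The Lipschitz constant of 1 / s^2 = exp (-2 I) / b^2 as a function of the integral I of [rho],
   for |I| <= L T. *)
set (K := / b ^ 2 * (exp (2 * (L * T)) * 2)).
assert (HK : 0 < K).
{ unfold K. pose proof (exp_pos (2 * (L * T))). assert (0 < / b ^ 2) by (apply Rinv_0_lt_compat, pow_lt, Hb).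
  apply Rmult_lt_0_compat; lra. }
assert (HKC : 0 <= K * C) by nra.
(* Integrating a forcing of size (K C + C) A exp (k t) gains 1 / k, and this [k] leaves at most half
   of A exp (k t). The summand 1 ensures k >= 1. *)
set (k := 2 * (K * C + C) + 1). assert (Hk : 1 <= k) by (unfold k; nra).
exists k. split; [lra|].
intros F p rho1 rho2 w w1 w2 wt v v1 v2 vt A c1 c2 HL1 HL2 (HW & We & Wb & Wi) (HV & Ve & Vb & Vi) HCb HA.
assert (HA0 : 0 <= A).
{ pose proof (HA 0 ltac:(lra)) as H. rewrite Rmult_0_r, exp_0 in H. pose proof (Rabs_pos (rho1 0 - rho2 0)). lra. }
assert (Einv : forall rho t, / radius b rho t ^ 2 = / b ^ 2 * exp (- 2 * RInt rho 0 t)).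
{ intros rho t. unfold radius. replace (- 2 * RInt rho 0 t) with (- RInt rho 0 t + - RInt rho 0 t) by ring.
  rewrite exp_plus, exp_Ropp. pose proof (exp_pos (RInt rho 0 t)). field. split; lra. }
assert (Hinv : forall t, 0 <= t <= T -> Rabs (/ radius b rho1 t ^ 2 - / radius b rho2 t ^ 2) <= K * (A * exp (k * t))).
{ intros t Ht. rewrite !Einv.
  assert (HI : forall rho, cont1 rho -> (forall t, 0 <= t <= T -> Rabs (rho t) <= L) -> - 2 * RInt rho 0 t <= 2 * (L * T)).
  { intros rho Hc Hl. pose proof (abs_RInt_le rho 0 t L ltac:(lra) Hc ltac:(intros; apply Hl; lra)) as H.
    apply Rabs_le_between in H. assert (L * (t - 0) <= L * T) by (apply Rmult_le_compat_l; lra). lra. }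
  replace (/ b ^ 2 * exp (- 2 * RInt rho1 0 t) - / b ^ 2 * exp (- 2 * RInt rho2 0 t))
    with (/ b ^ 2 * (exp (- 2 * RInt rho1 0 t) - exp (- 2 * RInt rho2 0 t))) by ring.
  assert (Hb2 : 0 < / b ^ 2) by (apply Rinv_0_lt_compat, pow_lt, Hb).
  rewrite Rabs_mult, (Rabs_pos_eq (/ b ^ 2)) by lra. unfold K. rewrite !Rmult_assoc.
  apply Rmult_le_compat_l; [lra|].
  eapply Rle_trans; [apply (exp_lip _ _ (2 * (L * T))); apply HI; auto|].
  apply Rmult_le_compat_l; [apply Rlt_le, exp_pos|].
  replace (- 2 * RInt rho1 0 t - - 2 * RInt rho2 0 t) with (- 2 * (RInt rho1 0 t - RInt rho2 0 t)) by ring.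
  rewrite Rabs_mult, (Rabs_left (- 2)) by lra. apply Rmult_le_compat; try apply Rabs_pos; [lra|lra|].
  replace (RInt rho1 0 t - RInt rho2 0 t) with (RInt (fun r => rho1 r - rho2 r) 0 t)
    by (apply (RInt_minus_cont1 rho1 rho2); auto).
  eapply Rle_trans.
  - apply (abs_RInt_le_prim (fun r => rho1 r - rho2 r) (fun r => A / k * exp (k * r)) (fun r => A * exp (k * r))); [lra|cont|cont| |].
    + intros r _. der. field. lra.
    + intros r Hr. apply HA; lra.
  - assert (0 <= A / k <= A).
    { split; [apply Rdiv_le_0_compat; lra|]. apply Rmult_le_reg_r with k; [lra|]. unfold Rdiv. rewrite Rmult_assoc, Rinv_l by lra. nra. }
    pose proof (exp_pos (k * t)). pose proof (exp_pos (k * 0)). nra. }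
assert (HS : forall sg, (sg = 1 \/ sg = -1) -> forall y t, in_rect 1 T y t ->
  sg * (w y t - v y t) <= (K * C + C) * A / k * exp (k * t)).
{ intros sg Hsg.
  assert (Hmu : forall t, 0 <= (K * C + C) * A / k * exp (k * t)).
  { intros t. pose proof (exp_pos (k * t)). apply Rmult_le_pos; [|lra]. apply Rdiv_le_0_compat; nra. }
  apply (max_principle_rect T L _ _ _ _ (fun _ t => / radius b rho1 t ^ 2) (fun y t => y * rho1 t)
    (fun t => (K * C + C) * A / k * exp (k * t)) (fun t => (K * C + C) * A * exp (k * t)) HT
    ltac:(lra) (rect_C21_scal_minus 1 T _ _ _ _ _ _ _ _ sg HW HV)).
  - cont.
  - intros y t Hy Ht. split; [|split].
    + apply Rlt_le, Rinv_0_lt_compat, pow_lt, radius_pos, Hb.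
    + rewrite <- (Rmult_1_l L). apply abs_mul_le; [apply Rabs_le; lra|apply HL1; lra].
    + rewrite We, Ve by auto.
      assert (Hyt : in_rect 1 T y t) by (split; lra).
      destruct (HCb y t Hyt) as [B1 B2].
      pose proof (abs_mul_le _ _ _ _ (Hinv t ltac:(lra)) B2) as X1.
      assert (X2 : Rabs (y * (rho1 t - rho2 t) * v1 y t) <= 1 * (A * exp (k * t)) * C).
      { apply abs_mul_le; [apply abs_mul_le; [apply Rabs_le; lra|apply HA; lra]|exact B1]. }
      apply Rabs_le_between in X1, X2.
      pose proof (radius_pos b rho1 t Hb). pose proof (radius_pos b rho2 t Hb).
      (* The operator with [rho1] acts on the difference, while the differences of the coefficients
         multiply derivatives of [v], which [C] bounds. *)
      replace (sg * (w2 y t / radius b rho1 t ^ 2 + y * rho1 t * w1 y t - (v2 y t / radius b rho2 t ^ 2 + y * rho2 t * v1 y t)))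
        with (/ radius b rho1 t ^ 2 * (sg * (w2 y t - v2 y t)) + y * rho1 t * (sg * (w1 y t - v1 y t))
          + sg * ((/ radius b rho1 t ^ 2 - / radius b rho2 t ^ 2) * v2 y t + y * (rho1 t - rho2 t) * v1 y t))
        by (field; split; lra).
      apply Rplus_le_compat_l. destruct Hsg as [-> | ->]; lra.
  - intros t Ht. rewrite (proj2 (Wb t Ht)), (proj2 (Vb t Ht)). ring.
  - intros t _. der. field. lra.
  - auto.
  - intros t Ht. rewrite (proj1 (Wb t Ht)), (proj1 (Vb t Ht)), Rminus_diag, Rmult_0_r. auto.
  - intros y Hy. rewrite Wi, Vi by exact Hy. rewrite Rminus_diag, Rmult_0_r. auto. }
intros y t Hyt.
assert (Hfin : (K * C + C) * A / k * exp (k * t) <= A / 2 * exp (k * t)).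
{ apply Rmult_le_compat_r; [apply Rlt_le, exp_pos|]. apply Rmult_le_reg_r with (2 * k); [lra|].
  replace ((K * C + C) * A / k * (2 * k)) with (2 * (K * C + C) * A) by (field; lra).
  replace (A / 2 * (2 * k)) with (A * k) by field. unfold k. nra. }
apply Rabs_le. pose proof (HS 1 (or_introl eq_refl) y t Hyt). pose proof (HS (-1) (or_intror eq_refl) y t Hyt). lra.
Qed.

Definition free_solution (T b lambda sigma : R) (F p rho : R -> R) (w w1 w2 wt : R -> R -> R) : Prop :=
  cont1 rho /\ linear_solution T b F p rho w w1 w2 wt /\
  forall t, 0 <= t <= T -> rho t = exp (- (lambda * t)) * RInt (fun y => w y t) 0 1 - sigma.

Lemma average_lip (lambda t e : R) (w v : R -> R -> R) : 0 <= lambda -> 0 <= t -> cont2 w -> cont2 v ->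
  (forall y, 0 <= y <= 1 -> Rabs (w y t - v y t) <= e) ->
  Rabs (exp (- (lambda * t)) * RInt (fun y => w y t) 0 1 - exp (- (lambda * t)) * RInt (fun y => v y t) 0 1) <= e.
Proof.
intros Hl Ht cw cv He.
rewrite <- Rmult_minus_distr_l.
replace (RInt (fun y => w y t) 0 1 - RInt (fun y => v y t) 0 1) with (RInt (fun y => w y t - v y t) 0 1)
  by (apply (RInt_minus_cont1 (fun y => w y t) (fun y => v y t)); cont).
replace e with (1 * e) by ring. apply abs_mul_le.
- rewrite Rabs_pos_eq by apply Rlt_le, exp_pos. rewrite <- exp_0. apply exp_le. nra.
- replace e with (e * (1 - 0)) by ring. apply abs_RInt_le; [lra|cont|exact He].
Qed.

(** A weighted bound on the difference of the coefficients yields half of it for the difference of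
    the solutions, and averaging passes this back to the coefficients; iteration drives the bound to
    0. *)
Lemma free_solution_unique T b lambda sigma F p rho1 w w1 w2 wt rho2 v v1 v2 vt :
  0 < T -> 0 < b -> 0 <= lambda ->
  free_solution T b lambda sigma F p rho1 w w1 w2 wt -> free_solution T b lambda sigma F p rho2 v v1 v2 vt ->
  (forall t, 0 <= t <= T -> rho1 t = rho2 t) /\ (forall y t, in_rect 1 T y t -> w y t = v y t).
Proof.
intros HT Hb Hl (c1 & HW & E1) (c2 & HV & E2).
destruct (bounded1 rho1 0 T c1) as (L1 & HL1 & HL1b); [lra|]. destruct (bounded1 rho2 0 T c2) as (L2 & HL2 & HL2b); [lra|].
assert (cw : cont2 w) by apply HW. assert (HVc := HV). destruct HVc as (((cv & cv1 & cv2 & _) & _) & _).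
destruct (bounded2 v1 0 1 0 T cv1) as (C1 & HC1 & HC1b); try lra.
destruct (bounded2 v2 0 1 0 T cv2) as (C2 & HC2 & HC2b); try lra.
destruct (linear_difference T b (L1 + L2) (C1 + C2)) as (k & Hk & HD); try lra.
assert (Hmain : forall A, (forall t, 0 <= t <= T -> Rabs (rho1 t - rho2 t) <= A * exp (k * t)) ->
  forall y t, in_rect 1 T y t -> Rabs (w y t - v y t) <= A / 2 * exp (k * t)).
{ intros A HA. apply (HD F p rho1 rho2 w w1 w2 wt v v1 v2 vt); auto.
  - intros t Ht. specialize (HL1b t Ht). lra.
  - intros t Ht. specialize (HL2b t Ht). lra.
  - intros y t [Hy Ht]. specialize (HC1b y t Hy Ht). specialize (HC2b y t Hy Ht). lra. }
assert (Hit : forall n t, 0 <= t <= T -> Rabs (rho1 t - rho2 t) <= (L1 + L2) / 2 ^ n * exp (k * t)).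
{ induction n; intros t Ht.
  - simpl. unfold Rdiv. rewrite Rinv_1, Rmult_1_r.
    assert (1 <= exp (k * t)) by (rewrite <- exp_0; apply exp_le; nra).
    apply Rle_trans with (L1 + L2); [|nra].
    specialize (HL1b t Ht). specialize (HL2b t Ht). apply Rabs_le_between in HL1b, HL2b. apply Rabs_le; lra.
  - rewrite E1, E2 by exact Ht.
    match goal with |- Rabs ?X <= _ => replace X with (exp (- (lambda * t)) * RInt (fun y => w y t) 0 1
      - exp (- (lambda * t)) * RInt (fun y => v y t) 0 1) by ring end.
    apply average_lip; auto; try lra. intros y Hy.
    assert (H2n : 0 < 2 ^ n) by (apply pow_lt; lra).
    simpl pow. replace ((L1 + L2) / (2 * 2 ^ n)) with ((L1 + L2) / 2 ^ n / 2) by (field; lra).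
    apply Hmain; [exact IHn|split; auto]. }
assert (Hrho : forall t, 0 <= t <= T -> rho1 t = rho2 t).
{ intros t Ht. apply Rminus_diag_uniq. destruct (Req_dec (rho1 t - rho2 t) 0) as [|Hn]; [auto|exfalso].
  apply Rabs_pos_lt in Hn. set (P := Rabs (rho1 t - rho2 t)) in *. pose proof (exp_pos (k * t)) as He.
  destruct (geometric_small (L1 + L2) (P / (2 * exp (k * t)))) as [N HN]; [lra|apply Rdiv_lt_0_compat; lra|].
  specialize (Hit N t Ht). fold P in Hit. specialize (HN N (le_n _)).
  assert ((L1 + L2) / 2 ^ N * exp (k * t) <= P / (2 * exp (k * t)) * exp (k * t)) by (apply Rmult_le_compat_r; lra).
  replace (P / (2 * exp (k * t)) * exp (k * t)) with (P / 2) in * by (field; lra). lra. }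
split; [exact Hrho|]. intros y t Hyt.
assert (H : Rabs (w y t - v y t) <= 0 / 2 * exp (k * t)).
{ apply Hmain; auto. intros r Hr. rewrite Hrho, Rminus_diag, Rabs_R0 by exact Hr. lra. }
replace (0 / 2 * exp (k * t)) with 0 in H by (unfold Rdiv; ring).
apply Rminus_diag_uniq. destruct (Req_dec (w y t - v y t) 0) as [|Hn]; [auto|]. apply Rabs_pos_lt in Hn. lra.
Qed.

Theorem free_solution_exists (T b lambda sigma : R) (F F1 p p1 p2 : R -> R) : 0 < T -> 0 < b -> 0 <= lambda ->
  (forall t, is_derive F t (F1 t)) -> cont1 F1 ->
  (forall x, is_derive p x (p1 x)) -> (forall x, is_derive p1 x (p2 x)) -> cont1 p2 ->
  F 0 = p 0 -> F1 0 = p2 0 -> p1 b = 0 ->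
  exists rho w w1 w2 wt, free_solution T b lambda sigma F p rho w w1 w2 wt.
Proof.
intros HT Hb Hl HF HF1 Hp Hp1 Hp2 EF0 EF1 Epb.
destruct (bounded1 F 0 T (cont1_derive F F1 HF)) as (MF & HMF & HMFb); [lra|].
destruct (bounded1 p 0 b (cont1_derive p p1 Hp)) as (Mp & HMp & HMpb); [lra|].
(* Every linear solution is bounded by MF + Mp, so [Phi] below maps the solution for any [rho] to a
   coefficient that is again bounded by [L]. *)
set (L := MF + Mp + Rabs sigma). assert (HL : 0 < L) by (pose proof (Rabs_pos sigma); unfold L; lra).
destruct (linear_solution_exists T b L F F1 p p1 p2) as [C HC]; auto; try lra.
assert (HC0 : 0 <= C).
{ destruct (HC (fun _ => 0)) as (w & w1 & w2 & wt & _ & H); [cont|intros; rewrite Rabs_R0; lra|].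
  destruct (H 0 0) as [H0 _]; [split; lra|]. eapply Rle_trans; [apply Rabs_pos|exact H0]. }
destruct (linear_difference T b L C) as (k & Hk & HD); try lra.
set (Phi := fun (w : R -> R -> R) t => exp (- (lambda * t)) * RInt (fun y => w y t) 0 1 - sigma).
pose (X := ((R -> R) * (nat -> R -> R -> R))%type).
pose (P := fun (n : nat) (x : X) => cont1 (fst x) /\ (forall t, 0 <= t <= T -> Rabs (fst x t) <= L) /\
  linear_solution T b F p (fst x) (snd x 0%nat) (snd x 1%nat) (snd x 2%nat) (snd x 3%nat) /\
  (forall y t, in_rect 1 T y t -> Rabs (snd x 1%nat y t) <= C /\ Rabs (snd x 2%nat y t) <= C)).
pose (Q := fun (n : nat) (x x' : X) => forall t, 0 <= t <= T -> fst x' t = Phi (snd x 0%nat) t).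
assert (HX : forall rho, cont1 rho -> (forall t, 0 <= t <= T -> Rabs (rho t) <= L) -> exists ws, forall n, P n (rho, ws)).
{ intros rho Hrho HrhoL. destruct (HC rho Hrho HrhoL) as (w & w1 & w2 & wt & Hw & Hwb).
  exists (fun c : nat => match c with 0%nat => w | 1%nat => w1 | 2%nat => w2 | _ => wt end). intros n.
  split; [exact Hrho|]. split; [exact HrhoL|]. split; [exact Hw|exact Hwb]. }
assert (HPhi : forall rho w w1 w2 wt, cont1 rho -> linear_solution T b F p rho w w1 w2 wt ->
  cont1 (fun t => Phi w (clamp 0 T t)) /\ forall t, 0 <= t <= T -> Rabs (Phi w t) <= L).
{ intros rho w w1 w2 wt Hrho Hw. assert (cw : cont2 w) by apply Hw. split.
  - pose proof (cont1_RInt_param w 0 1 cw ltac:(lra)) as Hi. pose proof (cont1_clamp 0 T).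
    apply (cont1_comp (Phi w) (clamp 0 T)); [|assumption]. unfold Phi. cont.
  - intros t Ht. unfold Phi, L.
    assert (A : Rabs (exp (- (lambda * t)) * RInt (fun y => w y t) 0 1
       - exp (- (lambda * t)) * RInt (fun _ => 0) 0 1) <= MF + Mp).
    { apply (average_lip lambda t (MF + Mp) w (fun _ _ => 0)); auto; try lra; [cont|]. intros y Hy. rewrite Rminus_0_r.
      apply (linear_solution_bound T b F p rho w w1 w2 wt); auto; [| |split; auto].
      - intros r Hr. specialize (HMFb r Hr). lra.
      - intros x Hx. specialize (HMpb x Hx). lra. }
    rewrite RInt_const_R in A.
    rewrite !Rmult_0_r, Rminus_0_r in A. apply abs_add_le; [exact A|]. rewrite Rabs_Ropp. lra. }
destruct (HX (fun _ => 0)) as [ws0 H0]; [cont|intros; rewrite Rabs_R0; lra|].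
destruct (dependent_choice_seq X P Q ((fun _ => 0), ws0) (H0 0%nat)) as (f & Hf0 & Hf).
{ intros n [rho ws] (Hr & HrL & Hw & Hwb). destruct (HPhi _ _ _ _ _ Hr Hw) as [Hc Hbd].
  destruct (HX (fun t => Phi (ws 0%nat) (clamp 0 T t))) as [ws' Hws'].
  - exact Hc.
  - intros t Ht. apply Hbd, clamp_in; lra.
  - exists ((fun t => Phi (ws 0%nat) (clamp 0 T t)), ws'). split; [apply Hws'|].
    intros t Ht. simpl. rewrite clamp_id by exact Ht. reflexivity. }
set (rh := fun n => fst (f n)). set (wn := fun n => snd (f n)).
assert (HP : forall n, P n (f n)) by (intros; apply Hf).
assert (Hrc : forall n, cont1 (rh n)) by (intros n; apply (HP n)).
assert (HrL : forall n t, 0 <= t <= T -> Rabs (rh n t) <= L) by (intros n; apply (HP n)).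
assert (Hlin : forall n, linear_solution T b F p (rh n) (wn n 0%nat) (wn n 1%nat) (wn n 2%nat) (wn n 3%nat)) by (intros n; apply (HP n)).
assert (HwC : forall n y t, in_rect 1 T y t -> Rabs (wn n 1%nat y t) <= C /\ Rabs (wn n 2%nat y t) <= C) by (intros n; apply (HP n)).
assert (HQ : forall n t, 0 <= t <= T -> rh (S n) t = Phi (wn n 0%nat) t) by (intros n; apply Hf).
assert (Hcw : forall n, cont2 (wn n 0%nat)) by (intros n; apply (Hlin n)).
assert (Hexp : forall t, 0 <= t <= T -> 1 <= exp (k * t) <= exp (k * T)).
{ intros t Ht. split; [rewrite <- exp_0; apply exp_le; nra|apply exp_le; nra]. }
assert (HPl : forall w v t e, 0 <= t <= T -> cont2 w -> cont2 v -> (forall y, 0 <= y <= 1 -> Rabs (w y t - v y t) <= e) ->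
  Rabs (Phi w t - Phi v t) <= e).
{ intros w v t e Ht cw cv He. unfold Phi.
  match goal with |- Rabs ?Y <= _ => replace Y with (exp (- (lambda * t)) * RInt (fun y => w y t) 0 1
      - exp (- (lambda * t)) * RInt (fun y => v y t) 0 1) by ring end.
  apply average_lip; auto; lra. }
assert (Hgeo : forall n t, 0 <= t <= T -> Rabs (rh (S n) t - rh n t) <= 2 * L / 2 ^ n * exp (k * t)).
{ induction n; intros t Ht.
  - simpl pow. pose proof (HrL 1%nat t Ht) as A. pose proof (HrL 0%nat t Ht) as B. pose proof (Hexp t Ht).
    apply Rabs_le_between in A, B. apply Rle_trans with (2 * L); [apply Rabs_le; lra|].
    unfold Rdiv. rewrite Rinv_1, Rmult_1_r. nra.
  - rewrite !HQ by exact Ht. apply HPl; auto. intros y Hy.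
    assert (H2n : 0 < 2 ^ n) by (apply pow_lt; lra).
    simpl pow. replace (2 * L / (2 * 2 ^ n)) with (2 * L / 2 ^ n / 2) by (field; lra).
    apply (HD F p (rh (S n)) (rh n) (wn (S n) 0%nat) (wn (S n) 1%nat) (wn (S n) 2%nat) (wn (S n) 3%nat)
      (wn n 0%nat) (wn n 1%nat) (wn n 2%nat) (wn n 3%nat)); auto. split; auto. }
assert (Htel : forall n t, rh (S n) t = rh 0%nat t + sum_f_R0 (fun i => rh (S i) t - rh i t) n).
{ induction n; intros t; simpl; [ring|]. rewrite IHn. simpl. ring. }
assert (HCau : ucauchy 1 T (fun n _ t => rh (S n) t)).
{ intros e He.
  assert (Hg : ucauchy 1 T (fun n x t => sum_f_R0 (fun i => (fun i (_ : R) t => rh (S i) t - rh i t) i x t) n)).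
  { apply (geometric_sum_cauchy 1 T (2 * L * exp (k * T))).
    - pose proof (exp_pos (k * T)). nra.
    - intros i x t [_ Ht]. eapply Rle_trans; [apply Hgeo, Ht|].
      assert (H2n : 0 < 2 ^ i) by (apply pow_lt; lra).
      replace (2 * L * exp (k * T) / 2 ^ i) with (2 * L / 2 ^ i * exp (k * T)) by (field; lra).
      apply Rmult_le_compat_l; [apply Rdiv_le_0_compat; lra|apply Hexp, Ht]. }
  destruct (Hg e He) as [N HN]. exists N. intros n m Hn Hm x t Hxt. specialize (HN n m Hn Hm x t Hxt). cbv beta in HN.
  rewrite (Htel n), (Htel m).
  match goal with |- Rabs ?Y <= _ => replace Y with (sum_f_R0 (fun i => rh (S i) t - rh i t) n
    - sum_f_R0 (fun i => rh (S i) t - rh i t) m) by ring end. exact HN. }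
destruct (ucauchy_limit 1 T (fun n _ t => rh (S n) t)) as (g & cg & Hg); try lra; [|exact HCau|].
{ intros n. pose proof (Hrc (S n)). cont. }
set (rho := fun t => g 0 t).
assert (Hrho : cont1 rho) by (unfold rho; cont).
assert (HrhoL : forall t, 0 <= t <= T -> Rabs (rho t) <= L).
{ intros t Ht. apply (ulimit_bound 1 T _ g (fun _ _ => L) Hg); [|split; lra]. intros n x r [_ Hr]. apply HrL, Hr. }
destruct (HC rho Hrho HrhoL) as (w & w1 & w2 & wt & Hw & Hwb).
assert (cw : cont2 w) by apply Hw.
exists rho, w, w1, w2, wt. split; [exact Hrho|]. split; [exact Hw|].
intros t Ht. change (rho t = Phi w t). apply Rminus_diag_uniq.
destruct (Req_dec (rho t - Phi w t) 0) as [|Hn]; [auto|exfalso].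
apply Rabs_pos_lt in Hn. set (E := Rabs (rho t - Phi w t)) in *.
pose proof (exp_pos (k * T)) as HeT.
set (e := E / (4 * exp (k * T))). assert (He : 0 < e) by (apply Rdiv_lt_0_compat; lra).
assert (HeE : e * exp (k * T) = E / 4) by (unfold e; field; lra).
destruct (Hg e He) as [N HN].
assert (A1 : Rabs (rh (S (S N)) t - rho t) <= e) by (apply (HN (S N) ltac:(lia) 0 t); split; lra).
(* The difference estimate also gives continuity of the solution map: [Phi w] is close to the
   iterate computed from a coefficient close to [rho]. *)
assert (A2 : Rabs (Phi w t - rh (S (S N)) t) <= e / 2 * exp (k * t)).
{ rewrite HQ by exact Ht. apply HPl; auto. intros y Hy.
  apply (HD F p rho (rh (S N)) w w1 w2 wt (wn (S N) 0%nat) (wn (S N) 1%nat) (wn (S N) 2%nat) (wn (S N) 3%nat)); auto.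
  - intros r Hr. rewrite Rabs_minus_sym.
    assert (Rabs (rh (S N) r - rho r) <= e) by (apply (HN N (le_n _) 0 r); split; lra).
    pose proof (Hexp r Hr). nra.
  - split; auto. }
pose proof (Hexp t Ht).
assert (E <= Rabs (rh (S (S N)) t - rho t) + Rabs (Phi w t - rh (S (S N)) t)).
{ unfold E. replace (rho t - Phi w t) with (- ((rh (S (S N)) t - rho t) + (Phi w t - rh (S (S N)) t))) by ring.
  rewrite Rabs_Ropp. apply Rabs_triang. }
nra.
Qed.

(** * Gluing over growing time intervals *)

Lemma is_derive_ext_open (g h : R -> R) (a b x l : R) : a < x < b ->
  (forall y, a < y < b -> g y = h y) -> is_derive g x l -> is_derive h x l.
Proof.
intros Hx E. apply is_derive_ext_loc.
assert (Hr : 0 < Rmin (x - a) (b - x)) by (apply Rmin_pos; lra).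
pose proof (Rmin_l (x - a) (b - x)). pose proof (Rmin_r (x - a) (b - x)).
exists (mkposreal _ Hr). intros y Hy. apply Rabs_def2 in Hy. unfold minus, plus, opp in Hy; simpl in Hy. apply E. lra.
Qed.

Lemma rect_C21_unique X T w w1 w2 wt v v1 v2 vt : 0 < X -> 0 < T ->
  rect_C21 X T w w1 w2 wt -> rect_C21 X T v v1 v2 vt ->
  (forall x t, in_rect X T x t -> w x t = v x t) ->
  forall x t, in_rect X T x t -> w1 x t = v1 x t /\ w2 x t = v2 x t /\ wt x t = vt x t.
Proof.
intros HX HT ((a0 & a1 & a2 & at') & Hwx & Hwt) ((b0 & b1 & b2 & bt) & Hvx & Hvt) E.
assert (E1 : forall x t, 0 < x < X -> 0 <= t <= T -> w1 x t = v1 x t).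
{ intros x t Hx Ht. destruct (Hwx x t Hx Ht) as [D _]. destruct (Hvx x t Hx Ht) as [D' _].
  apply (is_derive_ext_open _ (fun y => v y t) 0 X) in D; auto; [|intros y Hy; apply E; split; lra].
  apply is_derive_unique in D, D'. exact (eq_trans (eq_sym D) D'). }
assert (E2 : forall x t, 0 < x < X -> 0 <= t <= T -> w2 x t = v2 x t).
{ intros x t Hx Ht. destruct (Hwx x t Hx Ht) as [_ D]. destruct (Hvx x t Hx Ht) as [_ D'].
  apply (is_derive_ext_open _ (fun y => v1 y t) 0 X) in D; auto.
  apply is_derive_unique in D, D'. exact (eq_trans (eq_sym D) D'). }
assert (Et : forall x t, 0 < x < X -> 0 < t < T -> wt x t = vt x t).
{ intros x t Hx Ht. pose proof (Hwt x t Hx Ht) as D. pose proof (Hvt x t Hx Ht) as D'.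
  apply (is_derive_ext_open _ (fun r => v x r) 0 T) in D; auto; [|intros y Hy; apply E; split; lra].
  apply is_derive_unique in D, D'. exact (eq_trans (eq_sym D) D'). }
intros x t Hxt. split; [|split]; apply (rect_closure X T); auto; intros; [apply E1|apply E2]; lra.
Qed.

Lemma radius_ext b rho rho' T t : (forall t, 0 <= t <= T -> rho t = rho' t) -> 0 <= t <= T ->
  radius b rho t = radius b rho' t.
Proof.
intros E Ht. unfold radius. do 2 f_equal. apply RInt_ext. intros x Hx.
rewrite Rmin_left, Rmax_right in Hx by lra. apply E. lra.
Qed.

(** Serves both to restrict a solution to a shorter interval and to replace its functions by glued
    ones that agree on the rectangle. *)
Lemma free_solution_congr T T' b lambda sigma F p rho w w1 w2 wt rho' w' w1' w2' wt' :
  0 < T' <= T -> free_solution T b lambda sigma F p rho w w1 w2 wt ->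
  cont1 rho' -> cont2 w' -> cont2 w1' -> cont2 w2' -> cont2 wt' ->
  (forall t, 0 <= t <= T' -> rho t = rho' t) ->
  (forall y t, in_rect 1 T' y t -> w y t = w' y t /\ w1 y t = w1' y t /\ w2 y t = w2' y t /\ wt y t = wt' y t) ->
  free_solution T' b lambda sigma F p rho' w' w1' w2' wt'.
Proof.
intros HT (cr & ((_ & Hx & Ht) & He & Hb & Hi) & Hrho) cr' c0 c1 c2 ct Er E.
split; [exact cr'|]. split.
- split; [|split; [|split]].
  + split; [auto|]. split.
    * intros y t Hy Htt. destruct (Hx y t Hy ltac:(lra)) as [D0 D1].
      destruct (E y t ltac:(split; lra)) as (_ & <- & <- & _). split.
      -- apply (is_derive_ext_open (fun y => w y t) _ 0 1); auto. intros z Hz. apply E; split; lra.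
      -- apply (is_derive_ext_open (fun y => w1 y t) _ 0 1); auto. intros z Hz. apply E; split; lra.
    * intros y t Hy Htt. destruct (E y t ltac:(split; lra)) as (_ & _ & _ & <-).
      apply (is_derive_ext_open (fun r => w y r) _ 0 T'); auto; [|apply Ht; lra]. intros z Hz. apply E; split; lra.
  + intros y t Hy Htt. destruct (E y t ltac:(split; lra)) as (_ & <- & <- & <-).
    rewrite <- Er, <- (radius_ext b rho rho' T') by (auto; lra). apply He; lra.
  + intros t Htt. destruct (E 0 t ltac:(split; lra)) as (<- & _). destruct (E 1 t ltac:(split; lra)) as (_ & <- & _).
    apply Hb. lra.
  + intros y Hy. destruct (E y 0 ltac:(split; lra)) as (<- & _). apply Hi, Hy.
- intros t Htt. rewrite <- Er by exact Htt. rewrite Hrho by lra. do 2 f_equal. apply RInt_ext. intros y Hy.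
  rewrite Rmin_left, Rmax_right in Hy by lra. apply E. split; lra.
Qed.

Theorem free_solution_global (b lambda sigma : R) (F F1 p p1 p2 : R -> R) : 0 < b -> 0 <= lambda ->
  (forall t, is_derive F t (F1 t)) -> cont1 F1 ->
  (forall x, is_derive p x (p1 x)) -> (forall x, is_derive p1 x (p2 x)) -> cont1 p2 ->
  F 0 = p 0 -> F1 0 = p2 0 -> p1 b = 0 ->
  exists rho w w1 w2 wt, forall T, 0 < T -> free_solution T b lambda sigma F p rho w w1 w2 wt.
Proof.
intros Hb Hl HF HF1 Hp Hp1 Hp2 EF0 EF1 Epb.
assert (Hex : forall n : nat, exists x : (R -> R) * (nat -> R -> R -> R),
  free_solution (INR n + 1) b lambda sigma F p (fst x) (snd x 0%nat) (snd x 1%nat) (snd x 2%nat) (snd x 3%nat)).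
{ intros n. pose proof (pos_INR n).
  destruct (free_solution_exists (INR n + 1) b lambda sigma F F1 p p1 p2) as (rho & w & w1 & w2 & wt & H1); auto; [lra|].
  exists (rho, fun c : nat => match c with 0%nat => w | 1%nat => w1 | 2%nat => w2 | _ => wt end). exact H1. }
set (sol := fun n => proj1_sig (constructive_indefinite_description _ (Hex n))).
assert (Hsol : forall n, free_solution (INR n + 1) b lambda sigma F p (fst (sol n)) (snd (sol n) 0%nat) (snd (sol n) 1%nat)
  (snd (sol n) 2%nat) (snd (sol n) 3%nat)).
{ intros n. unfold sol. destruct constructive_indefinite_description; auto. }
clearbody sol. clear Hex.
assert (Hc : forall n, cont1 (fst (sol n)) /\ forall c, (c <= 3)%nat -> cont2 (snd (sol n) c)).
{ intros n. destruct (Hsol n) as (c & (((c0 & c1 & c2 & c3) & _) & _) & _). split; [exact c|].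
  intros i Hi. do 4 (destruct i as [|i]; [assumption|]). lia. }
assert (Hagree : forall n m t, 0 <= t -> t <= INR n + 1 -> t <= INR m + 1 ->
  fst (sol n) t = fst (sol m) t /\ forall c y, (c <= 3)%nat -> 0 <= y <= 1 -> snd (sol n) c y t = snd (sol m) c y t).
{ intros n m t Ht Hn Hm. set (T := Rmin (INR n + 1) (INR m + 1)).
  pose proof (pos_INR n). pose proof (pos_INR m).
  assert (HT : 0 < T) by (apply Rmin_pos; lra).
  assert (HTn : T <= INR n + 1) by apply Rmin_l. assert (HTm : T <= INR m + 1) by apply Rmin_r.
  assert (HtT : 0 <= t <= T) by (split; [exact Ht|apply Rmin_glb; auto]).
  assert (Hr : forall k, T <= INR k + 1 -> free_solution T b lambda sigma F p (fst (sol k)) (snd (sol k) 0%nat) (snd (sol k) 1%nat)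
    (snd (sol k) 2%nat) (snd (sol k) 3%nat)).
  { intros k Hk. destruct (Hc k) as [ck cks]. apply (free_solution_congr (INR k + 1) T b lambda sigma F p _ _ _ _ _ _ _ _ _ _ ltac:(lra) (Hsol k)); auto. }
  pose proof (Hr n HTn) as Sn. pose proof (Hr m HTm) as Sm.
  destruct (free_solution_unique T b lambda sigma F p _ _ _ _ _ _ _ _ _ _ HT Hb Hl Sn Sm) as [E0 E1].
  split; [apply E0, HtT|]. intros c y Hcc Hy.
  destruct (rect_C21_unique 1 T _ _ _ _ _ _ _ _ ltac:(lra) HT (proj1 (proj1 (proj2 Sn))) (proj1 (proj1 (proj2 Sm))) E1 y t) as (K1 & K2 & K3).
  { split; auto. }
  do 4 (destruct c as [|c]; [auto; apply E1; split; auto|]). lia. }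
(* One more than the integer part: all times up to t + 1 lie in the interval of the solution with
   this index, so continuity at [t] is inherited from that single solution. *)
set (idx := fun t : R => S (proj1_sig (nfloor_ex (Rmax 0 t) (Rmax_l 0 t)))).
assert (Hidx : forall t, Rmax 0 t <= INR (idx t)).
{ intros t. unfold idx. destruct nfloor_ex as [n Hn]. simpl proj1_sig. rewrite S_INR. lra. }
set (rho := fun t => fst (sol (idx t)) (Rmax 0 t)).
set (w := fun (c : nat) y t => snd (sol (idx t)) c (clamp 0 1 y) (Rmax 0 t)).
assert (Hloc : forall n t, t <= INR n + 1 -> rho t = fst (sol n) (Rmax 0 t) /\
  forall c y, (c <= 3)%nat -> w c y t = snd (sol n) c (clamp 0 1 y) (Rmax 0 t)).
{ intros n t Ht. pose proof (pos_INR n). pose proof (Hidx t).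
  destruct (Hagree (idx t) n (Rmax 0 t)) as [E0 E1]; [apply Rmax_l|lra|apply Rmax_lub; lra|].
  split; [exact E0|]. intros c y Hcc. apply E1; [exact Hcc|apply clamp_in; lra]. }
assert (cmax : cont1 (Rmax 0)).
{ apply cont1_of_eps. intros x e He. exists e; split; auto. intros u Hu.
  unfold Rmax. repeat destruct Rle_dec; apply Rabs_def2 in Hu; apply Rabs_def1; lra. }
pose proof (cont1_clamp 0 1) as cclamp.
assert (crho : cont1 rho).
{ apply cont1_of_eps. intros t e He. pose proof (Hidx t). pose proof (Rmax_r 0 t).
  destruct (Hc (idx t)) as [cs _].
  assert (ck : cont1 (fun t' => fst (sol (idx t)) (Rmax 0 t'))) by (apply cont1_comp; auto).
  destruct (cont1_eps _ t e ck He) as (d & Hd & H2).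
  exists (Rmin d 1). split; [apply Rmin_pos; lra|]. intros u Hu.
  pose proof (Rmin_l d 1). pose proof (Rmin_r d 1).
  assert (Hu1 : u <= INR (idx t) + 1) by (apply Rabs_def2 in Hu; lra).
  rewrite (proj1 (Hloc (idx t) u Hu1)), (proj1 (Hloc (idx t) t ltac:(lra))). apply H2. lra. }
assert (cw : forall c, (c <= 3)%nat -> cont2 (w c)).
{ intros c Hcc y t e. pose proof (Hidx t). pose proof (Rmax_r 0 t).
  destruct (Hc (idx t)) as [_ cs]. specialize (cs c Hcc).
  assert (ck : cont2 (fun y t' => snd (sol (idx t)) c (clamp 0 1 y) (Rmax 0 t'))) by cont.
  destruct (cont2_eps _ y t e ck (cond_pos e)) as (d & Hd & H2).
  assert (Hm : 0 < Rmin d 1) by (apply Rmin_pos; lra).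
  exists (mkposreal _ Hm). simpl. intros z u Hz Hu.
  pose proof (Rmin_l d 1). pose proof (Rmin_r d 1).
  assert (Hu1 : u <= INR (idx t) + 1) by (apply Rabs_def2 in Hu; lra).
  rewrite (proj2 (Hloc (idx t) u Hu1) c z Hcc), (proj2 (Hloc (idx t) t ltac:(lra)) c y Hcc). apply H2; lra. }
exists rho, (w 0%nat), (w 1%nat), (w 2%nat), (w 3%nat). intros T HT.
destruct (nfloor_ex T) as [n Hn]; [lra|].
apply (free_solution_congr (INR n + 1) T b lambda sigma F p _ _ _ _ _ _ _ _ _ _ ltac:(lra) (Hsol n)); auto.
- intros t Ht. rewrite (proj1 (Hloc n t ltac:(lra))), Rmax_right by lra. reflexivity.
- intros y t [Hy Ht]. destruct (Hloc n t ltac:(lra)) as [_ E].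
  rewrite !E by lia. rewrite clamp_id, Rmax_right by lra. auto.
Qed.

(** * Return to the moving domain *)

Lemma continuous_on_eps (D : R -> Prop) (f : R -> R) (x e : R) : continuous_on D f -> D x -> 0 < e ->
  exists d, 0 < d /\ forall y, D y -> Rabs (y - x) < d -> Rabs (f y - f x) < e.
Proof.
intros H Hx He. specialize (H x Hx). apply filterlim_locally with (eps := mkposreal e He) in H.
destruct H as [d Hd]. exists d. split; [apply cond_pos|]. intros y Hy Hyx. apply (Hd y Hyx Hy).
Qed.

Lemma continuous_on2_eps (D : R * R -> Prop) (f : R -> R -> R) (x t e : R) :
  continuous_on D (fun p => f (fst p) (snd p)) -> D (x, t) -> 0 < e ->
  exists d, 0 < d /\ forall y r, D (y, r) -> Rabs (y - x) < d -> Rabs (r - t) < d -> Rabs (f y r - f x t) < e.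
Proof.
intros H Hx He. specialize (H (x, t) Hx). apply filterlim_locally with (eps := mkposreal e He) in H.
destruct H as [d Hd]. exists d. split; [apply cond_pos|]. intros y r Hy Hyx Hrt.
apply (Hd (y, r)); [split; [exact Hyx|exact Hrt]|exact Hy].
Qed.

Lemma cont1_continuous_on (D : R -> Prop) (f : R -> R) : cont1 f -> continuous_on D f.
Proof.
intros H x Hx. apply filterlim_locally. intros e.
destruct (cont1_eps f x e H (cond_pos e)) as (d & Hd & Hd'). exists (mkposreal d Hd). intros y Hy _. apply Hd', Hy.
Qed.

Lemma cont2_continuous_on_closed (s : R -> R) (v : R -> R -> R) : cont2 v -> continuous_on_closed s v.
Proof.
intros H [x t] _. apply filterlim_locally. intros e.
destruct (cont2_eps v x t e H (cond_pos e)) as (d & Hd & Hd'). exists (mkposreal d Hd). intros [y r] [Hy Hr] _.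
apply Hd'; [exact Hy|exact Hr].
Qed.

Lemma is_derive_on_eps (D : R -> Prop) (f : R -> R) (x l e : R) : is_derive_on D f x l -> 0 < e ->
  exists d, 0 < d /\ forall y, D y -> y <> x -> Rabs (y - x) < d -> Rabs ((f y - f x) / (y - x) - l) < e.
Proof.
intros H He. apply filterlim_locally with (eps := mkposreal e He) in H.
destruct H as [d Hd]. exists d. split; [apply cond_pos|]. intros y Hy Hn Hyx. apply (Hd y Hyx Hn Hy).
Qed.

Lemma is_derive_is_derive_on (D : R -> Prop) (f : R -> R) (x l : R) : is_derive f x l -> is_derive_on D f x l.
Proof.
intros H. apply filterlim_locally. intros e. apply is_derive_Reals in H.
destruct (H e (cond_pos e)) as [d Hd]. exists d. intros y Hy Hn _.
assert (E : forall z : R, x + (z - x) = z) by (intros; ring).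
specialize (Hd (y - x)). rewrite E in Hd. apply Hd; [|exact Hy].
intros H0. apply Hn. rewrite <- (E y), H0. apply Rplus_0_r.
Qed.

Lemma is_derive_on_inside (D : R -> Prop) (f : R -> R) (a b x l : R) : a < x < b ->
  (forall y, a < y < b -> D y) -> is_derive_on D f x l -> is_derive f x l.
Proof.
intros Hx HD H. apply is_derive_Reals. intros e He.
destruct (is_derive_on_eps D f x l e H He) as (d & Hd & Hd').
set (r := Rmin d (Rmin (x - a) (b - x))).
assert (Hr : 0 < r) by (repeat apply Rmin_pos; lra).
assert (Hr2 : r <= d /\ r <= x - a /\ r <= b - x) by (unfold r, Rmin; repeat destruct Rle_dec; repeat split; lra).
exists (mkposreal r Hr). simpl. intros h Hh Hhr.
specialize (Hd' (x + h)). replace (x + h - x) with h in Hd' by ring.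
apply Hd'; [apply HD; apply Rabs_def2 in Hhr; lra|lra|lra].
Qed.

Lemma C1_on_continuous (D : R -> Prop) (f f1 : R -> R) : C1_on D f f1 -> continuous_on D f.
Proof.
intros [Hd _] x Hx. apply filterlim_locally. intros e.
destruct (is_derive_on_eps D f x (f1 x) 1 (Hd x Hx) ltac:(lra)) as (d & Hd0 & Hd').
set (K := Rabs (f1 x) + 1). pose proof (Rabs_pos (f1 x)) as Hp.
set (r := Rmin d (e / K)).
assert (Hr : 0 < r) by (apply Rmin_pos; [lra|apply Rdiv_lt_0_compat; [apply cond_pos|unfold K; lra]]).
exists (mkposreal r Hr). intros y Hy HDy. change (Rabs (f y - f x) < e). change (Rabs (y - x) < r) in Hy.
pose proof (Rmin_l d (e / K)). pose proof (Rmin_r d (e / K)). fold r in H, H0.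
destruct (Req_dec y x) as [->|Hn]; [rewrite Rminus_diag, Rabs_R0; apply cond_pos|].
specialize (Hd' y HDy Hn ltac:(lra)).
replace (f y - f x) with (((f y - f x) / (y - x) - f1 x + f1 x) * (y - x)) by (field; lra).
rewrite Rabs_mult. apply Rle_lt_trans with (K * Rabs (y - x)).
- apply Rmult_le_compat_r; [apply Rabs_pos|]. eapply Rle_trans; [apply Rabs_triang|]. unfold K. lra.
- apply Rlt_le_trans with (K * (e / K)); [apply Rmult_lt_compat_l; [unfold K|]; lra|]. apply Req_le. field. unfold K; lra.
Qed.

(** Composition with a 1-Lipschitz retraction continues a function from a half-line or a segment to
    the whole line without losing continuity. *)
Definition retraction (D : R -> Prop) (c : R -> R) : Prop :=
  (forall x, D (c x)) /\ (forall x, D x -> c x = x) /\ (forall x y, Rabs (c x - c y) <= Rabs (x - y)).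

Lemma cont1_retract (D : R -> Prop) (c f : R -> R) : retraction D c -> continuous_on D f -> cont1 (fun x => f (c x)).
Proof.
intros (Hc & _ & Hl) Hf. apply cont1_of_eps. intros x e He.
destruct (continuous_on_eps D f (c x) e Hf (Hc x) He) as (d & Hd & H).
exists d. split; [exact Hd|]. intros u Hu. apply H; [apply Hc|]. eapply Rle_lt_trans; [apply Hl|exact Hu].
Qed.

Lemma retraction_half_line : retraction half_line (Rmax 0).
Proof.
split; [|split].
- intros x; apply Rmax_l.
- intros x Hx; apply Rmax_right, Hx.
- intros x y. unfold Rmax. repeat destruct Rle_dec; unfold Rabs; repeat destruct Rcase_abs; lra.
Qed.

Lemma retraction_segment b : 0 <= b -> retraction (segment b) (clamp 0 b).
Proof.
intros Hb. split; [|split].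
- intros x; apply clamp_in, Hb.
- intros x Hx; apply clamp_id, Hx.
- apply clamp_lip.
Qed.

(** Replaces one-sided derivatives by ordinary ones: the right-hand side makes sense for every real
    [x] and is differentiable on the whole line. *)
Lemma C1_on_extension (D : R -> Prop) (c f f1 : R -> R) : retraction D c ->
  (forall x y, D x -> 0 <= y <= x -> D y) -> (forall x, D x -> 0 <= x) -> C1_on D f f1 ->
  forall x, D x -> f x = f 0 + RInt (fun r => f1 (c r)) 0 x.
Proof.
intros Hr Hconv Hpos Hf x Hx. pose proof (Hpos x Hx) as Hx0.
pose proof (C1_on_continuous D f f1 Hf) as Hcf. destruct Hf as [Hd Hc1].
pose proof (cont1_retract D c f Hr Hcf) as Hg. pose proof (cont1_retract D c f1 Hr Hc1) as Hg1.
assert (Hid : forall y, 0 <= y <= x -> c y = y) by (intros; apply Hr, (Hconv x); auto).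
rewrite (ftc_open (fun y => f (c y)) (fun y => f1 (c y)) 0 x Hx0 Hg Hg1); [rewrite !Hid by lra; ring|].
intros y Hy. rewrite (Hid y) by lra.
apply (is_derive_ext_open f _ 0 x); auto.
- intros z Hz. rewrite Hid by lra. reflexivity.
- apply (is_derive_on_inside D f 0 x); auto; [|apply Hd, (Hconv x); auto; lra]. intros z Hz. apply (Hconv x); auto; lra.
Qed.

(** The inverse of the change of variables; [k] counts derivatives in [x], each of which brings a
    factor 1 / s. *)
Definition physical (lambda : R) (s : R -> R) (g : R -> R -> R) (k : nat) (x t : R) : R :=
  exp (- (lambda * t)) * (g (x / s t) t / s t ^ k).

Lemma cont2_physical lambda s g k : cont1 s -> (forall t, s t <> 0) -> cont2 g -> cont2 (physical lambda s g k).
Proof. intros cs Hs cg. unfold physical. cont; auto. intros; apply pow_nonzero, Hs. Qed.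

(** At fixed [x] the motion of y = x / s contributes - y rho w_y, which cancels the drift; the
    exponential contributes the term with [lambda]. *)
Lemma physical_derive lambda T b F p rho w w1 w2 wt x t : 0 < b -> cont1 rho ->
  linear_solution T b F p rho w w1 w2 wt -> 0 < t < T -> 0 < x < radius b rho t ->
  is_derive (fun y => physical lambda (radius b rho) w 0 y t) x (physical lambda (radius b rho) w1 1 x t) /\
  is_derive (fun y => physical lambda (radius b rho) w1 1 y t) x (physical lambda (radius b rho) w2 2 x t) /\
  is_derive (fun r => physical lambda (radius b rho) w 0 x r) t
    (physical lambda (radius b rho) w2 2 x t - lambda * physical lambda (radius b rho) w 0 x t).
Proof.
intros Hb Hrho (((c0 & c1 & c2 & ct) & Hx & Ht) & He & _) Htt Hxx.
set (s := radius b rho) in *.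
assert (Hs' : forall r, s r <> 0) by (intros r; pose proof (radius_pos b rho r Hb); unfold s; lra).
assert (Hy : 0 < x / s t < 1).
{ split; [apply Rdiv_lt_0_compat; lra|]. apply Rmult_lt_reg_r with (s t); [lra|]. unfold Rdiv. rewrite Rmult_assoc, Rinv_l; lra. }
assert (Dl : is_derive (fun y => y / s t) x (/ s t)) by (der; ring).
destruct (Hx (x / s t) t Hy ltac:(lra)) as [D0 D1].
pose proof (derive_comp (fun z => w z t) _ x _ _ D0 Dl) as E0.
pose proof (derive_comp (fun z => w1 z t) _ x _ _ D1 Dl) as E1.
split; [|split]; unfold physical.
- der. field. apply Hs'.
- der. field. apply Hs'.
- pose proof (radius_derive b rho t Hrho) as Ds. fold s in Ds.
  assert (E : is_derive (fun r => w (x / s r) r) t (w1 (x / s t) t * (- (x / s t * rho t)) + wt (x / s t) t)).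
  { apply (is_derive_chain2 w w1 (fun r => x / s r)); auto.
    - evar_last; [apply (derive_mult (fun _ => x) (fun r => / s r)); [apply derive_const|apply derive_inv; [exact Ds|apply Hs']]|].
      field. apply Hs'.
    - set (d := Rmin (Rmin (x / s t) (1 - x / s t)) (Rmin t (T - t))).
      exists d. split; [repeat apply Rmin_pos; lra|]. intros z r Hz Hr.
      assert (d <= x / s t /\ d <= 1 - x / s t /\ d <= t /\ d <= T - t).
      { unfold d, Rmin. repeat destruct Rle_dec; repeat split; lra. }
      apply Rabs_def2 in Hz. apply Rabs_def2 in Hr. apply Hx; lra. }
  rewrite He in E by auto. change (radius b rho t) with (s t) in E.
  der; [apply pow_nonzero, Hs'|]. field. auto.
Qed.

Lemma physical_boundary lambda T b F p rho w w1 w2 wt : 0 < b ->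
  linear_solution T b F p rho w w1 w2 wt ->
  (forall t, 0 <= t <= T -> physical lambda (radius b rho) w 0 0 t = exp (- (lambda * t)) * F t /\
     physical lambda (radius b rho) w1 1 (radius b rho t) t = 0) /\
  (forall x, 0 <= x <= b -> physical lambda (radius b rho) w 0 x 0 = p x).
Proof.
intros Hb (_ & _ & Hbd & Hi). split.
- intros t Ht. pose proof (radius_pos b rho t Hb). destruct (Hbd t Ht) as [E0 E1]. unfold physical. split.
  + replace (0 / radius b rho t) with 0 by (field; lra). rewrite E0. field.
  + replace (radius b rho t / radius b rho t) with 1 by (field; lra). rewrite E1. field. lra.
- intros x Hx. unfold physical. rewrite radius_0, Hi.
  + rewrite Rmult_0_r, Ropp_0, exp_0. replace (b * (x / b)) with x by (field; lra). field.
  + apply ratio_unit; lra.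
Qed.

Lemma RInt_rescale (g : R -> R) (s : R) : cont1 g -> 0 < s ->
  RInt (fun x => g (x / s)) 0 s = s * RInt g 0 1 :> R.
Proof.
intros cg Hs.
pose proof (RInt_comp_lin g (/ s) 0 0 s) as E.
replace (/ s * 0 + 0) with 0 in E by ring. replace (/ s * s + 0) with 1 in E by (field; lra).
rewrite <- E by (apply ex_RInt_cont1, cg).
rewrite (RInt_ext (fun y => scal (/ s) (g (/ s * y + 0))) (fun y => / s * g (y / s))).
2:{ intros x _. apply (f_equal (Rmult (/ s))). f_equal. unfold Rdiv. ring. }
rewrite (RInt_scal_cont1 (fun y => g (y / s))) by (cont; intros; lra).
rewrite <- Rmult_assoc, Rinv_r, Rmult_1_l by lra. reflexivity.
Qed.

Lemma RInt_rescaled_average (lambda sigma : R) (v w : R -> R -> R) (t s : R) : 0 < s -> cont2 w ->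
  (forall x, 0 < x < s -> v x t = exp (- (lambda * t)) * w (x / s) t) ->
  RInt (fun x => v x t - sigma) 0 s = s * (exp (- (lambda * t)) * RInt (fun y => w y t) 0 1 - sigma) :> R.
Proof.
intros Hs cw E.
rewrite (RInt_ext _ (fun x => (fun y => exp (- (lambda * t)) * w y t - sigma) (x / s))).
2:{ intros x Hx. rewrite Rmin_left, Rmax_right in Hx by lra. rewrite E by exact Hx. reflexivity. }
rewrite (RInt_rescale (fun y => exp (- (lambda * t)) * w y t - sigma)) by (auto; cont).
rewrite (RInt_minus_cont1 (fun y => exp (- (lambda * t)) * w y t) (fun _ => sigma)) by cont.
rewrite (RInt_scal_cont1 (fun y => w y t)) by cont. rewrite RInt_const_R.
ring.
Qed.

(** [v] is continuous relative to the closed moving domain; rescaled and clamped it becomes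
    continuous on the plane, the form that [max_principle_moving] asks for. *)
Lemma closed_domain_rescaled (s : R -> R) (v : R -> R -> R) (r : R -> R) (T : R) : 0 <= T ->
  cont1 r -> (forall t, 0 <= t -> r t = s t) -> (forall t, 0 <= t -> 0 < s t) -> continuous_on_closed s v ->
  cont2 (fun y t => v (r (clamp 0 T t) * clamp 0 1 y) (clamp 0 T t)).
Proof.
intros HT cr Ers Hs Hv y t e.
assert (Hdom : forall y t, closed_domain s (r (clamp 0 T t) * clamp 0 1 y, clamp 0 T t)).
{ intros z q. pose proof (clamp_in 0 T q HT) as H1. pose proof (clamp_in 0 1 z ltac:(lra)) as H2.
  pose proof (Hs (clamp 0 T q) ltac:(lra)). rewrite Ers by lra. split; [|simpl; lra]. simpl. nra. }
destruct (continuous_on2_eps _ v _ _ e Hv (Hdom y t) (cond_pos e)) as (d & Hd & H).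
pose proof (cont1_clamp 0 T). pose proof (cont1_clamp 0 1).
assert (cm : cont2 (fun y t => r (clamp 0 T t) * clamp 0 1 y)) by cont.
destruct (cont2_eps _ y t d cm Hd) as (d' & Hd' & H').
assert (Hm : 0 < Rmin d d') by (apply Rmin_pos; lra).
exists (mkposreal _ Hm). simpl. intros u q Hu Hq. pose proof (Rmin_l d d'). pose proof (Rmin_r d d').
apply H; [apply Hdom|apply H'; lra|]. eapply Rle_lt_trans; [apply clamp_lip|lra].
Qed.

Theorem theorem1p1 (lambda sigma b : R) (f f1 phi phi1 phi2 : R -> R)
    (hlambda : 0 < lambda) (hsigma : 0 < sigma) (hb : 0 < b)
    (hf : C1_on half_line f f1)
    (hf_pos : forall t, 0 <= t -> 0 < f t)
    (hphi : C2_on (segment b) phi phi1 phi2)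
    (hphi_pos : forall x, 0 <= x <= b -> 0 < phi x)
    (hcompat0 : f 0 = phi 0)
    (hcompat1 : f1 0 = phi2 0 - lambda * phi 0)
    (hcompatb : phi1 b = 0) :
  exists (u : R -> R -> R) (s : R -> R),
    is_solution lambda sigma b f phi u s /\
    forall (v : R -> R -> R) (r : R -> R),
      is_solution lambda sigma b f phi v r ->
      (forall t, 0 <= t -> r t = s t) /\
      (forall x t, 0 <= x <= s t -> 0 <= t -> v x t = u x t).
Proof.
assert (hseg : forall x y, segment b x -> 0 <= y <= x -> segment b y) by (unfold segment; intros; lra).
assert (hseg0 : forall x, segment b x -> 0 <= x) by (unfold segment; intros; lra).
pose proof retraction_half_line as rh. pose proof (retraction_segment b ltac:(lra)) as rs.
destruct hphi as [hphi hphi1].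
(* Boundary and initial values are rebuilt by integrating their highest derivatives, continued as
   constants, and so become smooth on the whole line. *)
set (fh1 := fun t => f1 (Rmax 0 t)). set (fh := fun t => f 0 + RInt fh1 0 t).
assert (cfh1 : cont1 fh1) by (apply (cont1_retract half_line (Rmax 0) f1); [exact rh|apply hf]).
assert (Ef : forall t, 0 <= t -> fh t = f t).
{ intros t Ht. symmetry. apply (C1_on_extension half_line (Rmax 0) f f1); auto.
  unfold half_line; intros; lra. }
assert (Dfh : forall t, is_derive fh t (fh1 t)).
{ intros t. unfold fh. pose proof (is_derive_RInt_cont1 fh1 0 t cfh1). der. ring. }
set (p2 := fun x => phi2 (clamp 0 b x)). set (p1 := fun x => phi1 0 + RInt p2 0 x). set (p := fun x => phi 0 + RInt p1 0 x).
assert (cp2 : cont1 p2) by (apply (cont1_retract (segment b) (clamp 0 b) phi2); [exact rs|apply hphi1]).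
assert (Dp1 : forall x, is_derive p1 x (p2 x)).
{ intros x. unfold p1. pose proof (is_derive_RInt_cont1 p2 0 x cp2). der. ring. }
assert (cp1 : cont1 p1) by (apply (cont1_derive _ p2), Dp1).
assert (Dp : forall x, is_derive p x (p1 x)).
{ intros x. unfold p. pose proof (is_derive_RInt_cont1 p1 0 x cp1). der. ring. }
assert (Ep1 : forall x, 0 <= x <= b -> p1 x = phi1 x).
{ intros x Hx. symmetry. apply (C1_on_extension (segment b) (clamp 0 b) phi1 phi2); auto. }
assert (Ep : forall x, 0 <= x <= b -> p x = phi x).
{ intros x Hx. rewrite (C1_on_extension (segment b) (clamp 0 b) phi phi1 rs hseg hseg0 hphi x Hx).
  unfold p. f_equal. apply RInt_ext. intros y Hy. rewrite Rmin_left, Rmax_right in Hy by lra.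
  rewrite clamp_id by lra. apply Ep1; lra. }
set (F := fun t => exp (lambda * t) * fh t).
set (F1 := fun t => lambda * exp (lambda * t) * fh t + exp (lambda * t) * fh1 t).
assert (cfh : cont1 fh) by (apply (cont1_derive _ fh1), Dfh).
assert (DF : forall t, is_derive F t (F1 t)).
{ intros t. specialize (Dfh t). unfold F, F1. der. ring. }
assert (cF1 : cont1 F1) by (unfold F1; cont).
assert (EF0 : F 0 = p 0).
{ unfold F. rewrite Rmult_0_r, exp_0, Ef, Ep by lra. lra. }
(* The factor exp (lambda t) absorbs [lambda] from the compatibility condition: at the corner the
   time derivative equals the second space derivative. *)
assert (EF1 : F1 0 = p2 0).
{ unfold F1, fh1, p2. rewrite Rmult_0_r, exp_0, Ef, Rmax_left, clamp_id by lra. rewrite hcompat0; lra. }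
assert (Epb : p1 b = 0) by (rewrite Ep1 by lra; exact hcompatb).
assert (EF : forall t, 0 <= t -> exp (- (lambda * t)) * F t = f t).
{ intros t Ht. unfold F. rewrite <- Rmult_assoc, <- exp_plus, Ef by exact Ht.
  replace (- (lambda * t) + lambda * t) with 0 by ring. rewrite exp_0. ring. }
destruct (free_solution_global b lambda sigma F F1 p p1 p2) as (rho & w & w1 & w2 & wt & Hglob); auto; [lra|].
destruct (Hglob 1 ltac:(lra)) as (crho & (((cw & cw1 & cw2 & _) & _) & _) & _).
set (s := radius b rho).
assert (Hs : forall t, 0 < s t) by (intros; apply radius_pos, hb).
assert (Hs0 : forall t, s t <> 0) by (intros t; specialize (Hs t); lra).
pose proof (cont1_radius b rho crho) as cs. fold s in cs.
set (u := physical lambda s w 0). set (ux := physical lambda s w1 1). set (uxx := physical lambda s w2 2).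
assert (cu : cont2 u) by (apply cont2_physical; auto).
assert (cux : cont2 ux) by (apply cont2_physical; auto).
assert (cuxx : cont2 uxx) by (apply cont2_physical; auto).
exists u, s. split.
- split; [auto|]. split; [apply cont2_continuous_on_closed, cu|].
  exists (fun t => rho t * s t), ux, (fun x t => uxx x t - lambda * u x t), uxx.
  split; [|split; [|split; [|split; [|split; [|split; [|split]]]]]].
  + split; [intros t _; apply is_derive_is_derive_on, radius_derive, crho|].
    apply cont1_continuous_on. cont.
  + split; [|repeat split; apply cont2_continuous_on_closed; cont].
    intros x t [Hx Ht]. simpl in Hx, Ht. destruct (Hglob (t + 1) ltac:(lra)) as (_ & Hlin & _).
    destruct (physical_derive lambda (t + 1) b F p rho w w1 w2 wt x t hb crho Hlin ltac:(lra) Hx) as (D0 & D1 & Dt).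
    split; [exact D0|split; [exact Dt|exact D1]].
  + intros x t _ _. ring.
  + intros t Ht. destruct (Hglob t Ht) as (_ & _ & E). rewrite (E t) by lra.
    rewrite (RInt_rescaled_average lambda sigma u w); auto; [ring|].
    intros x _. unfold u, physical. simpl. field.
  + intros t Ht. destruct (Hglob (t + 1) ltac:(lra)) as (_ & Hlin & _).
    destruct (physical_boundary lambda (t + 1) b F p rho w w1 w2 wt hb Hlin) as [Hb0 _].
    rewrite <- EF by exact Ht. apply Hb0; lra.
  + intros x Hx. destruct (Hglob 1 ltac:(lra)) as (_ & Hlin & _).
    destruct (physical_boundary lambda 1 b F p rho w w1 w2 wt hb Hlin) as [_ Hi]. unfold u. rewrite <- Ep by exact Hx. apply Hi, Hx.
  + apply radius_0.
  + intros t Ht. destruct (Hglob (t + 1) ltac:(lra)) as (_ & Hlin & _).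
    destruct (physical_boundary lambda (t + 1) b F p rho w w1 w2 wt hb Hlin) as [Hb0 _]. apply Hb0; lra.
- intros v r (Hr & cv & r1 & vx & vt & vxx & HC1 & (HP & cvx & _) & Hpde & Hr1 & Hv0 & Hvi & Hr0 & Hvn).
  set (g := fun t => r (Rmax 0 t)). set (g1 := fun t => r1 (Rmax 0 t)).
  assert (cg : cont1 g) by (apply (cont1_retract half_line (Rmax 0) r); [exact rh|apply (C1_on_continuous _ _ r1), HC1]).
  assert (cg1 : cont1 g1) by (apply (cont1_retract half_line (Rmax 0) r1); [exact rh|apply HC1]).
  assert (Hg : forall t, 0 < g t) by (intros t; apply Hr, Rmax_l).
  assert (Hg0 : forall t, g t <> 0) by (intros t; specialize (Hg t); lra).
  (* The logarithmic derivative of the competing boundary, from which [Erad] below recovers the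
     boundary itself. *)
  set (rv := fun t => g1 t / g t). assert (crv : cont1 rv) by (unfold rv; cont; auto).
  assert (Eg : forall t, 0 <= t -> g t = r t) by (intros t Ht; unfold g; rewrite Rmax_right by exact Ht; auto).
  assert (Dr : forall t, 0 < t -> is_derive r t (r1 t)).
  { intros t Ht. apply (is_derive_on_inside half_line r 0 (t + 1)); [lra|unfold half_line; intros; lra|].
    apply HC1. unfold half_line; lra. }
  assert (Erad : forall t, 0 <= t -> r t = radius b rv t).
  { intros t Ht. pose proof (ftc_open (fun t => g t * exp (- RInt rv 0 t)) (fun _ => 0) 0 t Ht) as E.
    rewrite RInt_const_R, RInt_point_R in E.
    pose proof (cont1_RInt rv 0 crv) as cI.
    assert (K : (t - 0) * 0 = g t * exp (- RInt rv 0 t) - g 0 * exp (- 0)).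
    { apply E; [cont|cont|]. intros z Hz.
      assert (Dg : is_derive g z (g1 z)).
      { unfold g1. rewrite Rmax_right by lra. apply (is_derive_ext_open r _ 0 (z + 1)); [lra| |apply Dr; lra].
        intros y Hy. symmetry. apply Eg. lra. }
      pose proof (is_derive_RInt_cont1 rv 0 z crv). der. unfold rv. field. apply Hg0. }
    rewrite !Eg, Hr0, Ropp_0, exp_0 in K by lra.
    unfold radius. rewrite <- (Rmult_1_r (r t)), <- exp_0.
    replace 0 with (- RInt rv 0 t + RInt rv 0 t) at 1 by ring. rewrite exp_plus, <- Rmult_assoc. f_equal. lra. }
  assert (Hmain : forall T, 0 < T -> (forall t, 0 <= t <= T -> rv t = rho t) /\
    forall x t, 0 <= t <= T -> 0 <= x <= r t -> v x t = u x t).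
  { intros T HT.
    destruct (bounded1 rv 0 T crv) as (L & HL & HLb); [lra|].
    (* A linear solution for the competitor's own boundary, with the regularity that [free_solution]
       demands; the competitor will be shown to coincide with it. *)
    destruct (linear_solution_exists T b L F F1 p p1 p2) as [C HC]; auto; try lra.
    destruct (HC rv crv HLb) as (z & z1 & z2 & zt & Hz & _). clear HC.
    set (sv := radius b rv) in *. pose proof (cont1_radius b rv crv) as csv. fold sv in csv.
    assert (Hsv : forall t, 0 < sv t) by (intros; apply radius_pos, hb).
    assert (Hsv0 : forall t, sv t <> 0) by (intros t; specialize (Hsv t); lra).
    assert (cz : cont2 z /\ cont2 z1) by (split; apply Hz). destruct cz as [cz cz1].
    set (q := physical lambda sv z 0). set (qx := physical lambda sv z1 1). set (qxx := physical lambda sv z2 2).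
    assert (cq : cont2 q) by (apply cont2_physical; auto). assert (cqx : cont2 qx) by (apply cont2_physical; auto).
    destruct (physical_boundary lambda T b F p rv z z1 z2 zt hb Hz) as [Hqb Hqi].
    assert (Hvq : forall sg, (sg = 1 \/ sg = -1) -> forall x t, 0 <= t <= T -> 0 <= x <= sv t -> sg * (v x t - q x t) <= 0).
    { intros sg Hsg.
      apply (max_principle_moving T 0 sv (fun x t => sg * (v x t - q x t)) (fun x t => sg * (vx x t - qx x t))
        (fun x t => sg * (vxx x t - qxx x t)) (fun x t => sg * (vt x t - (qxx x t - lambda * q x t)))
        (fun _ _ => 1) (fun _ _ => 0) (fun _ => 0) (fun _ => 0)); auto; try lra.
      - cont.
      - pose proof (closed_domain_rescaled r v sv T ltac:(lra) csv (fun t Ht => eq_sym (Erad t Ht)) Hr cv) as c1.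
        pose proof (cont1_clamp 0 T). pose proof (cont1_clamp 0 1).
        apply cont2_mult; [cont|]. apply cont2_minus; [exact c1|cont].
      - intros x t Ht Hx.
        destruct (physical_derive lambda T b F p rv z z1 z2 zt x t hb crv Hz Ht Hx) as (D0 & D1 & Dt).
        fold sv in D0, D1, Dt. fold q in D0, Dt. fold qx in D0, D1. fold qxx in D1, Dt. fold (q x t) in Dt.
        destruct (HP x t) as (E0 & Et & E1); [split; simpl; [rewrite Erad by lra; exact Hx|lra]|].
        split; [|split]; der; ring.
      (* The difference satisfies the heat equation with the extra term [- lambda] times itself,
         which has the right sign where the difference is positive. *)
      - intros x t Ht Hx. split; [lra|]. split; [rewrite Rabs_R0; lra|]. intros Hpos.
        rewrite Hpde by (try rewrite Erad by lra; auto; lra). nra.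
      - intros t e Ht He.
        assert (Hin : closed_domain r (sv t, t)) by (split; simpl; [rewrite Erad by lra; fold sv; specialize (Hsv t); lra|lra]).
        destruct (continuous_on2_eps _ vx (sv t) t (e / 2) cvx Hin) as (d & Hd & H); [lra|].
        assert (cqt : cont1 (fun x => qx x t)) by cont.
        destruct (cont1_eps _ (sv t) (e / 2) cqt) as (d' & Hd' & H'); [lra|].
        exists (Rmin d d'). split; [apply Rmin_pos; auto|]. intros x Hx0 Hx.
        pose proof (Rmin_l d d'). pose proof (Rmin_r d d').
        assert (Hvx0 : vx (sv t) t = 0) by (unfold sv; rewrite <- Erad by lra; apply Hvn; lra).
        assert (Hqx0 : qx (sv t) t = 0) by (apply Hqb; lra).
        specialize (H x t). specialize (H' x). rewrite Hvx0, Rminus_0_r in H. rewrite Hqx0, Rminus_0_r in H'.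
        assert (A : Rabs (vx x t) < e / 2).
        { apply H; [split; simpl; [rewrite Erad by lra; fold sv; lra|lra]|apply Rabs_def1; lra|rewrite Rminus_diag, Rabs_R0; exact Hd]. }
        assert (B : Rabs (qx x t) < e / 2) by (apply H'; apply Rabs_def1; lra).
        apply Rabs_def2 in A. apply Rabs_def2 in B. destruct Hsg as [-> | ->]; lra.
      - intros t _. apply derive_const.
      - intros; lra.
      - intros t Ht. rewrite Hv0 by lra. unfold q, sv. rewrite (proj1 (Hqb t Ht)), EF by lra. lra.
      - intros x Hx. unfold sv in Hx. rewrite radius_0 in Hx. rewrite Hvi by exact Hx. unfold q, sv. rewrite Hqi, Ep by exact Hx. lra. }
    assert (Evq : forall x t, 0 <= t <= T -> 0 <= x <= sv t -> v x t = q x t).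
    { intros x t Ht Hx. pose proof (Hvq 1 (or_introl eq_refl) x t Ht Hx). pose proof (Hvq (-1) (or_intror eq_refl) x t Ht Hx). lra. }
    assert (Hfree : free_solution T b lambda sigma F p rv z z1 z2 zt).
    { split; [exact crv|]. split; [exact Hz|].
      assert (Hpos : forall t, 0 < t < T -> rv t = exp (- (lambda * t)) * RInt (fun y => z y t) 0 1 - sigma).
      { intros t Ht. unfold rv, g1. rewrite Rmax_right, Hr1, Eg by lra.
        rewrite Erad by lra. fold sv.
        rewrite (RInt_rescaled_average lambda sigma v z); auto; [field; apply Hsv0|].
        intros x Hx. rewrite Evq by lra. unfold q, physical. simpl. field. }
      pose proof (cont1_RInt_param z 0 1 cz ltac:(lra)) as cI.
      intros t Ht.
      (* The identity holds inside (0, T) and extends to the end times by continuity; the space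
         variable is a dummy. *)
      apply (rect_closure 1 T (fun _ t => rv t) (fun _ t => exp (- (lambda * t)) * RInt (fun y => z y t) 0 1 - sigma))
        with (x := 0); try lra; [cont| |auto|split; lra].
      apply cont2_minus; [apply cont2_mult; [cont|]|cont].
      apply (cont2_comp1 (fun t => RInt (fun y => z y t) 0 1) (fun _ t => t)); cont. }
    destruct (free_solution_unique T b lambda sigma F p _ _ _ _ _ _ _ _ _ _ HT hb ltac:(lra) Hfree (Hglob T HT)) as [E1 E2].
    split; [exact E1|]. intros x t Ht Hx. rewrite Erad in Hx by lra. rewrite Evq by auto.
    unfold q, u, physical. assert (Es : sv t = s t) by (apply (radius_ext b rv rho T); auto).
    rewrite Es, E2; [reflexivity|]. rewrite <- Es. split; [|exact Ht]. fold sv in Hx. specialize (Hsv t).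
    apply ratio_unit; lra. }
  assert (Ers : forall t, 0 <= t -> r t = s t).
  { intros t Ht. rewrite Erad by exact Ht. apply (radius_ext b rv rho (t + 1)); [|lra].
    apply (Hmain (t + 1)). lra. }
  split; [exact Ers|]. intros x t Hx Ht. apply (Hmain (t + 1)); try lra. rewrite Ers by exact Ht. exact Hx.
Qed.
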